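(* Let $Y$ be a closed subset of a smooth manifold $X$ and let $I:=\mathcal J^\infty(Y;X)$. Then the chain complex $(I^{\otimes n},b')_{n\ge1}$ has a bounded contracting homotopy, that is, $I$ is homologically unital for any exact category structure on the category of Fréchet spaces.
   Context: $\mathcal J^\infty(Y;X)$ is the closed ideal in the Fréchet algebra $C^\infty(X)$ of smooth functions on $X$ consisting of all functions that are flat on $Y$, i.e. whose Taylor series vanishes at every point of $Y$. $\otimes$ is the complete projective topological tensor product of Fréchet spaces, and $b'(x_1\otimes\dotsb\otimes x_n)=\sum_{j=1}^{n-1}(-1)^{j-1}x_1\otimes\dotsb\otimes x_jx_{j+1}\otimes\dotsb\otimes x_n$. A bounded contracting homotopy consists of continuous linear maps $s_n\colon I^{\otimes n}\to I^{\otimes n+1}$, $n\ge1$, with $b's_1=\mathrm{Id}$ and $b's_n+s_{n-1}b'=\mathrm{Id}$ for $n\ge2$. Given an exact category structure (class of conflations, in Quillen's sense) on the category of Fréchet spaces, a chain complex $(C_n,d_n)$ is exact if $d_{n+1}$ induces a deflation $C_{n+1}\to\ker d_n$ for all $n$ (a deflation being the second map of a conflation). An algebra $I$ is homologically unital if $(I^{\otimes n},b')_{n\ge1}\otimes V$ is exact for every Fréchet space $V$. *)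

(* Defs.v *)
From Stdlib Require List.
From HB Require Import structures.
From mathcomp Require Import all_boot all_order all_algebra.
From mathcomp Require Import complex interval_inference.
From mathcomp Require Import mathcomp_extra boolp classical_sets functions.
From mathcomp Require Import reals topology convex normedtype derive.

Set Implicit Arguments.
Unset Strict Implicit.
Unset Printing Implicit Defensive.
Import Order.TTheory GRing.Theory Num.Theory.
Import numFieldTopology.Exports numFieldNormedType.Exports.
Local Open Scope classical_set_scope.
Local Open Scope ring_scope.
Local Open Scope complex_scope.

Section Partials.
Variables (R : realType) (m : nat).
Implicit Types (g h : 'rV[R]_m -> R) (U : set 'rV[R]_m) (s : seq 'I_m).

Definition pder s g : 'rV[R]_m -> R :=
  foldr (fun i h x => 'D_(delta_mx 0 i) h x) g s.

Definition diff_on n U g :=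
  forall s, (size s <= n)%N -> forall x, U x ->
    {for x, continuous (pder s g)} /\
    forall i, derivable (pder s g) x (delta_mx 0 i).

Definition smooth_on U g := forall n, diff_on n U g.

Definition flat_at g (x : 'rV[R]_m) := forall s, pder s g x = 0.

Lemma eq_pder U g h : open U -> (forall x, U x -> g x = h x) ->
  forall s x, U x -> pder s g x = pder s h x.
Proof.
move=> oU gh; elim=> [|i s IH] x Ux /=; first exact: gh.
apply: near_eq_derive; near=> y; apply: IH.
by near: y; exact: open_nbhs_nbhs.
Unshelve. all: by end_near. Qed.

Lemma near_eq_for_continuous (f f' : 'rV[R]_m -> R) x :
  (\forall y \near x, f y = f' y) ->
  {for x, continuous f} -> {for x, continuous f'}.
Proof.
move=> ff' cf; rewrite /prop_for /continuous_at -(nbhs_singleton ff').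
exact: cvg_trans (near_eq_cvg ff') cf.
Qed.

Lemma eq_diff_on n U g h : open U -> (forall x, U x -> g x = h x) ->
  diff_on n U g -> diff_on n U h.
Proof.
move=> oU gh sg s sn x Ux; have [cg dg] := sg s sn x Ux.
have nU : \forall y \near x, pder s g y = pder s h y.
  by near=> y; apply: (eq_pder oU gh); near: y; exact: open_nbhs_nbhs.
split=> [|i]; first exact: near_eq_for_continuous cg.
exact: near_eq_derivable (dg i).
Unshelve. all: by end_near. Qed.

Lemma pder_lin n U g h a b : open U -> diff_on n U g -> diff_on n U h ->
  forall s, (size s <= n)%N -> forall x, U x ->
  pder s (fun y => a * g y + b * h y) x = a * pder s g x + b * pder s h x.
Proof.
move=> oU sg sh; elim=> [//|i s IH] sn x Ux /=.
have [_ /(_ i) dg] := sg s (ltnW sn) x Ux.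
have [_ /(_ i) dh] := sh s (ltnW sn) x Ux.
transitivity ('D_(delta_mx 0 i) (a \*: pder s g + b \*: pder s h) x).
  apply: near_eq_derive; near=> y; rewrite IH ?(ltnW sn) //.
  by near: y; exact: open_nbhs_nbhs.
by rewrite deriveD ?deriveZ //; apply: derivableZ.
Unshelve. all: by end_near. Qed.

Lemma diff_on_lin n U g h a b : open U -> diff_on n U g -> diff_on n U h ->
  diff_on n U (fun y => a * g y + b * h y).
Proof.
move=> oU sg sh s sn x Ux.
have [cg dg] := sg s sn x Ux; have [ch dh] := sh s sn x Ux.
have E : \forall y \near x,
    (a \*: pder s g + b \*: pder s h) y =
    pder s (fun y => a * g y + b * h y) y.
  near=> y; rewrite (pder_lin _ _ oU sg sh) //.
  by near: y; exact: open_nbhs_nbhs.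
split=> [|i]; last first.
  by apply: near_eq_derivable E _; apply: derivableD; apply: derivableZ.
apply: near_eq_for_continuous E _; apply: continuousD.
  exact: (@cvgZl_tmp _ R^o _ _ _ a _ _ cg).
exact: (@cvgZl_tmp _ R^o _ _ _ b _ _ ch).
Unshelve. all: by end_near. Qed.

Lemma pder_rcons s i g : pder (rcons s i) g = pder s (pder [:: i] g).
Proof. by rewrite /pder foldr_rcons. Qed.

Lemma diff_on_pder n U i g : diff_on n.+1 U g -> diff_on n U (pder [:: i] g).
Proof.
by move=> sg s sn x Ux; rewrite -pder_rcons; apply: sg; rewrite ?size_rcons.
Qed.

Lemma diff_onW n U g : diff_on n.+1 U g -> diff_on n U g.
Proof. by move=> sg s sn; apply: sg; exact: leqW. Qed.

Lemma pder1M n U i g h : diff_on n U g -> diff_on n U h ->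
  forall x, U x -> pder [:: i] (fun y => g y * h y) x =
    1 * (g x * pder [:: i] h x) + 1 * (pder [:: i] g x * h x).
Proof.
move=> sg sh x Ux.
have [_ /(_ i) dg] := sg [::] (leq0n _) x Ux.
have [_ /(_ i) dh] := sh [::] (leq0n _) x Ux.
have := deriveM dg dh; rewrite /= !mul1r => ->.
by congr (_ + _); rewrite mulrC.
Qed.

Lemma diff_onM n U g h : open U -> diff_on n U g -> diff_on n U h ->
  diff_on n U (fun y => g y * h y).
Proof.
move=> oU; elim: n g h => [|n IH] g h sg sh s.
  case: s => // _ x Ux.
  have [cg dg] := sg [::] (leq0n _) x Ux; have [ch dh] := sh [::] (leq0n _) x Ux.
  by split=> [|i]; [exact: (cvgM cg ch)|exact: (derivableM (dg i) (dh i))].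
case/lastP: s => [_ x Ux|s i].
  have [cg dg] := sg [::] (leq0n _) x Ux; have [ch dh] := sh [::] (leq0n _) x Ux.
  by split=> [|i]; [exact: (cvgM cg ch)|exact: (derivableM (dg i) (dh i))].
rewrite size_rcons ltnS => sn; rewrite pder_rcons.
suff : diff_on n U (pder [:: i] (fun y => g y * h y)) by apply.
have := diff_on_lin 1 1 oU (IH _ _ (diff_onW sg) (diff_on_pder i sh))
                         (IH _ _ (diff_on_pder i sg) (diff_onW sh)).
by apply: eq_diff_on => // x Ux; rewrite (pder1M _ sg sh).
Qed.

Lemma flat_atM U g h x : open U -> smooth_on U g -> smooth_on U h -> U x ->
  flat_at g x -> flat_at (fun y => g y * h y) x.
Proof.
move=> oU + + Ux + s; elim/last_ind: s g h => [|s i IH] g h sg sh fg.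
  by have /= -> := fg [::]; rewrite mul0r.
have sg' : smooth_on U (pder [:: i] g) by move=> n; exact: diff_on_pder.
have sh' : smooth_on U (pder [:: i] h) by move=> n; exact: diff_on_pder.
rewrite pder_rcons (eq_pder oU (pder1M i (sg 0) (sh 0)))//.
rewrite (@pder_lin (size s) U)// ?IH ?mulr0 ?addr0 //; try exact: diff_onM.
by move=> t; rewrite -pder_rcons.
Qed.
End Partials.

(* The ground field: the complex numbers if cplx, the real numbers otherwise;
   [Kmk a b] is a + ib, the imaginary part being dropped in the real case. *)
Definition base_field (R : realType) (cplx : bool) : numFieldType :=
  if cplx then (R[i] : numFieldType) else (R : numFieldType).

Section Scalars.
Variables (R : realType) (cplx : bool).
Local Notation K := (base_field R cplx).

Definition Kre : K -> R :=
  match cplx return base_field R cplx -> R with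
  | true => fun z : R[i] => complex.Re z | false => fun x : R => x end.

Definition Kim : K -> R :=
  match cplx return base_field R cplx -> R with
  | true => fun z : R[i] => complex.Im z | false => fun x : R => 0 end.

Definition Kmk : R -> R -> K :=
  match cplx return R -> R -> base_field R cplx with
  | true => fun a b => (a +i* b)%C | false => fun a _ => a end.

Definition Kabs (z : K) : R := Kre `|z|.

End Scalars.
Arguments Kre {R cplx}.
Arguments Kim {R cplx}.
Arguments Kabs {R cplx}.

Section ScalarTheory.
Variables (R : realType) (cplx : bool).
Local Notation K := (base_field R cplx).
Local Notation mk := (@Kmk R cplx).
Implicit Types (x y z : K) (a b : R).

Lemma KreD x y : Kre (x + y) = Kre x + Kre y.
Proof. by case: cplx x y => [[? ?] [? ?]|? ?]. Qed.

Lemma KimD x y : Kim (x + y) = Kim x + Kim y.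
Proof. by case: cplx x y => [[? ?] [? ?]|? ?] //=; rewrite addr0. Qed.

Lemma KreM x y : Kre (x * y) = Kre x * Kre y + (- Kim x) * Kim y.
Proof.
by case: cplx x y => [[? ?] [? ?]|? ?] //=; rewrite ?mulNr // mulr0 subr0.
Qed.

Lemma KimM x y : Kim (x * y) = Kre x * Kim y + Kim x * Kre y.
Proof. by case: cplx x y => [[? ?] [? ?]|? ?] //=; rewrite mulr0 mul0r addr0. Qed.

Lemma Kre0 : Kre (0 : K) = 0.
Proof. by case: cplx. Qed.

Lemma Kim0 : Kim (0 : K) = 0.
Proof. by case: cplx. Qed.

Lemma KmkD a b a' b' : mk (a + a') (b + b') = mk a b + mk a' b'.
Proof. by case: cplx. Qed.

Lemma KmkM z a b :
  mk (Kre z * a + - Kim z * b) (Kre z * b + Kim z * a) = z * mk a b.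
Proof.
case: cplx z => [[x y]|z] /=; last by rewrite mulNr mul0r subr0.
by rewrite mulNr.
Qed.

Lemma KabsE z : `|z| = mk (Kabs z) 0.
Proof. by rewrite /Kabs; case: cplx z => [[a b]|z]. Qed.

Lemma Kmk_le a b : (mk a 0 <= mk b 0) = (a <= b).
Proof. by case: cplx => //=; rewrite lecR. Qed.

Lemma Kmk_lt a b : (mk a 0 < mk b 0) = (a < b).
Proof. by case: cplx => //=; rewrite ltcR. Qed.

Lemma Kabs_ge0 z : 0 <= Kabs z.
Proof.
by rewrite -Kmk_le -KabsE (_ : mk 0 0 = 0) ?normr_ge0 //; case: cplx.
Qed.

Lemma Kabs0 : Kabs (0 : K) = 0.
Proof. by rewrite /Kabs normr0 Kre0. Qed.

Lemma KabsD x y : Kabs (x + y) <= Kabs x + Kabs y.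
Proof.
by have := ler_normD x y; rewrite !KabsE -KmkD addr0 Kmk_le.
Qed.

Lemma KabsM x y : Kabs (x * y) = Kabs x * Kabs y.
Proof.
rewrite /Kabs normrM KreM [Kim `|x|](_ : _ = 0) ?oppr0 ?mul0r ?addr0 //.
by rewrite KabsE; case: cplx {y} x.
Qed.

Lemma Kabs_mk_le a b : Kabs (mk a b) <= `|a| + `|b|.
Proof.
have [Ka Kb] : Kabs (mk a 0) = `|a| /\ Kabs (mk 0 b) <= `|b|.
  rewrite /Kabs; case: cplx => /=; last by rewrite normr0.
  by rewrite expr0n /= addr0 add0r !sqrtr_sqr.
rewrite -{1}[a]addr0 -{1}[b]add0r KmkD -Ka; apply: (le_trans (KabsD _ _)).
by rewrite lerD2l.
Qed.

End ScalarTheory.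

Record seminorm_family (R : realType) (cplx : bool)
    (E : lmodType (base_field R cplx)) := SeminormFamily {
  sn_index : Type;
  sn :> sn_index -> E -> R;
  snD : forall j x y, sn j (x + y) <= sn j x + sn j y;
  snZ : forall j (a : base_field R cplx) x, sn j (a *: x) = Kabs a * sn j x
}.

(* E with the locally convex topology defined by the seminorms in P *)
Definition seminormed (R : realType) (cplx : bool)
  (E : lmodType (base_field R cplx)) (P : seminorm_family E) : Type := E.

Section SeminormTopology.
Variables (R : realType) (cplx : bool) (E : lmodType (base_field R cplx)).
Variable P : seminorm_family E.
Local Notation T := (seminormed P).

HB.instance Definition _ := GRing.Lmodule.copy T E.

Definition sn_ball (s : seq (sn_index P)) (e : R) (x : T) : set T :=
  [set y | forall j, List.In j s -> P j (y - x) < e].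

Definition sn_nbhs (x : T) : set_system T :=
  [set U | exists s e, 0 < e /\ sn_ball s e x `<=` U].

HB.instance Definition _ := hasNbhs.Build T sn_nbhs.

Lemma sn0 j : P j 0 = 0.
Proof. by rewrite -(scale0r 0) snZ Kabs0 mul0r. Qed.

Lemma snN j (x : E) : P j (- x) = P j x.
Proof. by rewrite -scaleN1r snZ /Kabs normrN1 (_ : Kre 1 = 1) ?mul1r //; case: cplx. Qed.

Lemma sn_ge0 j (x : E) : 0 <= P j x.
Proof.
have := snD j x (- x); rewrite subrr sn0 snN -mulr2n.
by rewrite pmulrn_lge0.
Qed.

Lemma sn_ballxx s e x : 0 < e -> sn_ball s e x x.
Proof. by move=> e0 j _; rewrite subrr sn0. Qed.

Lemma sn_ball_nbhs s e x y : sn_ball s e x y -> sn_nbhs y (sn_ball s e x).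
Proof.
move=> xy.
have [d [d0 yd]] : exists d, 0 < d /\
    forall j, List.In j s -> P j (y - x) + d <= e.
  elim: s xy => [|i s IH] xy; first by exists 1.
  have [j js|d [d0 yd]] := IH; first by apply: xy; right.
  exists (Num.min d (e - P i (y - x))); split.
    by rewrite lt_min d0 subr_gt0; apply: xy; left.
  move=> j /= [<-|js]; first by rewrite -lerBrDl ge_min lexx orbT.
  by apply: le_trans (yd j js); rewrite lerD2l ge_min lexx.
exists s, d; split=> // z yz j js.
rewrite -(subrK y z) -addrA; apply: le_lt_trans (snD j _ _) _.
by apply: lt_le_trans (yd j js); rewrite [ltLHS]addrC ltrD2l; exact: yz.
Qed.

Lemma sn_nbhs_filter (x : T) : ProperFilter (nbhs x).
Proof.
split; first by move=> [s [e [e0 /(_ x)]]]; apply; exact: sn_ballxx.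
split.
- by exists [::], 1; split.
- move=> U V [s [e [e0 sU]]] [t [d [d0 tV]]].
  exists (s ++ t), (Num.min e d); split; first by rewrite lt_min e0.
  move=> y xy; split; [apply: sU|apply: tV] => j js.
    have := xy j; rewrite lt_min => /(_ _)/andP[]//.
    by apply/List.in_or_app; left.
  have := xy j; rewrite lt_min => /(_ _)/andP[]//.
  by apply/List.in_or_app; right.
- by move=> U V UV [s [e [e0 sU]]]; exists s, e; split=> // y /sU/UV.
Qed.

Lemma sn_nbhs_singleton (x : T) (A : set T) : nbhs x A -> A x.
Proof. by move=> [s [e [e0]]]; apply; exact: sn_ballxx. Qed.

Lemma sn_nbhs_nbhs (x : T) (A : set T) : nbhs x A -> nbhs x (nbhs^~ A).
Proof.
move=> [s [e [e0 sA]]]; exists s, e; split=> // y /sn_ball_nbhs.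
by move=> [t [d [d0 tB]]]; exists t, d; split=> // z /tB/sA.
Qed.

HB.instance Definition _ := Nbhs_isNbhsTopological.Build T
  sn_nbhs_filter sn_nbhs_singleton sn_nbhs_nbhs.

Lemma sn_add_continuous : continuous (fun x : T * T => x.1 + x.2).
Proof.
move=> [x y] U [s [e [e0 sU]]].
exists (sn_ball s (e / 2) x, sn_ball s (e / 2) y) => /=.
  by split; exists s, (e / 2); split=> //; rewrite divr_gt0.
move=> [x' y'] /= [xx' yy']; apply: sU => j js.
rewrite opprD addrACA; apply: le_lt_trans (snD j _ _) _.
by rewrite [e]splitr ltrD ?xx' ?yy'.
Qed.

Lemma sn_scale_continuous :
  continuous (fun z : (base_field R cplx)^o * T => z.1 *: z.2).
Proof.
move=> [a x] U [s [e [e0 sU]]].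
have [M [M0 xM]] : exists M, 0 < M /\ forall j, List.In j s -> P j x <= M.
  elim: s {sU} => [|i s [M [M0 sM]]]; first by exists 1.
  exists (Num.max M (P i x)); split; first by rewrite lt_max M0.
  by move=> j /= [<-|/sM jM]; rewrite le_max ?jM// lexx orbT.
pose N := Kabs a + 1; have N0 : 0 < N by rewrite ltr_wpDl ?Kabs_ge0.
pose d := Num.min 1 (e / 2 / M).
have d0 : 0 < d by rewrite lt_min ltr01 !divr_gt0.
exists (ball (a : (base_field R cplx)^o) (Kmk cplx d 0), sn_ball s (e / 2 / N) x) => /=.
  split; last by exists s, (e / 2 / N); split=> //; rewrite !divr_gt0.
  apply: nbhsx_ballx.
  by rewrite (_ : 0 = Kmk cplx 0 0) ?Kmk_lt //; case: cplx.
move=> [b y] /= [ab xy]; apply: sU => j js.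
move: ab; rewrite -ball_normE /= distrC KabsE Kmk_lt lt_min => /andP[ab1 ab].
rewrite (_ : b *: y - a *: x = b *: (y - x) + (b - a) *: x); last first.
  by rewrite scalerBr scalerBl addrA subrK.
apply: le_lt_trans (snD j _ _) _; rewrite !snZ [e]splitr.
have bN : Kabs b <= N.
  by rewrite -[b](subrK a) addrC (le_trans (KabsD _ _))// lerD2l ltW.
apply: ltr_leD.
  apply: le_lt_trans (_ : N * P j (y - x) < _).
    by rewrite ler_wpM2r ?sn_ge0.
  by rewrite mulrC -ltr_pdivlMr //; exact: xy.
apply: le_trans (_ : Kabs (b - a) * M <= _).
  by rewrite ler_wpM2l ?Kabs_ge0 ?xM.
by rewrite -ler_pdivlMr ?ltW.
Qed.

Lemma sn_locally_convex : exists2 B : set_system T,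
  (forall b, b \in B -> convex_set b) & basis B.
Proof.
exists [set U | exists s e x, U = sn_ball s e x]; last first.
  split=> [U [s [e [x ->]]]|x U [s [e [e0 sU]]]].
    by rewrite openE => y /sn_ball_nbhs.
  exists (sn_ball s e x) => //; split; first by exists s, e, x.
  exact: sn_ballxx.
move=> U /[!inE] -[s [e [x ->]]] y z t /[!inE] xy xz j js.
rewrite /conv /= /convex.conv /=.
have r0 : 0 <= t%:num by [].
have r1 : t%:num <= 1 by [].
set r := t%:num in r0 r1.
rewrite -/r /unstable.onem.
have rx : x = r *: x + (1 - r) *: x :> E by rewrite -scalerDl subrKC scale1r.
rewrite {1}rx opprD addrACA -!scalerBr.
apply: le_lt_trans (snD j _ _) _; rewrite !snZ.
have -> : Kabs (1 - r) = 1 - Kabs r.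
  rewrite /Kabs !ger0_norm ?subr_ge0 //; apply/eqP; rewrite eq_sym subr_eq.
  by rewrite -KreD subrK; case: (cplx).
have a0 : 0 <= Kabs r by exact: Kabs_ge0.
have a1 : Kabs r <= 1.
  rewrite /Kabs ger0_norm // -subr_ge0.
  have := Kabs_ge0 (1 - r); rewrite /Kabs ger0_norm ?subr_ge0 //.
  suff -> : Kre (1 - r) = 1 - Kre r by rewrite subr_ge0.
  by apply/eqP; rewrite eq_sym subr_eq -KreD subrK; case: (cplx).
move: (xy j js) (xz j js); set u := P j _; set v := P j _ => ue ve.
rewrite -subr_gt0 (_ : e - _ = Kabs r * (e - u) + (1 - Kabs r) * (e - v)).
  have [->|rn0] := eqVneq (Kabs r) 0.
    by rewrite mul0r add0r subr0 mul1r subr_gt0.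
  rewrite ltr_pwDl ?mulr_ge0 ?subr_ge0 ?(ltW ve) //.
  by rewrite mulr_gt0 ?subr_gt0 // lt_neqAle eq_sym rn0.
by rewrite mulrBr mulrBr addrACA -mulrDl subrKC mul1r opprD.
Qed.

HB.instance Definition _ := PreTopologicalLmod_isTvs.Build (base_field R cplx) T
  sn_add_continuous sn_scale_continuous sn_locally_convex.
HB.instance Definition _ :=
  PreTopologicalNmodule_isTopologicalNmodule.Build T sn_add_continuous.
HB.instance Definition _ := TopologicalNmodule_isTopologicalLmodule.Build
  (base_field R cplx) T sn_scale_continuous.
HB.instance Definition _ :=
  Uniform_isTvs.Build (base_field R cplx) T sn_locally_convex.

End SeminormTopology.

Record chart (R : realType) (m : nat) (X : topologicalType) := Chart {
  chart_dom : set X;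
  chart_fwd : X -> 'rV[R]_m;
  chart_bwd : 'rV[R]_m -> X;
  chart_dom_open : open chart_dom;
  chart_cod_open : open (chart_fwd @` chart_dom);
  chart_fwdK : forall x, chart_dom x -> chart_bwd (chart_fwd x) = x;
  chart_fwd_continuous : {within chart_dom, continuous chart_fwd};
  chart_bwd_continuous :
    {within chart_fwd @` chart_dom, continuous chart_bwd}
}.

Definition chart_cod (R : realType) (m : nat) (X : topologicalType)
  (e : chart R m X) : set 'rV[R]_m := chart_fwd e @` chart_dom e.

Record manifold (R : realType) (m : nat) := Manifold {
  mfd_carrier :> topologicalType;
  mfd_hausdorff : hausdorff_space mfd_carrier;
  mfd_second_countable : @second_countable mfd_carrier;
  atlas : set (chart R m mfd_carrier);
  atlas_cover : forall x, exists2 e, atlas e & chart_dom e x;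
  atlas_smooth : forall e e', atlas e -> atlas e' -> forall i,
    smooth_on (chart_fwd e @` (chart_dom e `&` chart_dom e'))
      (fun v => chart_fwd e' (chart_bwd e v) 0 i)
}.

Section FlatFunctions.
Variables (R : realType) (cplx : bool) (m : nat) (X : manifold R m).
Variable Y : set X.
Local Notation K := (base_field R cplx).
Implicit Types (f g : X -> K) (e : chart R m X).

Definition re_in e f : 'rV[R]_m -> R := fun v => Kre (f (chart_bwd e v)).
Definition im_in e f : 'rV[R]_m -> R := fun v => Kim (f (chart_bwd e v)).

Definition smooth_fun f := forall e, atlas e ->
  smooth_on (chart_cod e) (re_in e f) /\ smooth_on (chart_cod e) (im_in e f).

Definition flat_on f := forall e, atlas e ->
  forall y, Y y -> chart_dom e y ->
  flat_at (re_in e f) (chart_fwd e y) /\ flat_at (im_in e f) (chart_fwd e y).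

Definition flat_pred : {pred X -> K^o} :=
  [pred f | `[< smooth_fun f /\ flat_on f >]].

(* the value at x of the s-th partial derivative of f in the chart e *)
Definition Kpder e (s : seq 'I_m) f (x : X) : K :=
  Kmk cplx (pder s (re_in e f) (chart_fwd e x))
           (pder s (im_in e f) (chart_fwd e x)).

Lemma re_inD e (a : K) f g : re_in e (fun x => a * f x + g x) =
  (fun v => 1 * (Kre a * re_in e f v + (- Kim a) * im_in e f v)
            + 1 * re_in e g v).
Proof. by apply/funext => v; rewrite /re_in KreD KreM !mul1r. Qed.

Lemma im_inD e (a : K) f g : im_in e (fun x => a * f x + g x) =
  (fun v => 1 * (Kre a * im_in e f v + Kim a * re_in e f v)
            + 1 * im_in e g v).
Proof. by apply/funext => v; rewrite /im_in KimD KimM !mul1r. Qed.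

Lemma re_inM e f g : re_in e (fun x => f x * g x) =
  (fun v => 1 * (re_in e f v * re_in e g v) + (-1) * (im_in e f v * im_in e g v)).
Proof. by apply/funext => v; rewrite /re_in KreM !mul1r mulN1r mulNr. Qed.

Lemma im_inM e f g : im_in e (fun x => f x * g x) =
  (fun v => 1 * (re_in e f v * im_in e g v) + 1 * (im_in e f v * re_in e g v)).
Proof. by apply/funext => v; rewrite /im_in KimM !mul1r. Qed.

Lemma smooth_funD (a : K) f g :
  smooth_fun f -> smooth_fun g -> smooth_fun (fun x => a * f x + g x).
Proof.
move=> sf sg e Xe; have [f1 f2] := sf e Xe; have [g1 g2] := sg e Xe.
have oe : open (chart_cod e) by exact: chart_cod_open.
rewrite re_inD im_inD; split=> n.
  by do 2 (apply: diff_on_lin => //).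
by do 2 (apply: diff_on_lin => //).
Qed.

Lemma KpderD e s (a : K) f g x : atlas e -> chart_dom e x ->
  smooth_fun f -> smooth_fun g ->
  Kpder e s (fun x => a * f x + g x) x = a * Kpder e s f x + Kpder e s g x.
Proof.
move=> Xe ex sf sg; have [f1 f2] := sf e Xe; have [g1 g2] := sg e Xe.
have oe : open (chart_cod e) by exact: chart_cod_open.
have Ux : chart_cod e (chart_fwd e x) by exists x.
rewrite /Kpder re_inD im_inD -KmkM -KmkD.
by congr Kmk; rewrite (pder_lin (n := size s) _ _ oe) ?mul1r //;
  try (by apply: diff_on_lin); rewrite (pder_lin (n := size s) _ _ oe).
Qed.

Lemma smooth_funM f g :
  smooth_fun f -> smooth_fun g -> smooth_fun (fun x => f x * g x).
Proof.
move=> sf sg e Xe; have [f1 f2] := sf e Xe; have [g1 g2] := sg e Xe.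
have oe : open (chart_cod e) by exact: chart_cod_open.
rewrite re_inM im_inM; split=> n.
  by apply: diff_on_lin => //; apply: diff_onM.
by apply: diff_on_lin => //; apply: diff_onM.
Qed.

Lemma flat_at_lin (U : set 'rV[R]_m) (h k : 'rV[R]_m -> R) a b v :
  open U -> U v -> smooth_on U h -> smooth_on U k ->
  flat_at h v -> flat_at k v -> flat_at (fun y => a * h y + b * k y) v.
Proof.
move=> oU Uv sh sk fh fk s.
by rewrite (pder_lin (n := size s) _ _ oU) // fh fk !mulr0 addr0.
Qed.

Lemma flat_onD (a : K) f g : smooth_fun f -> smooth_fun g ->
  flat_on f -> flat_on g -> flat_on (fun x => a * f x + g x).
Proof.
move=> sf sg ff fg e Xe y Yy ey.
have [f1 f2] := sf e Xe; have [g1 g2] := sg e Xe.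
have [f3 f4] := ff e Xe y Yy ey; have [g3 g4] := fg e Xe y Yy ey.
have oe : open (chart_cod e) by exact: chart_cod_open.
have Uy : chart_cod e (chart_fwd e y) by exists y.
have L h k a1 b1 := @flat_at_lin _ h k a1 b1 _ oe Uy.
rewrite re_inD im_inD; split; apply: (L) => //;
  [by move=> n; apply: diff_on_lin|by apply: (L)
  |by move=> n; apply: diff_on_lin|by apply: (L)].
Qed.

Lemma flat_onM f g : smooth_fun f -> smooth_fun g ->
  flat_on f -> flat_on (fun x => f x * g x).
Proof.
move=> sf sg ff e Xe y Yy ey.
have [f1 f2] := sf e Xe; have [g1 g2] := sg e Xe.
have [f3 f4] := ff e Xe y Yy ey.
have oe : open (chart_cod e) by exact: chart_cod_open.
have Uy : chart_cod e (chart_fwd e y) by exists y.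
have L h k a1 b1 := @flat_at_lin _ h k a1 b1 _ oe Uy.
rewrite re_inM im_inM; split; apply: (L) => //;
  try (by move=> n; apply: diff_onM); exact: (flat_atM oe).
Qed.

Lemma pder0 s : pder s (fun=> 0 : R) = (fun=> 0) :> ('rV[R]_m -> R).
Proof.
elim: s => [//|i s IH] /=; rewrite -/(pder s _) IH.
by apply/funext => v; exact: derive_cst.
Qed.

Lemma flat_pred_submod : submod_closed flat_pred.
Proof.
split=> [|a f g].
  apply/asboolP.
  have E e : re_in e (0 : X -> K^o) = (fun=> 0) /\
             im_in e (0 : X -> K^o) = (fun=> 0).
    by split; apply/funext => v; rewrite ?/re_in ?/im_in ?Kre0 ?Kim0.
  split=> [e _|e _ y _ _]; have [-> ->] := E e.
    split=> n s _ v _; rewrite pder0; split=> [|i];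
      [exact: cst_continuous|exact: derivable_cst
      |exact: cst_continuous|exact: derivable_cst].
  by split=> s; rewrite pder0.
move=> /asboolP [sf ff] /asboolP [sg fg]; apply/asboolP.
by split; [exact: smooth_funD|exact: flat_onD].
Qed.

HB.instance Definition _ := GRing.isSubmodClosed.Build K (X -> K^o) flat_pred
  flat_pred_submod.

Record flat_fun := FlatFun { flat_val :> X -> K^o; _ : flat_val \in flat_pred }.

HB.instance Definition _ := [isSub for flat_val].
HB.instance Definition _ := [Choice of flat_fun by <:].
HB.instance Definition _ := [SubChoice_isSubLmodule of flat_fun by <:].

Lemma flat_funP (f : flat_fun) : smooth_fun f /\ flat_on f.
Proof. by case: f => f /= /asboolP. Qed.

Lemma flat_mul_subproof (f g : flat_fun) :
  (fun x => f x * g x : K^o) \in flat_pred.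
Proof.
have [sf ff] := flat_funP f; have [sg _] := flat_funP g; apply/asboolP.
by split; [exact: smooth_funM|exact: flat_onM].
Qed.

Definition flat_mul (f g : flat_fun) : flat_fun :=
  FlatFun (flat_mul_subproof f g).

(* uniform convergence of all derivatives on compact subsets of charts *)
Record flat_index := FlatIndex {
  fi_chart : chart R m X;
  fi_set : set X;
  fi_der : seq 'I_m;
  fi_atlas : atlas fi_chart;
  fi_compact : compact fi_set;
  fi_sub : fi_set `<=` chart_dom fi_chart
}.

Definition flat_sn (j : flat_index) (f : flat_fun) : R :=
  sup [set Kabs (Kpder (fi_chart j) (fi_der j) f x) | x in fi_set j].

Lemma smooth_bounded (U A : set 'rV[R]_m) (g : 'rV[R]_m -> R) s : compact A -> A `<=` U ->
  smooth_on U g -> exists M, forall v, A v -> `|pder s g v| <= M.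
Proof.
move=> cA AU sg.
have : compact (pder s g @` A).
  apply: continuous_compact => //; apply: continuous_in_subspaceT => v.
  by rewrite inE => /AU Uv; have [] := sg (size s) s (leqnn _) v Uv.
move=> /compact_bounded [M [_ /(_ (M + 1))]]; rewrite ltrDl ltr01 => /(_ isT) MP.
by exists (M + 1) => v Av; apply: MP; exists v.
Qed.

Lemma flat_sn_has_ubound j (f : flat_fun) :
  has_ubound [set Kabs (Kpder (fi_chart j) (fi_der j) f x) | x in fi_set j].
Proof.
have [/(_ _ (fi_atlas j)) [sr si] _] := flat_funP f.
have cA : compact (chart_fwd (fi_chart j) @` fi_set j).
  apply: continuous_compact; last exact: fi_compact.
  apply: continuous_subspaceW (@fi_sub j) _; exact: chart_fwd_continuous.
have AU : chart_fwd (fi_chart j) @` fi_set j `<=` chart_cod (fi_chart j).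
  by move=> _ [x /(@fi_sub j) xd <-]; exists x.
have [M Mr] := smooth_bounded (fi_der j) cA AU sr.
have [N Ni] := smooth_bounded (fi_der j) cA AU si.
exists (M + N) => _ [x Ax <-]; apply: le_trans (Kabs_mk_le _ _ _) _.
by apply: lerD; [apply: Mr|apply: Ni]; exists x.
Qed.

Lemma Kpder_flatD e s (f g : flat_fun) x : atlas e -> chart_dom e x ->
  Kpder e s (f + g) x = Kpder e s f x + Kpder e s g x.
Proof.
move=> Xe ex; have [sf _] := flat_funP f; have [sg _] := flat_funP g.
rewrite -[Kpder e s f x]mul1r -(KpderD s 1 Xe ex sf sg).
by congr Kpder; apply/funext => y; rewrite mul1r.
Qed.

Lemma Kpder_flatZ e s (a : K) (f : flat_fun) x : atlas e -> chart_dom e x ->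
  Kpder e s (a *: f) x = a * Kpder e s f x.
Proof.
move=> Xe ex; have [sf _] := flat_funP f; have [s0 _] := flat_funP 0.
have K0 : Kpder e s (0 : flat_fun) x = 0.
  by have := KpderD s (-1) Xe ex s0 s0; rewrite mulN1r addNr => <-;
    congr Kpder; apply/funext => y; rewrite mulN1r addNr.
rewrite -[RHS]addr0 -[X in _ + X]K0 -(KpderD s a Xe ex sf s0).
by congr Kpder; apply/funext => y; rewrite addr0.
Qed.

Lemma flat_sn_ub j (f : flat_fun) x : fi_set j x ->
  Kabs (Kpder (fi_chart j) (fi_der j) f x) <= flat_sn j f.
Proof.
by move=> jx; apply: ub_le_sup; [exact: flat_sn_has_ubound|exists x].
Qed.

Lemma flat_sn_le j (f : flat_fun) M : 0 <= M ->
  (forall x, fi_set j x -> Kabs (Kpder (fi_chart j) (fi_der j) f x) <= M) ->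
  flat_sn j f <= M.
Proof.
move=> M0 fM; have [S0|/set0P[x jx]] := eqVneq (fi_set j) set0.
  by rewrite /flat_sn S0 image_set0 sup0.
apply: ge_sup; last by move=> _ [y jy <-]; exact: fM.
by exists (Kabs (Kpder (fi_chart j) (fi_der j) f x)), x.
Qed.

Lemma flat_sn_ge0 j (f : flat_fun) : 0 <= flat_sn j f.
Proof.
have [S0|/set0P[x jx]] := eqVneq (fi_set j) set0.
  by rewrite /flat_sn S0 image_set0 sup0.
exact: le_trans (Kabs_ge0 _) (flat_sn_ub f jx).
Qed.

Lemma flat_snD j (f g : flat_fun) : flat_sn j (f + g) <= flat_sn j f + flat_sn j g.
Proof.
apply: flat_sn_le => [|x jx]; first by rewrite addr_ge0 ?flat_sn_ge0.
rewrite Kpder_flatD; [|exact: fi_atlas|exact: fi_sub].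
by apply: le_trans (KabsD _ _) _; rewrite lerD ?flat_sn_ub.
Qed.

Lemma flat_snZ j (a : K) (f : flat_fun) :
  flat_sn j (a *: f) = Kabs a * flat_sn j f.
Proof.
have le b (g : flat_fun) : flat_sn j (b *: g) <= Kabs b * flat_sn j g.
  apply: flat_sn_le => [|x jx]; first by rewrite mulr_ge0 ?flat_sn_ge0 ?Kabs_ge0.
  rewrite Kpder_flatZ; [|exact: fi_atlas|exact: fi_sub]; rewrite KabsM.
  by rewrite ler_wpM2l ?Kabs_ge0 ?flat_sn_ub.
apply/eqP; rewrite eq_le le /=; have [->|a0] := eqVneq a 0.
  by rewrite Kabs0 mul0r flat_sn_ge0.
have := le a^-1 (a *: f); rewrite scalerA mulVf // scale1r.
move=> /(ler_wpM2l (Kabs_ge0 a)) /le_trans; apply.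
rewrite mulrA -KabsM mulfV // (_ : Kabs 1 = 1) ?mul1r //.
by rewrite /Kabs normr1; case: (cplx).
Qed.

Definition flat_family : seminorm_family flat_fun :=
  SeminormFamily flat_snD flat_snZ.

Definition flat_ideal : tvsType K := seminormed flat_family.

End FlatFunctions.

Definition flat_ideal_mul (R : realType) (cplx : bool) (m : nat)
    (X : manifold R m) (Y : set X) (f g : flat_ideal cplx Y) :
  flat_ideal cplx Y := flat_mul (f : flat_fun cplx Y) (g : flat_fun cplx Y).
Arguments flat_ideal_mul {R} cplx {m X} Y f g.

(* Completeness is stated for sequences and for the additive structure: the
   axioms of [tvsType] relate the uniform structure to the topology, but not to
   the addition, so [completeType] would not express it. *)
Record frechet (K : numFieldType) := Frechet {
  frechet_tvs :> tvsType K;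
  frechet_hausdorff : hausdorff_space frechet_tvs;
  frechet_metrizable : exists2 U : nat -> set frechet_tvs,
    (forall n, nbhs (0 : frechet_tvs) (U n)) &
    forall V, nbhs (0 : frechet_tvs) V -> exists n, U n `<=` V;
  frechet_complete : forall u : nat -> frechet_tvs,
    (fun p : nat * nat => u p.1 - u p.2) @ filter_prod \oo \oo
      --> (0 : frechet_tvs) ->
    exists l : frechet_tvs, u @ \oo --> l
}.

Record chom (K : numFieldType) (E F : frechet K) := CHom {
  chom_fun :> {linear E -> F};
  chom_continuous : continuous chom_fun
}.

Section Tensor.
Variable K : numFieldType.

Definition unique_chom (E F : frechet K) (P : chom E F -> Prop) :=
  exists2 g, P g & forall g', P g' -> g' =1 g.

Definition multilinear (E F : tvsType K) n (f : {ptws 'I_n -> E} -> F) :=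
  forall (x : 'I_n -> E) i (a : K) (u v : E),
    f (dfwith x i (a *: u + v)) = a *: f (dfwith x i u) + f (dfwith x i v).

(* T, with the elementary tensors tau x, is the n-fold completed projective
   tensor power of E *)
Definition is_tensor_power (E : tvsType K) n (T : frechet K)
    (tau : {ptws 'I_n -> E} -> T) :=
  [/\ continuous tau, multilinear tau &
    forall (F : frechet K) (f : {ptws 'I_n -> E} -> F),
      continuous f -> multilinear f ->
      unique_chom (fun g : chom T F => forall x, g (tau x) = f x)].

Definition bilinear_map (E F G : tvsType K) (f : E -> F -> G) :=
  (forall (a : K) u v y, f (a *: u + v) y = a *: f u y + f v y) /\
  (forall x (a : K) u v, f x (a *: u + v) = a *: f x u + f x v).

Definition is_tensor (E F : tvsType K) (T : frechet K) (tau : E -> F -> T) :=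
  [/\ continuous (fun z : E * F => tau z.1 z.2), bilinear_map tau &
    forall (G : frechet K) (f : E -> F -> G),
      continuous (fun z : E * F => f z.1 z.2) -> bilinear_map f ->
      unique_chom (fun g : chom T G => forall x y, g (tau x y) = f x y)].

End Tensor.

Section BarComplex.
Variables (K : numFieldType) (A : tvsType K) (mul : A -> A -> A).

(* (x_0, ..., x_j x_(j+1), ..., x_(n+1)) *)
Definition contract n (j : 'I_n.+1) (x : 'I_n.+2 -> A) : 'I_n.+1 -> A :=
  fun k => if (k < j)%N then x (widen_ord (leqnSn _) k)
    else if k == j then mul (x (widen_ord (leqnSn _) k)) (x (lift ord0 k))
    else x (lift ord0 k).

(* The degrees are shifted by one: [bar_obj n] is the (n+1)-fold tensor power *)
Record bar_complex := BarComplex {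
  bar_obj : nat -> frechet K;
  bar_tensor : forall n, {ptws 'I_n.+1 -> A} -> bar_obj n;
  bar_tensorP : forall n, is_tensor_power (@bar_tensor n);
  bar_d : forall n, chom (bar_obj n.+1) (bar_obj n);
  bar_dE : forall n (x : 'I_n.+2 -> A), bar_d n (bar_tensor x) =
    \sum_(j < n.+1) (-1) ^+ j *: bar_tensor (contract j x)
}.

End BarComplex.

Record tensor_complex (K : numFieldType) (C : nat -> frechet K)
    (d : forall n, chom (C n.+1) (C n)) (V : frechet K) := TensorComplex {
  tc_obj : nat -> frechet K;
  tc_tensor : forall n, C n -> V -> tc_obj n;
  tc_tensorP : forall n, is_tensor (@tc_tensor n);
  tc_d : forall n, chom (tc_obj n.+1) (tc_obj n);
  tc_dE : forall n (x : C n.+1) (v : V),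
    tc_d n (tc_tensor x v) = tc_tensor (d n x) v
}.

Definition contracting_homotopy (K : numFieldType) (C : nat -> frechet K)
    (d : forall n, chom (C n.+1) (C n)) (s : forall n, chom (C n) (C n.+1)) :=
  (forall x, d 0%N (s 0%N x) = x) /\
  (forall n x, d n.+1 (s n.+1 x) + s n (d n x) = x).

Section ExactStructure.
Variable K : numFieldType.
Implicit Types A B C D : frechet K.

Definition is_kernel A B C (i : chom A B) (p : chom B C) :=
  (forall x, p (i x) = 0) /\
  forall D (f : chom D B), (forall x, p (f x) = 0) ->
    unique_chom (fun g : chom D A => forall x, i (g x) = f x).

Definition is_cokernel A B C (i : chom A B) (p : chom B C) :=
  (forall x, p (i x) = 0) /\
  forall D (f : chom B D), (forall x, f (i x) = 0) ->
    unique_chom (fun g : chom C D => forall y, g (p y) = f y).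

Definition is_iso A B (f : chom A B) :=
  exists g : chom B A, cancel f g /\ cancel g f.

Definition is_pullback A B C D
    (f' : chom D A) (p' : chom D B) (p : chom A C) (f : chom B C) :=
  (forall x, p (f' x) = f (p' x)) /\
  forall E (u : chom E A) (v : chom E B), (forall x, p (u x) = f (v x)) ->
    unique_chom (fun w : chom E D =>
      (forall x, f' (w x) = u x) /\ (forall x, p' (w x) = v x)).

Definition is_pushout A B C D
    (i : chom C A) (f : chom C B) (f' : chom A D) (i' : chom B D) :=
  (forall x, f' (i x) = i' (f x)) /\
  forall E (u : chom A E) (v : chom B E), (forall x, u (i x) = v (f x)) ->
    unique_chom (fun w : chom D E =>
      (forall x, w (f' x) = u x) /\ (forall x, w (i' x) = v x)).

Definition deflation_of (conf : forall A B C, chom A B -> chom B C -> Prop)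
  B C (p : chom B C) := exists A (i : chom A B), conf A B C i p.

Definition inflation_of (conf : forall A B C, chom A B -> chom B C -> Prop)
  A B (i : chom A B) := exists C (p : chom B C), conf A B C i p.

(* Quillen's axioms, without the one which Keller showed to be redundant; the
   split sequences are the biproduct diagrams *)
Record exact_structure := ExactStructure {
  conflation : forall A B C, chom A B -> chom B C -> Prop;
  conflation_iso : forall A B C A' B' C' (i : chom A B) (p : chom B C)
      (i' : chom A' B') (p' : chom B' C')
      (a : chom A A') (b : chom B B') (c : chom C C'),
    is_iso a -> is_iso b -> is_iso c ->
    (forall x, b (i x) = i' (a x)) -> (forall x, c (p x) = p' (b x)) ->
    conflation i p -> conflation i' p';
  conflation_split : forall A B C (i : chom A B) (p : chom B C)
      (r : chom B A) (s : chom C B),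
    (forall x, r (i x) = x) -> (forall x, p (s x) = x) ->
    (forall x, i (r x) + s (p x) = x) -> conflation i p;
  conflation_kernel : forall A B C (i : chom A B) (p : chom B C),
    conflation i p -> is_kernel i p;
  conflation_cokernel : forall A B C (i : chom A B) (p : chom B C),
    conflation i p -> is_cokernel i p;
  deflation_comp : forall A B C (p : chom A B) (q : chom B C) (r : chom A C),
    (forall x, r x = q (p x)) ->
    deflation_of conflation p -> deflation_of conflation q ->
    deflation_of conflation r;
  inflation_comp : forall A B C (i : chom A B) (j : chom B C) (k : chom A C),
    (forall x, k x = j (i x)) ->
    inflation_of conflation i -> inflation_of conflation j ->
    inflation_of conflation k;
  deflation_pullback : forall A B C (p : chom A C) (f : chom B C),
    deflation_of conflation p ->
    exists D (f' : chom D A) (p' : chom D B),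
      is_pullback f' p' p f /\ deflation_of conflation p';
  inflation_pushout : forall A B C (i : chom C A) (f : chom C B),
    inflation_of conflation i ->
    exists D (f' : chom A D) (i' : chom B D),
      is_pushout i f f' i' /\ inflation_of conflation i'
}.

Definition deflation (S : exact_structure) B C (p : chom B C) :=
  deflation_of (conflation S) p.

(* Exactness of the complex ... -> C 1 -> C 0 -> 0; in degree 0 the kernel is
   C 0 itself. *)
Definition exact_complex (S : exact_structure) (C : nat -> frechet K)
    (d : forall n, chom (C n.+1) (C n)) :=
  deflation S (d 0%N) /\
  forall n, exists Z (i : chom Z (C n.+1)) (e : chom (C n.+2) Z),
    [/\ is_kernel i (d n), deflation S e & forall x, i (e x) = d n.+1 x].

Definition homologically_unital (S : exact_structure) (A : tvsType K)
    (mul : A -> A -> A) :=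
  forall (C : bar_complex mul) (V : frechet K) (D : tensor_complex (bar_d C) V),
    exact_complex S (tc_d D).

End ExactStructure.

(* Main.v *)
Require Import Defs.
From HB Require Import structures.
From mathcomp Require Import all_boot all_order all_algebra.
From mathcomp Require Import interval_inference.
From mathcomp Require Import mathcomp_extra boolp classical_sets functions.
From mathcomp Require Import cardinality reals topology convex normedtype.
From mathcomp Require Import sequences derive realfun exp.
From mathcomp Require Import zify ring lra.

Set Implicit Arguments.
Unset Strict Implicit.
Unset Printing Implicit Defensive.
Import Order.TTheory GRing.Theory Num.Theory.
Import numFieldTopology.Exports numFieldNormedType.Exports.
Local Open Scope classical_set_scope.
Local Open Scope ring_scope.

(** The reason why the bar complex of [I], the ideal of functions flat on [Y], can be
    contracted is that [I] has a substitute for a unit. Suppose that elements [u k] of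
    an algebra and maps [v k] with [v k (x * y) = v k x * y] satisfy
    [x = sum_k u k * v k x] for all [x]. Then
    [s (x0 (x) x1 (x) ...) = sum_k u k (x) v k x0 (x) x1 (x) ...]
    is a contracting homotopy: contracting the first two slots of the right-hand side
    gives back the argument, and the other contractions of [s x] cancel against
    [s (b' x)] ([bar_contracting]). The series has to converge in the completed
    projective tensor powers. That is ensured when each seminorm of [u k] grows at most
    exponentially in [k] and each seminorm of [v k x] decays faster than every
    exponential ([rapid_splitting], [tail_small]).

    In [I] such a decomposition comes from cut-off functions [e k] that vanish near [Y]
    and, on larger and larger compact sets, are equal to [1] at distance more than about
    [2 ^- k] from [Y]. Their derivatives of order
    [N] have size about [2 ^ (N * k)] up to a fixed exponential factor. On the other
    hand a function [f] that is flat on [Y] is, with all its derivatives, smaller than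
    any power of the distance to [Y] ([flat_taylor]), so [(1 - e k) * f] tends to zero
    faster than every exponential ([cutoff_flat]). With [h k = 1 - e k] one takes
    [u k = e k.+1 - e k = h k - h k.+1] and lets [v k] be multiplication by
    [h k + h k.+1]; then [u k * v k = h k ^ 2 - h k.+1 ^ 2] telescopes to the identity
    ([approximate_unit_splitting]).

    The cut-offs are built in cubes of charts from a smooth partition of unity over a
    grid of mesh [2 ^- k], by keeping the cells that stay away from [Y]. A countable
    family of them is glued to functions on the manifold with weights that are, locally,
    finite in number ([approximate_unit_exists]); estimates pass from one chart to
    another by the chain rule ([bounded_transfer]).

    Finally, a contraction survives tensoring with a Frechet space [V], and in a
    contractible complex every differential is a split epimorphism onto the kernel of
    the next one. Split sequences are conflations for every exact structure, which gives
    homological unitality ([contracting_homologically_unital]). *)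

(** * Convex neighbourhoods and continuity in topological vector spaces *)

Section Tvs.
Variable K : numFieldType.
Implicit Types E F : tvsType K.

Lemma convex_nbhs0 E (V : set E) : nbhs 0 V ->
  exists2 W : set E, nbhs 0 W & convex_set W /\ W `<=` V.
Proof.
move=> V0; have [B cB [oB bB]] := @locally_convex K E.
have [W [BW W0] WV] := bB 0 V V0.
exists W; last by split=> //; apply: cB; rewrite inE.
by apply: open_nbhs_nbhs; split=> //; exact: oB.
Qed.

Lemma convex_half E (W : set E) x y : convex_set W -> W x -> W y ->
  W (2^-1 *: x + 2^-1 *: y).
Proof.
have h01 : 0 <= (2^-1 : K) <= 1.
  by rewrite invr_ge0 ler0n invf_le1 ?ltr0n // ler1n.
move=> cW Wx Wy.
have /(_ (Itv01 (proj1 (andP h01)) (proj2 (andP h01)))) :=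
  cW x y _ (mem_set Wx) (mem_set Wy).
rewrite inE /conv /= /unstable.onem.
have -> // : 1 - 2^-1 = 2^-1 :> K by field.
Qed.

Lemma convex_shrink E (W : set E) x n : convex_set W -> W 0 -> W (2 ^+ n *: x) ->
  W x.
Proof.
move=> cW W0; elim: n => [|n IH]; first by rewrite scale1r.
move=> /convex_half /(_ W0) /=; rewrite scaler0 addr0 scalerA => H; apply: IH.
by have := H cW; rewrite exprS mulKf ?pnatr_eq0.
Qed.

(** A convex set containing [a] and [b] contains [a / 2 + b / 2]; iterating from the
    last term to the first puts weight [2 ^- k.+1] on the term of index [k]. *)
Lemma convex_geometric_sum E (W : set E) (t : nat -> E) M N :
  convex_set W -> W 0 -> (forall k, (M <= k)%N -> W (2 ^+ k.+1 *: t k)) ->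
  W (\sum_(M <= k < N) t k).
Proof.
move=> cW W0 Wt; apply: (@convex_shrink _ _ _ M) => //.
have [NM|/ltnW MN] := leqP N M; first by rewrite big_geq // scaler0.
rewrite -(subnK MN) addnC; move: (N - M)%N => {N MN} d.
elim: d M Wt => [|d IH] M Wt; first by rewrite addn0 big_geq // scaler0.
rewrite addnS big_ltn ?ltnS ?leq_addr // scalerDr -addSn.
have -> : 2 ^+ M = 2^-1 * 2 ^+ M.+1 :> K by rewrite exprS mulKf ?pnatr_eq0.
rewrite -!scalerA; apply: convex_half => //; first exact: Wt.
by apply: IH => k /ltnW; exact: Wt.
Qed.

Lemma continuous_add E (T : topologicalType) (f g : T -> E) x :
  {for x, continuous f} -> {for x, continuous g} ->
  {for x, continuous (fun y => f y + g y)}.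
Proof.
move=> cf cg.
apply: (@continuous_comp T (E * E)%type E (fun y => (f y, g y))
  (fun z => z.1 + z.2)); last exact: add_continuous.
exact: cvg_pair.
Qed.

Lemma continuous_scale E (T : topologicalType) (a : K) (f : T -> E) x :
  {for x, continuous f} -> {for x, continuous (fun y => a *: f y)}.
Proof.
move=> cf.
apply: (@continuous_comp T (K^o * E)%type E (fun y => (a : K^o, f y))
  (fun z => z.1 *: z.2)); last exact: scale_continuous.
have ca : (fun=> a : K^o) @ nbhs x --> (a : K^o) by exact: cvg_cst.
exact: (cvg_pair ca cf).
Qed.

Lemma continuous_sum E (T : topologicalType) I (r : seq I) (f : I -> T -> E) x :
  (forall i, {for x, continuous (f i)}) ->
  {for x, continuous (fun y => \sum_(i <- r) f i y)}.
Proof.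
move=> cf; elim: r => [|i r IH].
  have -> : (fun y => \sum_(i <- [::]) f i y) = (fun=> 0).
    by apply/funext => y; rewrite big_nil.
  exact: cvg_cst.
have -> : (fun y => \sum_(j <- i :: r) f j y) =
          (fun y => f i y + \sum_(j <- r) f j y).
  by apply/funext => y; rewrite big_cons.
exact: continuous_add.
Qed.

Lemma nbhs0D E (V : set E) : nbhs 0 V ->
  exists2 W : set E, nbhs 0 W & forall x y, W x -> W y -> V (x + y).
Proof.
move=> V0; have := @add_continuous E (0, 0) V; rewrite /= addr0.
move=> /(_ V0) [[A B] /= [A0 B0] AB]; exists (A `&` B); first exact: filterI.
by move=> x y [Ax _] [_ By]; exact: (AB (x, y)).
Qed.

Lemma nbhs0_opp E (V : set E) : nbhs 0 V -> nbhs 0 [set x | V (- x)].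
Proof.
move=> V0; have := @opp_continuous E 0 V; rewrite oppr0; exact.
Qed.

Lemma nbhsDl E (V : set E) (x : E) : nbhs x V <-> nbhs 0 [set y | V (x + y)].
Proof.
split=> H.
  have : {for 0, continuous (fun y : E => x + y)}.
    by apply: continuous_add; [exact: cvg_cst|exact: cvg_id].
  by rewrite /prop_for /continuous_at addr0; apply.
have : {for x, continuous (fun y : E => - x + y)}.
  by apply: continuous_add; [exact: cvg_cst|exact: cvg_id].
rewrite /prop_for /continuous_at addNr => /(_ _ H) H'.
apply: (@filterS _ (nbhs x) _ _ _ _ H') => y /=.
by rewrite addrA subrr add0r.
Qed.

End Tvs.

(** * Continuous linear maps, tensor powers and sequential limits *)

Section Frechet.
Variable K : numFieldType.
Implicit Types E F T : frechet K.

(** Explicit maps between Frechet spaces are built through this lemma, so that only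
    their values are ever used and not their construction. *)
Lemma chom_of_linear E F (f : E -> F) :
  (forall a u v, f (a *: u + v) = a *: f u + f v) -> continuous f ->
  exists g : chom E F, forall x, g x = f x.
Proof.
move=> lf cf.
pose L := GRing.isLinear.Build K E F *:%R f lf.
pose fL : {linear E -> F} := HB.pack f L.
by exists (@CHom K E F fL cf).
Qed.

Lemma chom_id E : exists g : chom E E, forall x, g x = x.
Proof. by apply: (@chom_of_linear E E id) => // x; exact: cvg_id. Qed.

Lemma chom_zero E F : exists g : chom E F, forall x, g x = 0.
Proof.
apply: (@chom_of_linear E F (fun=> 0)) => [a u v|x]; last exact: cvg_cst.
by rewrite scaler0 addr0.
Qed.

Lemma chom_comp E F T (g : chom F T) (f : chom E F) :
  exists h : chom E T, forall x, h x = g (f x).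
Proof.
apply: (@chom_of_linear E T (fun x => g (f x))) => [a u v|x].
  by rewrite !linearP.
by apply: continuous_comp; exact: chom_continuous.
Qed.

Lemma chom_add E F (f g : chom E F) :
  exists h : chom E F, forall x, h x = f x + g x.
Proof.
apply: (@chom_of_linear E F (fun x => f x + g x)) => [a u v|x].
  by rewrite !linearP scalerDr addrACA.
by apply: continuous_add; exact: chom_continuous.
Qed.

Lemma chom_sub E F (f g : chom E F) :
  exists h : chom E F, forall x, h x = f x - g x.
Proof.
apply: (@chom_of_linear E F (fun x => f x - g x)) => [a u v|x].
  by rewrite !linearP scalerBr -scalerN addrACA.
apply: continuous_add; first exact: chom_continuous.
have -> : (fun y => - g y) = (fun y => (-1) *: g y).
  by apply/funext => y; rewrite scaleN1r.
by apply: continuous_scale; exact: chom_continuous.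
Qed.

(** The uniqueness half of the universal property: identities between maps out of
    a completed tensor power need only be checked on elementary tensors. *)
Lemma tensor_power_ext (A : tvsType K) n T tau F (g g' : chom T F) :
  @is_tensor_power K A n T tau -> (forall x, g (tau x) = g' (tau x)) -> g =1 g'.
Proof.
move=> [ct mt ut] gg'.
have [||h _ hu] := ut F (fun x => g (tau x)).
- by move=> x; apply: continuous_comp; [exact: ct|exact: chom_continuous].
- by move=> x i a u v; rewrite mt linearP.
- by move=> x; rewrite (hu g) // (hu g') // => y; rewrite gg'.
Qed.

Lemma tensor_ext (A B : tvsType K) T tau F (g g' : chom T F) :
  @is_tensor K A B T tau -> (forall x y, g (tau x y) = g' (tau x y)) -> g =1 g'.
Proof.
move=> [ct [mt1 mt2] ut] gg'.
have [||h _ hu] := ut F (fun x y => g (tau x y)).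
- move=> x; apply: (@continuous_comp _ _ _ (fun z => tau z.1 z.2) g).
    exact: ct.
  exact: chom_continuous.
- by split=> [a u v y|x a u v]; rewrite ?mt1 ?mt2 linearP.
- by move=> x; rewrite (hu g) // (hu g') // => y z; rewrite gg'.
Qed.

Lemma cvg_lin T (u v : nat -> T) (l l' : T) (a : K) :
  u @ \oo --> l -> v @ \oo --> l' ->
  (fun n => a *: u n + v n) @ \oo --> a *: l + l'.
Proof.
move=> ul vl.
have c : {for (l, l'), continuous (fun z : T * T => a *: z.1 + z.2)}.
  apply: continuous_add; last exact: cvg_snd.
  by apply: continuous_scale; exact: cvg_fst.
exact: (cvg_comp _ _ (cvg_pair ul vl) c).
Qed.

Lemma cvg_sum_lin T I (r : seq I) (a : I -> K) (u : I -> nat -> T) (l : I -> T) :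
  (forall i, u i @ \oo --> l i) ->
  (fun n => \sum_(i <- r) a i *: u i n) @ \oo --> \sum_(i <- r) a i *: l i.
Proof.
move=> ul; elim: r => [|i r IH].
  rewrite big_nil; under eq_fun do rewrite big_nil; exact: cvg_cst.
rewrite big_cons; under eq_fun do rewrite big_cons; exact: cvg_lin.
Qed.

Lemma cvg_chom T F (g : chom T F) (u : nat -> T) (l : T) :
  u @ \oo --> l -> (fun n => g (u n)) @ \oo --> g l.
Proof. by move=> ul; apply: (cvg_comp _ _ ul); exact: chom_continuous. Qed.

Lemma eq_cvg_seq T (u w : nat -> T) (l : T) :
  u =1 w -> u @ \oo --> l -> w @ \oo --> l.
Proof. by move=> /funext ->. Qed.

Lemma frechet_lim_unique T (u : nat -> T) (l l' : T) :
  u @ \oo --> l -> u @ \oo --> l' -> l = l'.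
Proof. by apply: cvg_unique; exact: frechet_hausdorff. Qed.

(** Prepares the five-term estimate of [locally_uniform_limit]. *)
Lemma nbhs0_shrink (A : tvsType K) (V : set A) : nbhs 0 V ->
  exists2 W : set A, nbhs 0 W & forall x1 x2 x3 x4 x5, W x1 -> W x2 -> W x3 ->
    W x4 -> W x5 -> V (x1 + x2 + x3 + x4 + x5).
Proof.
move=> /nbhs0D [V1 V10 V1V]; have [V2 V20 V2V] := nbhs0D V10.
have [V3 V30 V3V] := nbhs0D V20.
have Z W : nbhs (0 : A) W -> W 0 by exact: nbhs_singleton.
have V32 x : V3 x -> V2 x by move=> h; rewrite -[x]addr0; apply: V3V => //; exact: Z.
have V21 x : V2 x -> V1 x by move=> h; rewrite -[x]addr0; apply: V2V => //; exact: Z.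
exists V3 => // x1 x2 x3 x4 x5 h1 h2 h3 h4 h5; apply: V1V; last exact/V21/V32.
by rewrite -addrA; apply: V2V; apply: V3V.
Qed.

(** The three-epsilon argument. It takes five terms here because the Cauchy
    condition compares members of the sequence with each other: at [x] and at [y] the limit is
    reached through the fixed index [k] and an index that depends on the point. *)
Lemma locally_uniform_limit (Z : topologicalType) T (S : nat -> Z -> T) :
  (forall N, continuous (S N)) ->
  (forall (x : Z) (V : set T), nbhs 0 V -> exists k, \forall y \near x,
     forall M N, (k <= M)%N -> (k <= N)%N -> V (S N y - S M y)) ->
  exists2 F : Z -> T, continuous F & forall y, S ^~ y @ \oo --> F y.
Proof.
move=> cS uS.
have /choice [F SF] : forall y : Z, exists l : T, S ^~ y @ \oo --> l.
  move=> y; apply: frechet_complete => V V0.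
  have [k /nbhs_singleton H] := uS y V V0.
  exists ([set n | (k <= n)%N], [set n | (k <= n)%N]) => /=.
    by split; exists k.
  by move=> [a b] [/= ka kb]; exact: H.
exists F => // x V Vx.
have /nbhsDl /nbhs0_shrink [W W0 WV] := Vx.
pose W' := W `&` [set z | W (- z)].
have W'0 : nbhs 0 W' by apply: filterI => //; exact: nbhs0_opp.
have [k uk] := uS x W W0.
have near0 (y : Z) : \forall N \near \oo, W' (S N y - F y).
  have : (fun N => 1 *: S N y + - F y) @ \oo --> 1 *: F y + - F y.
    by apply: cvg_lin => //; exact: cvg_cst.
  rewrite scale1r subrr => /(_ _ W'0); rewrite nbhs_simpl /=.
  by apply: filterS => N /=; rewrite scale1r.
have cx : \forall y \near x, W (S k y - S k x).
  have : {for x, continuous (fun y => S k y + - S k x)}.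
    by apply: continuous_add; [exact: cS|exact: cvg_cst].
  by rewrite /prop_for /continuous_at subrr => /(_ _ W0).
have /filter_ex [N0 [N0k [N0W _]]] : \forall N \near \oo, (k <= N)%N /\ W' (S N x - F x).
  by apply: filterI; [exists k|exact: near0].
move: (nbhs_singleton uk) => ukx; rewrite nbhs_simpl /=.
apply: filterS2 cx uk => y cy uy.
have /filter_ex [N [Nk [_ NW]]] : \forall N \near \oo, (k <= N)%N /\ W' (S N y - F y).
  by apply: filterI; [exists k|exact: near0].
change (V (F y)); have -> : F y = F x + ((F y - S N y) + (S N y - S k y) + (S k y - S k x) +
  (S k x - S N0 x) + (S N0 x - F x)).
  by rewrite !addrA !subrK addrAC subrr add0r.
apply: WV => //; [by rewrite -opprB|exact: uy|exact: ukx].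
Qed.

End Frechet.

Section FiniteProduct.
Variables (K : numFieldType) (E : tvsType K) (n : nat).
Local Notation Z := {ptws 'I_n -> E}.

Lemma cvg_ptws (F : set_system Z) (f : Z) : Filter F ->
  (forall i, (fun g : Z => g i) @ F --> f i) -> F --> f.
Proof.
move=> FF Ff; apply/cvg_sup => i; apply/cvg_image.
  by rewrite eqEsubset; split=> v // _; exists (fun=> v).
move=> W /(Ff i) H; exists [set g : Z | W (g i)] => //.
by rewrite eqEsubset; split=> [_ [g Wg <-]//|v Wv]; exists (fun=> v).
Qed.

Lemma continuous_ptws (T : topologicalType) (f : T -> Z) x :
  (forall i, {for x, continuous (fun y => f y i)}) -> {for x, continuous f}.
Proof. by move=> cf; apply: cvg_ptws => i; exact: cf. Qed.

Lemma continuous_coord i : continuous (fun g : Z => g i).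
Proof. exact: (@proj_continuous _ (fun _ : 'I_n => E) i). Qed.

Lemma nbhs_ptws_box (f : Z) (U : set Z) : nbhs f U ->
  exists2 W : 'I_n -> set E, (forall i, nbhs (f i) (W i)) &
    forall g : Z, (forall i, W i (g i)) -> U g.
Proof.
pose B : set_system Z := [set V | exists2 W : 'I_n -> set E,
  (forall i, nbhs (f i) (W i)) & forall g : Z, (forall i, W i (g i)) -> V g].
have FB : Filter B.
  split=> [|V V' [W Wf WV] [W' W'f W'V]|V V' VV' [W Wf WV]].
  - by exists (fun=> setT) => // i; exact: filterT.
  - exists (fun i => W i `&` W' i) => [i|g gW]; first exact: filterI.
    by split; [apply: WV|apply: W'V] => i; have [] := gW i.
  - by exists W => // g /WV /VV'.
suff : B --> f by apply.
apply: cvg_ptws => i V Vf.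
exists (fun j => if j == i then V else setT) => [j|g /(_ i)].
  by case: eqP => [->//|_]; exact: filterT.
by rewrite eqxx.
Qed.

End FiniteProduct.

Section Multilinear.
Variables (K : numFieldType) (E F : tvsType K) (n : nat).
Variables (f : {ptws 'I_n -> E} -> F) (mf : multilinear f).
Implicit Types (x : 'I_n -> E) (i : 'I_n).

Lemma multilinear0 x i : f (dfwith x i 0) = 0.
Proof.
have := @mf x i 1 0 0; rewrite scaler0 addr0 scale1r.
by move=> /eqP; rewrite -subr_eq0 opprD addNKr oppr_eq0 => /eqP.
Qed.

Lemma multilinearZ x i a u : f (dfwith x i (a *: u)) = a *: f (dfwith x i u).
Proof. by rewrite -[a *: u]addr0 mf multilinear0 addr0. Qed.

Lemma multilinearD x i u v :
  f (dfwith x i (u + v)) = f (dfwith x i u) + f (dfwith x i v).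
Proof. by rewrite -[u]scale1r mf !scale1r. Qed.

Lemma multilinear_sum x i I (r : seq I) (u : I -> E) :
  f (dfwith x i (\sum_(k <- r) u k)) = \sum_(k <- r) f (dfwith x i (u k)).
Proof.
elim: r => [|k r IH]; first by rewrite !big_nil multilinear0.
by rewrite !big_cons multilinearD IH.
Qed.

(** Rescaling the slots one at a time: this is how growth in one factor of an
    elementary tensor is traded against decay in another. *)
Lemma multilinear_scale x (c : 'I_n -> K) :
  f (fun i => c i *: x i) = (\prod_i c i) *: f x.
Proof.
have H (s : seq 'I_n) : uniq s ->
    f (fun i => if i \in s then c i *: x i else x i) = (\prod_(i <- s) c i) *: f x.
  elim: s => [|i s IH] /=; first by rewrite big_nil scale1r.
  move=> /andP[iNs us]; rewrite big_cons -scalerA -IH //.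
  set y := (fun j => if j \in s then _ else _).
  have yi : y = dfwith y i (x i).
    apply/funext => j; case: dfwithP => //; rewrite /y.
    by rewrite (negbTE iNs).
  rewrite yi -multilinearZ; congr f; apply/funext => j.
  case: dfwithP => [|k ik]; first by rewrite mem_head.
  by rewrite /y inE [k == i]eq_sym (negbTE ik).
rewrite -big_enum -H ?enum_uniq //.
by congr f; apply/funext => i; rewrite mem_enum.
Qed.

End Multilinear.

(** * The contracting homotopy of a rapidly split algebra *)

Lemma exp2_ge (R : realType) (r : R) : exists n, r <= 2 ^+ n.
Proof.
have [r0|r0] := leP r 0; first by exists 0%N; exact: le_trans r0 ler01.
exists (Num.bound r); apply: le_trans (ltW (archi_boundP (ltW r0))) _.
by rewrite -natrX ler_nat ltnW // ltn_expl.
Qed.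

Section Homotopy.
Variables (R : realType) (cplx : bool).
Local Notation K := (base_field R cplx).
Variables (E : lmodType K) (P : seminorm_family E).
Local Notation A := (seminormed P : tvsType K).

Lemma Kabs_exp2 n : Kabs (2 ^+ n : K) = 2 ^+ n.
Proof.
have K1 : Kabs (1 : K) = 1 by rewrite /Kabs normr1; case: (cplx).
have K2 : Kabs (2 : K) = 2.
  rewrite /Kabs ger0_norm ?ler0n //.
  by rewrite -[2]/(1 + 1) KreD (_ : Kre 1 = 1) //; case: (cplx).
by elim: n => [//|n IH]; rewrite !exprS KabsM IH K2.
Qed.

Lemma Kabs_expN2 n : Kabs (2 ^- n : K) = 2 ^- n.
Proof.
apply: (@mulfI _ (2 ^+ n)); first by rewrite expf_neq0 // pnatr_eq0.
rewrite divff ?expf_neq0 ?pnatr_eq0 // -Kabs_exp2 -KabsM divff.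
  by rewrite -(expr0 2) Kabs_exp2.
by rewrite expf_neq0 // pnatr_eq0.
Qed.

Definition icons (D : Type) n (u : D) (y : 'I_n -> D) : 'I_n.+1 -> D :=
  fun i => if unlift ord0 i is Some j then y j else u.

Lemma icons0 (D : Type) n (u : D) (y : 'I_n -> D) : icons u y ord0 = u.
Proof. by rewrite /icons unlift_none. Qed.

Lemma iconsS (D : Type) n (u : D) (y : 'I_n -> D) i :
  icons u y (lift ord0 i) = y i.
Proof. by rewrite /icons liftK. Qed.

Definition apply_head (D : Type) n (v : D -> D) (x : 'I_n.+1 -> D) :
  'I_n.+1 -> D := dfwith x ord0 (v (x ord0)).

(** A right inverse [x |-> sum_k u k (x) v k x] of the multiplication map which is
    linear for right multiplication. The growth of [u] is exponential with a rate
    that depends on the seminorm, while [v] decays faster than every exponential;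
    this makes the series converge absolutely in the completed projective tensor
    product, whichever seminorm is used on either factor. *)
Record rapid_splitting (mul : A -> A -> A) (u : nat -> A) (v : nat -> A -> A) :=
  RapidSplitting {
  rs_linear : forall k a x y, v k (a *: x + y) = a *: v k x + v k y;
  rs_continuous : forall k, continuous (v k);
  rs_mul : forall k x y, v k (mul x y) = mul (v k x) y;
  rs_sum : forall x, (fun N => \sum_(0 <= k < N) mul (u k) (v k x)) @ \oo --> x;
  rs_growth : forall j, exists N k0, forall k, (k0 <= k)%N ->
    P j (u k) <= 2 ^+ (N * k);
  rs_decay : forall j M, exists s k0, forall k, (k0 <= k)%N ->
    forall x B, 0 <= B -> (forall i, List.In i s -> P i x <= B) ->
    2 ^+ (M * k) * P j (v k x) <= B
}.

Variables (mul : A -> A -> A) (u : nat -> A) (v : nat -> A -> A).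
Hypothesis rs : rapid_splitting mul u v.

Lemma growth_seq (s : seq (sn_index P)) : exists N k0, forall k, (k0 <= k)%N ->
  forall j, List.In j s -> P j (u k) <= 2 ^+ (N * k).
Proof.
elim: s => [|j s [N [k0 IH]]]; first by exists 0%N, 0%N.
have [N' [k1 H]] := rs_growth rs j.
exists (maxn N N'), (maxn k0 k1) => k; rewrite geq_max => /andP[k0k k1k].
have le_exp a b : (a <= b)%N -> (2 : R) ^+ (a * k) <= 2 ^+ (b * k).
  by move=> ab; rewrite ler_weXn2l ?ler1n // leq_mul2r ab orbT.
move=> i [<-|si].
  by apply: le_trans (H k k1k) _; apply: le_exp; exact: leq_maxr.
by apply: le_trans (IH k k0k _ si) _; apply: le_exp; exact: leq_maxl.
Qed.

Lemma decay_seq (s : seq (sn_index P)) M : exists t k0, forall k, (k0 <= k)%N ->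
  forall x B, 0 <= B -> (forall i, List.In i t -> P i x <= B) ->
  forall j, List.In j s -> 2 ^+ (M * k) * P j (v k x) <= B.
Proof.
elim: s => [|j s [t [k0 IH]]]; first by exists [::], 0%N.
have [t' [k1 H]] := rs_decay rs j M.
exists (t' ++ t), (maxn k0 k1) => k; rewrite geq_max => /andP[k0k k1k] x B B0 xB.
move=> i [<-|si].
  by apply: H => // l lt; apply: xB; apply/List.in_or_app; left.
by apply: IH si => // l lt; apply: xB; apply/List.in_or_app; right.
Qed.

(** Powers of [2] serve as the only radii, since exponents can be added and
    compared by linear arithmetic. *)
Lemma ball_exp2 (U : set A) : nbhs 0 U ->
  exists s d, forall z : A, (forall j, List.In j s -> 2 ^+ d * P j z <= 1) -> U z.
Proof.
move=> [s [e [e0 sU]]]; have [d ed] := exp2_ge (2 / e).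
exists s, d => z zs; apply: sU => j /zs H; rewrite subr0.
have H2 : 2 / e * P j z <= 1.
  by apply: le_trans H; rewrite ler_wpM2r // sn_ge0.
by move: H2; rewrite mulrAC ler_pdivrMr // mul1r; have := sn_ge0 j z; lra.
Qed.

Lemma multilinear_ball n (T : frechet K) (f : {ptws 'I_n.+1 -> A} -> T) :
  continuous f -> multilinear f -> forall V, nbhs 0 V ->
  exists s d, forall y : 'I_n.+1 -> A,
    (forall i j, List.In j s -> 2 ^+ d * P j (y i) <= 1) -> V (f y).
Proof.
move=> cf mf V V0; pose z : {ptws 'I_n.+1 -> A} := fun=> 0.
have fz : f z = 0.
  have -> : z = dfwith z ord0 0 by apply/funext => i; case: dfwithP.
  exact: multilinear0.
have [|W W0 WV] := @nbhs_ptws_box _ _ _ z (f @^-1` V).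
  by apply: cf; rewrite fz.
have [s [d sd]] : exists s d, forall (x : A),
    (forall j, List.In j s -> 2 ^+ d * P j x <= 1) ->
    forall i, i \in enum 'I_n.+1 -> W i x.
  elim: (enum 'I_n.+1) => [|i r [s [d IH]]]; first by exists [::], 0%N.
  have [s' [d' H]] := ball_exp2 (W0 i).
  exists (s' ++ s), (maxn d' d) => x xs k.
  have le_exp a j : (a <= maxn d' d)%N -> 2 ^+ a * P j x <= 2 ^+ (maxn d' d) * P j x.
    by move=> ab; rewrite ler_wpM2r ?sn_ge0 // ler_weXn2l ?ler1n.
  rewrite inE => /orP[/eqP->|kr].
    apply: H => j js; apply: le_trans (le_exp d' _ _) _; first exact: leq_maxl.
    by apply: xs; apply/List.in_or_app; left.
  apply: IH kr => j js; apply: le_trans (le_exp d _ _) _; first exact: leq_maxr.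
  by apply: xs; apply/List.in_or_app; right.
exists s, d => y ys; apply: WV => i; apply: sd (mem_enum _ _) => j js.
exact: ys.
Qed.

Lemma locally_bounded n (s : seq (sn_index P)) (x : {ptws 'I_n -> A}) :
  exists r, \forall y \near x, forall i j, List.In j s -> P j (y i) <= 2 ^+ r.
Proof.
have [r xr] : exists r, forall i j, List.In j s -> P j (x i) + 1 <= 2 ^+ r.
  elim: s => [|j s [r IH]]; first by exists 0%N.
  have [r' H] := exp2_ge (\sum_i P j (x i) + 1).
  have le_exp a : (a <= maxn r r')%N -> (2 : R) ^+ a <= 2 ^+ maxn r r'.
    by move=> ab; rewrite ler_weXn2l ?ler1n.
  exists (maxn r r') => i k [<-|ks].
    apply: le_trans (le_exp r' _); last exact: leq_maxr.
    apply: le_trans H; rewrite lerD2r (bigD1 i) //= lerDl sumr_ge0 // => l _.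
    exact: sn_ge0.
  by apply: le_trans (IH i k ks) (le_exp r _); exact: leq_maxl.
exists r.
have : nbhs x (\bigcap_i [set y : {ptws 'I_n -> A} | sn_ball s 1 (x i) (y i)]).
  apply: (@filter_forall _ _ _ _ (nbhs_filter x)) => i.
  have xi : nbhs (x i) (sn_ball s 1 (x i)) by exists s, 1; split.
  apply: (@filterS _ _ (nbhs_filter x)) (@continuous_coord _ A _ i x _ xi).
  by move=> y xy _.
apply: (@filterS _ _ (nbhs_filter x)) => y xy i j js; apply: le_trans (xr i j js).
rewrite -[y i](subrK (x i)) addrC; apply: le_trans (snD _ _ _) _.
by rewrite lerD2l; apply/ltW/xy.
Qed.

(** The general term of the series defining the homotopy. Locally in [y] the entries
    are at most [2 ^+ r] and [u k] is at most [2 ^+ (N * k)], so the decay of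
    [v k] at rate [N + 2] beats everything else and leaves a factor [2 ^- k.+1] over;
    [convex_geometric_sum] then controls the sums. *)
Lemma tail_small n (T : frechet K) (f : {ptws 'I_n.+2 -> A} -> T) :
  continuous f -> multilinear f -> forall (x : {ptws 'I_n.+1 -> A}) V, nbhs 0 V ->
  exists k0, \forall y \near x, forall k, (k0 <= k)%N ->
    V (2 ^+ k.+1 *: f (icons (u k) (apply_head (v k) y))).
Proof.
move=> cf mf x V V0.
have [s [d sV]] := multilinear_ball cf mf V0.
have [N [k1 Hu]] := growth_seq s.
have [t [k2 Hv]] := decay_seq s (N + 2).
have [r Hr] := locally_bounded (s ++ t) x.
exists (k1 + k2 + (r + 2 * d + 1 + n * (r + d)))%N; apply: (@filterS _ _ (nbhs_filter x)) Hr => y yr k kk.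
pose p := (N * k + d)%N; pose q := (r + d)%N.
(* Weights with product [2 ^+ k.+1]: the slot of [u k] and the slots of
   [y 1, ..., y n] are shrunk into the ball, and the slot of [v k (y 0)] is
   enlarged accordingly. *)
pose c : 'I_n.+2 -> K := icons (2 ^- p)
  (icons (2 ^+ (k.+1 + p + n * q)) (fun=> 2 ^- q)).
have n2 m : (2 : K) ^+ m != 0 by rewrite expf_neq0 // pnatr_eq0.
have e2 m : (0 : R) < 2 ^+ m by rewrite exprn_gt0.
have -> : 2 ^+ k.+1 = \prod_i c i.
  rewrite !big_ord_recl /c icons0 iconsS icons0.
  rewrite (eq_bigr (fun=> 2 ^- q)); last by move=> i _; rewrite !iconsS.
  rewrite prodr_const card_ord exprVn -exprM mulnC !exprD.
  by rewrite mulfK // mulrC mulfK // mulf_neq0.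
rewrite -multilinear_scale //; apply: sV => i j js.
have [si ti] : (forall l, List.In l s -> P l (y ord0) <= 2 ^+ r) /\
    (forall l, List.In l t -> P l (y ord0) <= 2 ^+ r).
  by split=> l ls; apply: yr; apply/List.in_or_app; [left|right].
rewrite /c; case: (unliftP ord0 i) => [i' ->|->]; last first.
  rewrite !icons0 snZ Kabs_expN2 /p exprD invfM mulrCA mulrA.
  rewrite divfK ?lt0r_neq0 //.
  by rewrite mulrC ler_pdivrMr // mul1r; apply: Hu => //; lia.
rewrite !iconsS; case: (unliftP ord0 i') => [l ->|->].
  rewrite !iconsS /apply_head dfwithout // snZ Kabs_expN2 /q exprD invfM.
  rewrite mulrCA mulrA divfK ?lt0r_neq0 //.
  rewrite mulrC ler_pdivrMr // mul1r; apply: yr.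
  by apply/List.in_or_app; left.
rewrite icons0 /apply_head dfwithin snZ Kabs_exp2 mulrA -exprD.
rewrite -(ler_pM2l (e2 r)) mulr1 mulrA -exprD.
apply: le_trans (Hv k _ (y ord0) (2 ^+ r) (ltW (e2 r)) ti j js); last by lia.
by rewrite ler_wpM2r ?sn_ge0 // ler_weXn2l ?ler1n // /p /q; nia.
Qed.


Lemma icons_dfwith n (a : A) (x : 'I_n -> A) i z :
  icons a (dfwith x i z) = dfwith (icons a x) (lift ord0 i) z.
Proof.
apply/funext => k; case: (unliftP ord0 k) => [k' ->|->]; last first.
  by rewrite dfwithout // !icons0.
rewrite iconsS; have [<-|ik] := eqVneq i k'; first by rewrite !dfwithin.
by rewrite !dfwithout ?iconsS // (inj_eq (@lift_inj _ _)).
Qed.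

Lemma apply_head_dfwith0 n (w : A -> A) (x : 'I_n.+1 -> A) z :
  apply_head w (dfwith x ord0 z) = dfwith x ord0 (w z).
Proof.
by apply/funext => k; rewrite /apply_head dfwithin; case: dfwithP => [|j j0];
  rewrite ?dfwithin ?dfwithout.
Qed.

Lemma apply_head_dfwithS n (w : A -> A) (x : 'I_n.+1 -> A) i z : ord0 != i ->
  apply_head w (dfwith x i z) = dfwith (apply_head w x) i z.
Proof.
move=> i0; apply/funext => k; rewrite /apply_head.
rewrite [dfwith x i z ord0]dfwithout 1?eq_sym //.
have [<-|ik] := eqVneq i k; first by rewrite dfwithin dfwithout // dfwithin.
rewrite [RHS]dfwithout //; have [<-|k0] := eqVneq ord0 k; first by rewrite !dfwithin.
by rewrite !dfwithout.
Qed.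

Lemma split_term_multilinear n (T : frechet K) (f : {ptws 'I_n.+2 -> A} -> T) k :
  multilinear f ->
  multilinear (fun y : {ptws 'I_n.+1 -> A} => f (icons (u k) (apply_head (v k) y))).
Proof.
move=> mf x i a b c; have [<-|i0] := eqVneq ord0 i.
  by rewrite !apply_head_dfwith0 (rs_linear rs) !icons_dfwith mf.
by rewrite !apply_head_dfwithS // !icons_dfwith mf.
Qed.

Lemma split_term_continuous n (T : frechet K) (f : {ptws 'I_n.+2 -> A} -> T) k :
  continuous f ->
  continuous (fun y : {ptws 'I_n.+1 -> A} => f (icons (u k) (apply_head (v k) y))).
Proof.
move=> cf x.
apply: (@continuous_comp _ _ _ (fun y : {ptws 'I_n.+1 -> A} =>
  icons (u k) (apply_head (v k) y) : {ptws 'I_n.+2 -> A}) f); last exact: cf.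
apply: continuous_ptws => i; case: (unliftP ord0 i) => [i' ->|->]; last first.
  have -> : (fun y : {ptws 'I_n.+1 -> A} => icons (u k) (apply_head (v k) y) ord0) =
    (fun=> u k) by apply/funext => y; rewrite icons0.
  by apply: cvg_cst; exact: nbhs_filter.
have -> : (fun y : {ptws 'I_n.+1 -> A} =>
    icons (u k) (apply_head (v k) y) (lift ord0 i')) =
    (fun y => apply_head (v k) y i') by apply/funext => y; rewrite iconsS.
have [<-|i0] := eqVneq ord0 i'.
  have -> : (fun y : {ptws 'I_n.+1 -> A} => apply_head (v k) y ord0) =
    (fun y => v k (y ord0)) by apply/funext => y; rewrite /apply_head dfwithin.
  apply: (@continuous_comp _ _ _ (fun y : {ptws 'I_n.+1 -> A} => y ord0) (v k)).
    exact: continuous_coord.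
  exact: (rs_continuous rs).
have -> : (fun y : {ptws 'I_n.+1 -> A} => apply_head (v k) y i') =
    (fun y => y i') by apply/funext => y; rewrite /apply_head dfwithout.
exact: continuous_coord.
Qed.

(** The series converges locally uniformly, so its sum is again continuous and
    factors through the completed tensor power. *)
Lemma split_series n (T : frechet K) (f : {ptws 'I_n.+2 -> A} -> T) :
  continuous f -> multilinear f ->
  exists F : {ptws 'I_n.+1 -> A} -> T, [/\ continuous F, multilinear F &
    forall y, (fun N => \sum_(0 <= k < N) f (icons (u k) (apply_head (v k) y)))
      @ \oo --> F y].
Proof.
move=> cf mf.
pose S N (y : {ptws 'I_n.+1 -> A}) :=
  \sum_(0 <= k < N) f (icons (u k) (apply_head (v k) y)).
have [|x V V0|F cF SF] := @locally_uniform_limit K _ T S.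
- move=> N x; apply: continuous_sum => k; exact: split_term_continuous.
- have V1 : nbhs 0 (V `&` [set z | V (- z)]).
    by apply: filterI => //; exact: nbhs0_opp.
  have [W W0 [cW WV]] := convex_nbhs0 V1.
  have [k0 H] := tail_small cf mf x W0.
  exists k0; apply: (@filterS _ _ (nbhs_filter x)) H => y yW M N Mk Nk.
  have D a b : (k0 <= a)%N -> (a <= b)%N -> W (S b y - S a y).
    move=> ka ab; rewrite /S (@big_cat_nat _ _ _ a) //= addrAC subrr add0r.
    apply: convex_geometric_sum => //; first exact: nbhs_singleton.
    by move=> k ak; apply: yW; exact: leq_trans ak.
  have [MN|/ltnW NM] := leqP M N; first by have [] := WV _ (D _ _ Mk MN).
  by have [_ /=] := WV _ (D _ _ Nk NM); rewrite opprB.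
- exists F; split=> // x i a b c.
  apply: frechet_lim_unique (SF _) _.
  have -> : S ^~ (dfwith x i (a *: b + c)) =
      (fun N => a *: S N (dfwith x i b) + S N (dfwith x i c)).
    apply/funext => N; rewrite /S scaler_sumr -big_split.
    by apply: eq_bigr => k _; rewrite (split_term_multilinear k mf).
  exact: cvg_lin.
Qed.

(** Contracting the first two slots of [u (x) v x0 (x) x1 (x) ...] multiplies
    [u] with [v x0]; together with [contractS_icons] and [contract_apply_head] this
    computes the differential of the homotopy. *)
Lemma contract0_icons n (a : A) (x : 'I_n.+1 -> A) :
  contract mul ord0 (icons a x) = dfwith x ord0 (mul a (x ord0)).
Proof.
apply/funext => k; rewrite /contract ltn0.
have [->|k0] := eqVneq k ord0.
  rewrite dfwithin iconsS; congr (mul _ _).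
  by rewrite (_ : widen_ord _ ord0 = ord0) ?icons0 //; apply/val_inj.
by rewrite dfwithout 1?eq_sym // iconsS.
Qed.

Lemma apply_head_head n (w w' : A -> A) (x : 'I_n.+1 -> A) :
  dfwith (apply_head w x) ord0 (w' (apply_head w x ord0)) =
  dfwith x ord0 (w' (w (x ord0))).
Proof.
apply/funext => k; rewrite /apply_head dfwithin.
by have [<-|k0] := eqVneq ord0 k; rewrite ?dfwithin // !dfwithout.
Qed.

Lemma contractS_icons n (a : A) (x : 'I_n.+2 -> A) (j : 'I_n.+1) :
  contract mul (lift ord0 j) (icons a x) = icons a (contract mul j x).
Proof.
apply/funext => k; case: (unliftP ord0 k) => [k' ->|->]; last first.
  rewrite icons0 /contract /= (_ : widen_ord _ ord0 = ord0) ?icons0 //.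
  exact/val_inj.
rewrite iconsS /contract !(inj_eq (@lift_inj _ _)) iconsS.
have -> : widen_ord (leqnSn n.+2) (lift ord0 k') = lift ord0 (widen_ord (leqnSn _) k').
  exact/val_inj.
by rewrite iconsS.
Qed.

Lemma contract_apply_head n k (x : 'I_n.+2 -> A) (j : 'I_n.+1) :
  contract mul j (apply_head (v k) x) = apply_head (v k) (contract mul j x).
Proof.
have w0 m : widen_ord (leqnSn m.+1) ord0 = ord0 by exact/val_inj.
apply/funext => i; rewrite /apply_head.
have [<-|i0] := eqVneq ord0 i; last first.
  by rewrite [RHS]dfwithout // /contract !dfwithout.
rewrite dfwithin /contract w0 dfwithin dfwithout //.
by case: (unliftP ord0 j) => [j' ->|->] //=; rewrite (rs_mul rs).
Qed.

(** In [b' (s x)] the contraction of the first two slots yields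
    [sum_k u k * v k x0], which is [x0]. The other contractions leave [u k] alone and
    commute with [v k] by [rs_mul], so they cancel against [s (b' x)] because of the
    shift of sign. *)
Theorem bar_contracting (C : bar_complex mul) :
  exists s : forall n, chom (bar_obj C n) (bar_obj C n.+1),
    contracting_homotopy (bar_d C) s.
Proof.
pose term n k (y : 'I_n.+1 -> A) :=
  bar_tensor C (icons (u k) (apply_head (v k) y)).
have sP : forall n, exists s : chom (bar_obj C n) (bar_obj C n.+1),
    forall y, (fun N => \sum_(0 <= k < N) term n k y) @ \oo -->
      s (bar_tensor C y).
  move=> n; have [ct mt _] := bar_tensorP C n.+1.
  have [F [cF mF SF]] := split_series ct mt.
  have [_ _ ut] := bar_tensorP C n.
  by have [g gF _] := ut _ F cF mF; exists g => y; rewrite gF; exact: SF.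
pose s n := sval (cid (sP n)).
have sE n y : (fun N => \sum_(0 <= k < N) term n k y) @ \oo --> s n (bar_tensor C y)
  := svalP (cid (sP n)) y.
have sum_cvg n (y : 'I_n.+1 -> A) :
    (fun N => bar_tensor C (dfwith y ord0
      (\sum_(0 <= k < N) mul (u k) (v k (y ord0))))) @ \oo --> bar_tensor C y.
  have [ct _ _] := bar_tensorP C n.
  have := @rs_sum _ _ _ rs (y ord0).
  have Ey : dfwith y ord0 (y ord0) = y by apply/funext => i; case: dfwithP.
  move=> H; rewrite -[X in _ --> bar_tensor C X]Ey.
  apply: (cvg_comp (fun N => \sum_(0 <= k < N) mul (u k) (v k (y ord0)))
    (fun z => bar_tensor C (dfwith y ord0 z)) H).
  apply: (@continuous_comp _ _ _ (dfwith y ord0 : A -> {ptws 'I_n.+1 -> A})).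
    exact: (@dfwith_continuous _ (fun=> A)).
  exact: ct.
exists s; split=> [x|n x].
  have [h hE] := chom_comp (bar_d C 0%N) (s 0%N).
  have [i iE] := chom_id (bar_obj C 0%N).
  rewrite -hE -[RHS]iE; apply: tensor_power_ext (bar_tensorP C 0%N) _ x => y.
  rewrite hE iE; apply: frechet_lim_unique (sum_cvg _ y).
  apply: eq_cvg_seq (cvg_chom (g := bar_d C 0%N) (sE 0%N y)) => N.
  have [_ mt _] := bar_tensorP C 0%N.
  rewrite linear_sum multilinear_sum //; apply: eq_bigr => k _.
  rewrite bar_dE big_ord1 expr0 scale1r contract0_icons.
  by rewrite apply_head_head.
have [h hE] := chom_comp (bar_d C n.+1) (s n.+1).
have [h' h'E] := chom_comp (s n) (bar_d C n).
have [g gE] := chom_add h h'.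
have [i iE] := chom_id (bar_obj C n.+1).
rewrite -hE -h'E -gE -[RHS]iE.
apply: tensor_power_ext (bar_tensorP C n.+1) _ x => y.
rewrite gE hE h'E iE bar_dE linear_sum.
under eq_bigr do rewrite linearZ.
have HB := cvg_sum_lin (r := index_enum 'I_n.+1)
  (a := fun j : 'I_n.+1 => (-1) ^+ j)
  (fun j : 'I_n.+1 => sE n (contract mul j y)).
have := cvg_lin (a := 1) (cvg_chom (g := bar_d C n.+1) (sE n.+1 y)) HB; rewrite scale1r.
move=> H; apply: frechet_lim_unique H _.
apply: eq_cvg_seq (sum_cvg _ y) => N; apply: esym.
have [_ mt _] := bar_tensorP C n.+1.
rewrite scale1r linear_sum multilinear_sum //.
under [X in _ + X = _]eq_bigr do rewrite scaler_sumr.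
rewrite exchange_big -big_split; apply: eq_bigr => k _ /=.
rewrite bar_dE big_ord_recl expr0 scale1r contract0_icons apply_head_head.
rewrite -addrA -big_split big1 ?addr0 // => j _ /=.
rewrite contractS_icons contract_apply_head /term /bump /= add1n exprS.
by rewrite mulN1r scaleNr addNr.
Qed.

End Homotopy.

(** * Kernels and exactness *)

Section Kernel.
Variables (K : numFieldType) (B C : frechet K) (p : chom B C).

Definition ker_pred : {pred B} := [pred x | p x == 0].

Lemma ker_pred_submod : submod_closed ker_pred.
Proof.
split=> [|a x y]; first by rewrite inE linear0.
by rewrite !inE => /eqP x0 /eqP y0; rewrite linearP x0 y0 scaler0 addr0.
Qed.

HB.instance Definition _ := GRing.isSubmodClosed.Build K B ker_pred
  ker_pred_submod.

Record ker_sub := KerSub { ker_val : B; _ : ker_val \in ker_pred }.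

HB.instance Definition _ := [isSub for ker_val].
HB.instance Definition _ := [Choice of ker_sub by <:].
HB.instance Definition _ := [SubChoice_isSubLmodule of ker_sub by <:].

Local Notation T := ker_sub.

Definition ker_nbhs (x : T) : set_system T :=
  [set U | exists2 V, nbhs (ker_val x) V & forall y, V (ker_val y) -> U y].

HB.instance Definition _ := hasNbhs.Build T ker_nbhs.

Lemma ker_nbhs_filter (x : T) : ProperFilter (nbhs x).
Proof.
split; first by move=> [V Vx /(_ x)]; apply; exact: nbhs_singleton Vx.
split.
- by exists setT => //; exact: filterT.
- move=> U U' [V Vx VU] [V' V'x V'U].
  exists (V `&` V'); first exact: filterI.
  by move=> y [/VU ? /V'U ?].
- by move=> U U' UU' [V Vx VU]; exists V => // y /VU /UU'.
Qed.

Lemma ker_nbhs_singleton (x : T) (A : set T) : nbhs x A -> A x.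
Proof. by move=> [V /nbhs_singleton Vx]; exact. Qed.

Lemma ker_nbhs_nbhs (x : T) (A : set T) : nbhs x A -> nbhs x (nbhs^~ A).
Proof.
move=> [V Vx VA]; exists (nbhs^~ V); first exact: nbhs_interior.
by move=> y Vy; exists V.
Qed.

HB.instance Definition _ := Nbhs_isNbhsTopological.Build T
  ker_nbhs_filter ker_nbhs_singleton ker_nbhs_nbhs.

Lemma ker_add_continuous : continuous (fun x : T * T => x.1 + x.2).
Proof.
move=> [x y] U [V /= Vxy VU].
have /= [[V1 V2] /= [V1x V2y] V12] := @add_continuous B (ker_val x, ker_val y) V Vxy.
exists ([set z | V1 (ker_val z)], [set z | V2 (ker_val z)]) => /=.
  by split; [exists V1|exists V2].
by move=> [z t] /= [z1 t2]; apply: VU; apply: (V12 (ker_val z, ker_val t)).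
Qed.

Lemma ker_scale_continuous : continuous (fun z : K^o * T => z.1 *: z.2).
Proof.
move=> [a x] U [V /= Vax VU].
have /= [[V1 V2] /= [V1a V2x] V12] := @scale_continuous K B (a, ker_val x) V Vax.
exists (V1, [set z | V2 (ker_val z)]) => /=; first by split=> //; exists V2.
by move=> [z t] /= [z1 t2]; apply: VU; apply: (V12 (z, ker_val t)).
Qed.

Lemma ker_locally_convex : exists2 b : set_system T,
  (forall U, U \in b -> convex_set U) & basis b.
Proof.
have [b cb [ob bb]] := @locally_convex K B.
exists [set U | exists2 V, b V & U = [set z | V (ker_val z)]].
  move=> U /[!inE] -[V bV ->] x y t /[!inE] Vx Vy.
  have := cb V (mem_set bV) (ker_val x) (ker_val y) t (mem_set Vx) (mem_set Vy).
  by rewrite inE.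
split=> [_ [V bV ->]|x U [V Vx VU]].
  rewrite openE => x Vx; exists V => //.
  by apply: open_nbhs_nbhs; split=> //; exact: ob.
have [W [bW Wx] WV] := bb _ _ Vx.
exists [set z | W (ker_val z)]; first by split=> //; exists W.
by move=> z /WV /VU.
Qed.

HB.instance Definition _ := PreTopologicalLmod_isTvs.Build K T
  ker_add_continuous ker_scale_continuous ker_locally_convex.
HB.instance Definition _ :=
  PreTopologicalNmodule_isTopologicalNmodule.Build T ker_add_continuous.
HB.instance Definition _ := TopologicalNmodule_isTopologicalLmodule.Build
  K T ker_scale_continuous.
HB.instance Definition _ := Uniform_isTvs.Build K T ker_locally_convex.

Lemma ker_val_continuous : continuous (ker_val : T -> B).
Proof. by move=> x V Vx; exists V. Qed.

Lemma ker_hausdorff : hausdorff_space T.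
Proof.
move=> x y xy; apply: val_inj; apply: (@frechet_hausdorff _ B) => U V Ux Vy.
have [z [Uz Vz]] : [set z | U (ker_val z)] `&` [set z | V (ker_val z)] !=set0.
  by apply: xy; [exists U|exists V].
by exists (ker_val z).
Qed.

Lemma ker_metrizable : exists2 U : nat -> set T,
  (forall n, nbhs (0 : T) (U n)) &
  forall V, nbhs (0 : T) V -> exists n, U n `<=` V.
Proof.
have [U U0 Ub] := frechet_metrizable B.
exists (fun n => [set z | U n (ker_val z)]) => [n|V [W W0 WV]]; first by exists (U n).
by have [n Un] := Ub W W0; exists n => z /Un /WV.
Qed.

Lemma ker_complete (u : nat -> T) :
  (fun q : nat * nat => u q.1 - u q.2) @ filter_prod \oo \oo --> (0 : T) ->
  exists l : T, u @ \oo --> l.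
Proof.
move=> cu; have [|l ul] := @frechet_complete _ B (fun n => ker_val (u n)).
  move=> V V0; have := cu [set z | V (ker_val z)]; apply.
  by exists V.
have pl : l \in ker_pred.
  rewrite inE; apply/eqP; apply: (frechet_lim_unique (cvg_chom (g := p) ul)).
  apply: eq_cvg_seq (cvg_cst (0 : C)) => n.
  by case: (u n) => x /= /eqP.
exists (KerSub pl) => U [V Vl VU].
by apply: (@filterS _ _ eventually_filter) (ul V Vl) => n /VU.
Qed.

Definition ker_frechet : frechet K :=
  @Frechet K T ker_hausdorff ker_metrizable ker_complete.

(** The lifting property is stated for plain continuous linear functions so that it
    applies before such a function has been packed. *)
Lemma kernel_exists : exists Z (i : chom Z B), [/\ injective i, is_kernel i p &
  forall (D : frechet K) (f : D -> B), (forall a u v, f (a *: u + v) = a *: f u + f v) ->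
    continuous f -> (forall x, p (f x) = 0) ->
    exists g : chom D Z, forall x, i (g x) = f x].
Proof.
have [i iE] := @chom_of_linear K ker_frechet B ker_val (fun _ _ _ => erefl)
  ker_val_continuous.
have lift_ker (D : frechet K) (f : D -> B) :
    (forall a u v, f (a *: u + v) = a *: f u + f v) ->
    continuous f -> (forall x, p (f x) = 0) ->
    exists g : chom D ker_frechet, forall x, i (g x) = f x.
  move=> lf cf pf.
  have pf' x : f x \in ker_pred by rewrite inE pf.
  have [|x U [V Vx VU]|g gE] := @chom_of_linear K D ker_frechet (fun x => KerSub (pf' x)).
  - by move=> a u v; apply: val_inj; exact: lf.
  - by apply: (@filterS _ _ (nbhs_filter x)) (cf x V Vx) => y Vy; exact: VU.
  - by exists g => x; rewrite iE gE.
exists ker_frechet, i; split=> [x y||//]; first by rewrite !iE => /val_inj.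
split=> [x|D f pf].
  by rewrite iE; case: x => x /= /eqP.
have [||//|g gE] := lift_ker D f; [exact: linearP|exact: chom_continuous|].
exists g => // g' g'E x; apply: val_inj.
by have := g'E x; rewrite -gE !iE.
Qed.

End Kernel.

Section Exactness.
Variables (K : numFieldType) (S : exact_structure K).

(** Every exact structure contains the split sequences; the projection
    [1 - s \o p] provides the missing retraction onto the kernel. *)
Lemma split_deflation B C (p : chom B C) (s : chom C B) :
  (forall x, p (s x) = x) -> deflation S p.
Proof.
move=> ps; have [Z [i [ii ki iU]]] := kernel_exists p.
have [sp spE] := chom_comp s p.
have [one oneE] := chom_id B.
have [e eE] := chom_sub one sp.
have [|||r rE] := iU B e; [exact: linearP|exact: chom_continuous| |].
  by move=> x; rewrite eE oneE spE linearB /= ps subrr.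
exists Z, i; apply: (conflation_split S (r := r) (s := s)) => // x.
  by apply: ii; rewrite rE eE oneE spE (proj1 ki) linear0 subr0.
by rewrite rE eE oneE spE subrK.
Qed.

(** On the kernel of [d n] the homotopy is a right inverse of [d n.+1], so the map
    onto that kernel is a split epimorphism. *)
Lemma contracting_exact (C : nat -> frechet K) (d : forall n, chom (C n.+1) (C n))
    (s : forall n, chom (C n) (C n.+1)) :
  contracting_homotopy d s -> (forall n x, d n (d n.+1 x) = 0) ->
  exact_complex S d.
Proof.
move=> [ds0 dsS] dd; split; first exact: split_deflation ds0.
move=> n; have [Z [i [ii ki iU]]] := kernel_exists (d n).
have [|||e eE] := iU _ (d n.+1); [exact: linearP|exact: chom_continuous|exact: dd|].
have [t tE] := chom_comp (s n.+1) i.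
exists Z, i, e; split=> //.
apply: (split_deflation (s := t)) => x.
apply: ii; rewrite eE tE; have := dsS n (i x).
by rewrite (proj1 ki) linear0 addr0.
Qed.

End Exactness.

(** * The bar complex and its tensor products are complexes *)

Section BarSquare.
Variables (K : numFieldType) (A : tvsType K) (mul : A -> A -> A).
Hypothesis mulA : forall x y z, mul x (mul y z) = mul (mul x y) z.

(** [contract] on sequences indexed by all of [nat], where the simplicial identity
    is a plain case analysis on indices. *)
Let cN (j : nat) (X : nat -> A) (k : nat) : A :=
  if (k < j)%N then X k else if k == j then mul (X k) (X k.+1) else X k.+1.

Let cN_cN i j X k : (j <= i)%N -> cN i (cN j X) k = cN j (cN i.+1 X) k.
Proof.
move=> ji; rewrite /cN; do ![case: ltngtP => ?]; try (exfalso; lia);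
  by rewrite ?mulA.
Qed.

Let contractE n (j : 'I_n.+1) (x : 'I_n.+2 -> A) k :
  contract mul j x k = cN j (fun l => x (inord l)) k.
Proof.
have Ew : inord k = widen_ord (leqnSn n.+1) k.
  by apply/val_inj; rewrite /= inordK // ltnW // ltnS.
have El : inord k.+1 = lift ord0 k.
  by apply/val_inj; rewrite /= inordK // ltnS.
by rewrite /contract /cN Ew El.
Qed.

Lemma contract_contract n (j : 'I_n.+2) (i : 'I_n.+1) (j' : 'I_n.+1)
    (i' : 'I_n.+2) (x : 'I_n.+3 -> A) :
  (j <= i)%N -> j' = j :> nat -> i' = i.+1 :> nat ->
  contract mul i (contract mul j x) = contract mul j' (contract mul i' x).
Proof.
move=> ji jj ii; apply/funext => k.
have E (l : 'I_n.+2) : (fun a => contract mul l x (inord a)) =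
    (fun a => cN l (fun b => x (inord b)) (inord a : 'I_n.+2)).
  by apply/funext => a; rewrite contractE.
have E' (a : 'I_n.+1) (l : 'I_n.+2) :
    cN a (fun b => cN l (fun b => x (inord b)) (inord b : 'I_n.+2)) k =
    cN a (cN l (fun b => x (inord b))) k.
  by rewrite {1 3}/cN !inordK ?ltnS //; have := ltn_ord k; lia.
by rewrite !contractE !E !E' jj ii cN_cN.
Qed.

(** The terms of the double sum cancel in pairs, by a sign-reversing involution on the
    pairs of successive contractions. *)
Lemma bar_square (C : bar_complex mul) n x : bar_d C n (bar_d C n.+1 x) = 0.
Proof.
have [h hE] := chom_comp (bar_d C n) (bar_d C n.+1).
have [z zE] := chom_zero (bar_obj C n.+2) (bar_obj C n).
rewrite -hE -[RHS](zE x); apply: tensor_power_ext (bar_tensorP C _) _ x => y.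
rewrite hE zE bar_dE linear_sum.
pose F (p : 'I_n.+2 * 'I_n.+1) : bar_obj C n :=
  (-1) ^+ (p.1 + p.2) *: bar_tensor C (contract mul p.2 (contract mul p.1 y)).
have -> : \sum_(j < n.+2) bar_d C n ((-1) ^+ j *: bar_tensor C (contract mul j y))
    = \sum_p F p.
  rewrite -(pair_bigA _ (fun j i => F (j, i))); apply: eq_bigr => j _.
  rewrite linearZ /= bar_dE scaler_sumr; apply: eq_bigr => i _.
  by rewrite scalerA -exprD.
(* The simplicial identity exchanges [(j, i)] and [(i + 1, j)] for [j <= i]. *)
pose h' (p : 'I_n.+2 * 'I_n.+1) : 'I_n.+2 * 'I_n.+1 :=
  if (p.1 <= p.2)%N then (inord p.2.+1, inord p.1) else (inord p.2, inord p.1.-1).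
have h'1 (p : 'I_n.+2 * 'I_n.+1) : (p.1 <= p.2)%N -> (h' p).1 = p.2.+1 :> nat /\ (h' p).2 = p.1 :> nat.
  case: p => j i /= ji; rewrite /h' /= ji /= !inordK //; have := ltn_ord i; lia.
have h'2 (p : 'I_n.+2 * 'I_n.+1) : (p.1 <= p.2)%N = false ->
    (h' p).1 = p.2 :> nat /\ (h' p).2 = p.1.-1 :> nat.
  case: p => j i /= ji; rewrite /h' /= ji /= !inordK //;
    have := ltn_ord i; have := ltn_ord j; lia.
have h'K : involutive h'.
  move=> p; have pE (q : 'I_n.+2 * 'I_n.+1) : (q.1 = p.1 :> nat) -> (q.2 = p.2 :> nat) -> q = p.
    by case: q p => [? ?] [? ?] /= /val_inj -> /val_inj ->.
  case: (boolP (p.1 <= p.2)%N) => [H|/negbTE H].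
    have [a b] := h'1 p H.
    have H' : ((h' p).1 <= (h' p).2)%N = false by rewrite a b ltnNge H.
    by have [c d] := h'2 _ H'; apply: pE; [rewrite c b|rewrite d a].
  have [a b] := h'2 p H.
  have H' : ((h' p).1 <= (h' p).2)%N by rewrite a b; lia.
  by have [c d] := h'1 _ H'; apply: pE; [rewrite c b; lia|rewrite d a].
have FN p : F (h' p) = - F p.
  wlog H : p / (p.1 <= p.2)%N.
    move=> W; case: (boolP (p.1 <= p.2)%N) => [/W//|/negbTE H].
    have [a b] := h'2 p H; have := W (h' p); rewrite h'K a b => -> //.
      by rewrite opprK.
    by lia.
  have [a b] := h'1 p H; rewrite /F.
  rewrite -(contract_contract (j := p.1) (i := p.2)) // a b.
  by rewrite addSn exprS mulN1r scaleNr addnC.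
have SN : \sum_p F p = - \sum_p F p.
  rewrite -sumrN; under [RHS]eq_bigr do rewrite -FN.
  by rewrite (reindex_inj (inv_inj h'K)).
have : 2 *: (\sum_p F p) = 0 by rewrite scaler_nat mulr2n {1}SN addNr.
by move=> /eqP; rewrite scaler_eq0 pnatr_eq0 => /eqP.
Qed.

End BarSquare.

Section TensorVector.
Variables (K : numFieldType) (C : nat -> frechet K) (V : frechet K).
Variables (d : forall n, chom (C n.+1) (C n)) (D : tensor_complex d V).

Lemma tensor_square : (forall n x, d n (d n.+1 x) = 0) ->
  forall n x, tc_d D n (tc_d D n.+1 x) = 0.
Proof.
move=> dd n x.
have [h hE] := chom_comp (tc_d D n) (tc_d D n.+1).
have [z zE] := chom_zero (tc_obj D n.+2) (tc_obj D n).
rewrite -hE -[RHS](zE x); apply: tensor_ext (tc_tensorP D _) _ x => y v.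
have [_ [l _] _] := tc_tensorP D n.
by rewrite hE zE !tc_dE dd -{1}[0](subrr 0) -scaleN1r addrC l scaleN1r addNr.
Qed.

Lemma tensor_contracting (s : forall n, chom (C n) (C n.+1)) :
  contracting_homotopy d s ->
  exists t : forall n, chom (tc_obj D n) (tc_obj D n.+1),
    contracting_homotopy (tc_d D) t.
Proof.
move=> [ds0 dsS].
have tP n : exists t : chom (tc_obj D n) (tc_obj D n.+1),
    forall x v, t (tc_tensor D x v) = tc_tensor D (s n x) v.
  have [_ _ ut] := tc_tensorP D n; have [ct [ml mr] _] := tc_tensorP D n.+1.
  have [||g gE _] := ut _ (fun x v => tc_tensor D (s n x) v); last by exists g.
    move=> z; apply: (@continuous_comp _ _ _ (fun z : C n * V => (s n z.1, z.2))
      (fun z => tc_tensor D z.1 z.2)); last exact: ct.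
    apply: cvg_pair; last exact: cvg_snd.
    by apply: (@continuous_comp _ _ _ fst (s n)); [exact: cvg_fst|exact: chom_continuous].
  by split=> [a x y v|x a v w]; rewrite ?linearP ?ml ?mr.
pose t n := sval (cid (tP n)).
have tE n x v : t n (tc_tensor D x v) = tc_tensor D (s n x) v := svalP (cid (tP n)) x v.
exists t; split=> [x|n x].
  have [h hE] := chom_comp (tc_d D 0%N) (t 0%N).
  have [i iE] := chom_id (tc_obj D 0%N).
  rewrite -hE -[RHS]iE; apply: tensor_ext (tc_tensorP D 0%N) _ x => y v.
  by rewrite hE iE tE tc_dE ds0.
have [h hE] := chom_comp (tc_d D n.+1) (t n.+1).
have [h' h'E] := chom_comp (t n) (tc_d D n).
have [g gE] := chom_add h h'.
have [i iE] := chom_id (tc_obj D n.+1).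
rewrite -hE -h'E -gE -[RHS]iE.
apply: tensor_ext (tc_tensorP D n.+1) _ x => y v.
have [_ [l _] _] := tc_tensorP D n.+1.
rewrite gE hE h'E iE tE !tc_dE tE -[in RHS](dsS n y).
by rewrite -[X in tc_tensor D (X + _)]scale1r l scale1r.
Qed.

End TensorVector.

Theorem contracting_homologically_unital (K : numFieldType) (S : exact_structure K)
    (A : tvsType K) (mul : A -> A -> A) :
  (forall x y z, mul x (mul y z) = mul (mul x y) z) ->
  (forall C : bar_complex mul, exists s, contracting_homotopy (bar_d C) s) ->
  homologically_unital S mul.
Proof.
move=> mulA hs C V D; have [s sP] := hs C.
have [t tP] := tensor_contracting D sP.
by apply: contracting_exact tP _; apply: tensor_square; exact: bar_square.
Qed.

(** * Mean values and the chain rule for partial derivatives *)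

Lemma near_forall (I : finType) (T : Type) (F : set_system T) (FF : Filter F)
    (P : I -> T -> Prop) : (forall i, F (P i)) -> F (fun t => forall i, P i t).
Proof.
move=> FP; have H : F (\bigcap_i [set t | P i t]).
  by apply: filter_forall => i; apply: filterS (FP i) => t.
by apply: filterS H => t Pt i; exact: Pt.
Qed.

Lemma cvg_bigsum (R : realType) (I : Type) (s : seq I) (T : Type) (F : set_system T)
    (FF : Filter F) (f : I -> T -> R) (l : I -> R) :
  (forall i, f i @ F --> l i) ->
  (fun t => \sum_(i <- s) f i t) @ F --> \sum_(i <- s) l i.
Proof.
move=> fl; elim: s => [|i s IH].
  rewrite big_nil; under eq_fun do rewrite big_nil; exact: cvg_cst.
rewrite big_cons; under eq_fun do rewrite big_cons; exact: cvgD.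
Qed.

Section Multivariate.
Variables (R : realType) (m : nat).
Local Notation V := 'rV[R]_m.
Implicit Types (g : V -> R) (U : set V) (x h v w : V) (i j : 'I_m).
Implicit Types a t r e : R.
Local Notation delta i := (delta_mx 0 i : V).

Lemma nbhs_cube x U : nbhs x U <->
  exists2 r, 0 < r & forall w, (forall i, `|w 0 i - x 0 i| < r) -> U w.
Proof.
split=> [/nbhs_ballP [r /= r0 rU]|[r r0 rU]].
  exists r => // w wx; apply: rU; split=> // k i.
  by rewrite (ord1 k) -ball_normE /= distrC.
apply/nbhs_ballP; exists r => // w [_ H]; apply: rU => i.
by have := H 0 i; rewrite -ball_normE /= distrC.
Qed.

Lemma cvg_coord (T : Type) (F : set_system T) (FF : Filter F) (f : T -> V) x :
  (forall i, (fun z => f z 0 i) @ F --> x 0 i) -> f @ F --> x.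
Proof.
move=> fx U /nbhs_cube [r r0 rU].
change (F (f @^-1` U)).
have H i : F (fun z => `|f z 0 i - x 0 i| < r).
  by have /cvgrPdist_lt /(_ r r0) := fx i; apply: filterS => z; rewrite distrC.
by apply: filterS (near_forall FF H) => z Hz; exact: rU.
Qed.

Lemma continuous_entry i : continuous (fun v : V => v 0 i).
Proof.
exact: coord_continuous.
Qed.

Lemma is_derive_line g x i t : derivable g (x + t *: delta i) (delta i) ->
  is_derive t 1 (fun s : R => g (x + s *: delta i)) ('D_(delta i) g (x + t *: delta i)).
Proof.
set G := fun s : R => _ => dg.
have E : (fun k : R => k^-1 *: ((G \o shift t) (k *: 1) - G t)) =
   (fun k => k^-1 *: ((g \o shift (x + t *: delta i)) (k *: delta i) - g (x + t *: delta i))).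
  apply/funext => k /=; congr (_ *: (_ - _)); rewrite /G; congr g.
  by rewrite [k%:A]mulr1 scalerDl addrCA.
by split; rewrite ?/derivable ?/derive E.
Qed.

Lemma mean_value_line g x i a :
  (forall t, 0 <= t <= 1 -> derivable g (x + (t * a) *: delta i) (delta i)) ->
  exists2 t, 0 <= t <= 1 & g (x + a *: delta i) - g x =
    a * 'D_(delta i) g (x + (t * a) *: delta i).
Proof.
move=> dg; pose G (s : R) := g (x + (s * a) *: delta i).
have dG t : 0 <= t <= 1 ->
    is_derive t 1 G (a * 'D_(delta i) g (x + (t * a) *: delta i)).
  move=> t01; have := is_derive_line (dg t t01).
  set H := fun s : R => _ => dH.
  have dl : is_derive t 1 (fun s : R => s * a) a.
    have := @is_deriveZ _ _ _ id a t 1 1 _; rewrite /GRing.scale /= mulr1.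
    move=> /(_ (is_derive_id _ _)); congr (is_derive _ _ _ _).
    by apply/funext => s /=; rewrite mulrC.
  have := @is_derive1_comp _ H (fun s => s * a) t _ _ dH dl.
  by rewrite mulrC.
have [||t t01 Ht] := @MVT_segment R G (fun t => a * 'D_(delta i) g (x + (t * a) *: delta i)) 0 1 ler01.
- by move=> t; rewrite in_itv /= => /andP[t0 t1]; apply: dG; rewrite !ltW.
- apply: derivable_within_continuous => t; rewrite in_itv /= => t01.
  by have [] := dG t t01.
- exists t; first by rewrite in_itv in t01.
  by rewrite subr0 mulr1 in Ht; rewrite -Ht /G mul1r mul0r scale0r addr0.
Qed.

Definition in_box x h w :=
  forall i, exists2 t, 0 <= t <= 1 & w 0 i = x 0 i + t * (h : V) 0 i.

(** Walk from [x] to [x + h] along the coordinate axes, one coordinate at a time, and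
    use the mean value theorem of one variable on each leg. *)
Lemma mean_value_box g x (h : V) :
  (forall w, in_box x h w -> forall i, derivable g w (delta i)) ->
  exists2 xi : 'I_m -> V, forall i, in_box x h (xi i) &
    g (x + h) - g x = \sum_i h 0 i * 'D_(delta i) g (xi i).
Proof.
move=> dg; pose P (l : nat) : V := \row_c (x 0 c + if (c < l)%N then h 0 c else 0).
have step i : exists2 w, in_box x h w &
    g (P i.+1) - g (P i) = h 0 i * 'D_(delta i) g w.
  have PS : P i.+1 = P i + h 0 i *: delta i.
    apply/rowP => c; rewrite !mxE eqxx /= ltnS leq_eqVlt.
    have [ci|ci] := eqVneq (c : nat) i; rewrite -(inj_eq val_inj) /=.
      by rewrite ci eqxx ltnn /= mulr1 addr0 (_ : c = i) //; exact: val_inj.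
    by rewrite (negbTE ci) /= mulr0 addr0.
  have inb t : 0 <= t <= 1 -> in_box x h (P i + (t * h 0 i) *: delta i).
    move=> t01 c; have [->|ci] := eqVneq c i.
      by exists t => //; rewrite !mxE !eqxx ltnn addr0 mulr1.
    exists (if (c < i)%N then 1 else 0); first by case: ifP; rewrite lexx ler01.
    by rewrite !mxE eqxx (negbTE ci) mulr0 addr0; case: ifP; rewrite ?mul1r ?mul0r.
  rewrite PS; have [t t01 ->] := mean_value_line (fun t t01 => dg _ (inb t t01) i).
  by exists (P i + (t * h 0 i) *: delta i) => //; exact: inb.
have /choice [xi xiP] : forall i, exists w, in_box x h w /\
    g (P i.+1) - g (P i) = h 0 i * 'D_(delta i) g w.
  by move=> i; have [w] := step i; exists w.
exists xi => [i|]; first exact: (xiP i).1.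
have -> : x + h = P m by apply/rowP => c; rewrite !mxE ltn_ord.
have -> : x = P 0%N by apply/rowP => c; rewrite !mxE ltn0 addr0.
rewrite -(telescope_sumr (fun l => g (P l))) // big_mkord.
by apply: eq_bigr => i _; exact: (xiP i).2.
Qed.

Lemma in_box_near x h w i : in_box x h w -> `|w 0 i - x 0 i| <= `|h 0 i|.
Proof.
move=> /(_ i) [t /andP[t0 t1] ->]; rewrite addrC addKr normrM ger0_norm //.
by rewrite ler_piMl.
Qed.

(** The chain rule. The difference quotient is rewritten with [mean_value_box], and
    the intermediate points converge; continuity of the partial derivatives takes the
    place of total differentiability. *)
Lemma is_derive_comp_row (W : normedModType R) (Phi : W -> V) (v w : W) g (dPhi : V) :
  (\forall y \near Phi v, forall i, derivable g y (delta i)) ->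
  (forall i, {for Phi v, continuous (fun y => 'D_(delta i) g y)}) ->
  (forall i, is_derive v w (fun u => Phi u 0 i) (dPhi 0 i)) ->
  is_derive v w (fun u => g (Phi u)) (\sum_i dPhi 0 i * 'D_(delta i) g (Phi v)).
Proof.
move=> /nbhs_cube [r r0 rg] cg dP.
pose q i (k : R) : R := k^-1 *: (Phi (k *: w + v) 0 i - Phi v 0 i).
have qcvg i : q i @ 0^' --> dPhi 0 i.
  have [H <-] := dP i; exact: H.
have near0 i : (fun k => Phi (k *: w + v) 0 i - Phi v 0 i) @ 0^' --> (0 : R).
  have : (fun k : R => k * q i k) @ 0^' --> 0 * dPhi 0 i.
    apply: cvgM; last exact: qcvg.
    exact: cvg_within.
  rewrite mul0r; apply: cvg_trans; apply: near_eq_cvg.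
  near=> k; rewrite /q /GRing.scale /= mulrA divff ?mul1r //.
  by near: k; exact: nbhs_dnbhs_neq.
have nearr i : \forall k \near 0^', `|Phi (k *: w + v) 0 i - Phi v 0 i| < r.
  have /cvgrPdist_lt /(_ r r0) := near0 i.
  by apply: filterS => k; rewrite sub0r normrN.
have nearr' : \forall k \near (0 : R)^', forall i, `|Phi (k *: w + v) 0 i - Phi v 0 i| < r.
  exact: (near_forall (dnbhs_filter (0 : R)) nearr).
have /choice [xi xiP] : forall k : R, exists xi : 'I_m -> V,
    (forall i, `|Phi (k *: w + v) 0 i - Phi v 0 i| < r) ->
    (forall i, in_box (Phi v) (Phi (k *: w + v) - Phi v) (xi i)) /\
    g (Phi (k *: w + v)) - g (Phi v) =
      \sum_i (Phi (k *: w + v) - Phi v) 0 i * 'D_(delta i) g (xi i).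
  move=> k; have [Hk|Hk] := pselect (forall i, `|Phi (k *: w + v) 0 i - Phi v 0 i| < r).
    have [|xi xib Exi] := @mean_value_box g (Phi v) (Phi (k *: w + v) - Phi v).
      move=> z zb i; apply: rg => j; apply: le_lt_trans (in_box_near j zb) _.
      by rewrite !mxE; exact: Hk.
    by exists xi => _; split=> //; rewrite -Exi [Phi v + _]addrC subrK.
  by exists (fun=> 0) => /Hk.
have xicvg i : xi ^~ i @ (0 : R)^' --> Phi v.
  apply: cvg_coord => j; apply/cvgrPdist_lt => e e0.
  have /cvgrPdist_lt /(_ e e0) := near0 j.
  apply: filterS2 nearr' => k Hk; rewrite sub0r normrN; apply: le_lt_trans.
  have [/(_ i) Hb _] := xiP k Hk.
  by rewrite distrC; apply: le_trans (in_box_near j Hb) _; rewrite !mxE.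
have quot : (fun k : R => k^-1 *: (g (Phi (k *: w + v)) - g (Phi v))) @ 0^' -->
    \sum_i dPhi 0 i * 'D_(delta i) g (Phi v).
  have : (fun k : R => \sum_i q i k * 'D_(delta i) g (xi k i)) @ 0^' -->
      \sum_i dPhi 0 i * 'D_(delta i) g (Phi v).
    apply: cvg_bigsum => i; apply: cvgM; first exact: qcvg.
    exact: (cvg_comp _ _ (xicvg i) (cg i)).
  apply: cvg_trans; apply: near_eq_cvg; apply: filterS nearr' => k Hk.
  have [_ ->] := xiP k Hk; rewrite /GRing.scale /= mulr_sumr.
  by apply: eq_bigr => i _; rewrite !mxE /q /GRing.scale /= mulrA.
split; first by apply/cvg_ex; exists (\sum_i dPhi 0 i * 'D_(delta i) g (Phi v)).
exact: cvg_lim quot.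
Unshelve. all: by end_near. Qed.

End Multivariate.

(** * Calculus of smooth functions with explicit bounds *)

Section SmoothCalculus.
Variables (R : realType) (m : nat).
Local Notation V := 'rV[R]_m.
Implicit Types (f g h : V -> R) (U A : set V) (v w x y : V) (i j : 'I_m).
Implicit Types (s : seq 'I_m) (B C : R).
Local Notation delta i := (delta_mx 0 i : V).

Lemma smooth_cont U g x s : smooth_on U g -> U x -> {for x, continuous (pder s g)}.
Proof. by move=> sg Ux; have [] := sg (size s) s (leqnn _) x Ux. Qed.

Lemma smooth_derivable U g x s i : smooth_on U g -> U x ->
  derivable (pder s g) x (delta i).
Proof. by move=> sg Ux; have [] := sg (size s) s (leqnn _) x Ux. Qed.

Lemma eq_smooth_on U f g : open U -> (forall x, U x -> f x = g x) ->
  smooth_on U f -> smooth_on U g.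
Proof. by move=> oU fg sf n; apply: eq_diff_on fg (sf n). Qed.

Lemma sub_smooth_on U U' g : U' `<=` U -> smooth_on U g -> smooth_on U' g.
Proof. by move=> UU sg n s sn x /UU Ux; exact: sg Ux. Qed.

Lemma smooth_on_pder U g i : smooth_on U g -> smooth_on U (pder [:: i] g).
Proof. by move=> sg n; apply: diff_on_pder. Qed.

Lemma smooth_onM U f g : open U -> smooth_on U f -> smooth_on U g ->
  smooth_on U (fun v => f v * g v).
Proof. by move=> oU sf sg n; apply: diff_onM. Qed.

Lemma smooth_on_cst U c : smooth_on U (fun=> c).
Proof.
have P s : pder s (fun=> c) = (fun=> if s is [::] then c else 0) :> (V -> R).
  elim: s => [//|i s IH] /=; rewrite -/(pder s _) IH.
  by apply/funext => v; exact: derive_cst.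
by move=> n s _ x _; rewrite P; split=> [|i]; [exact: cst_continuous|exact: derivable_cst].
Qed.

Lemma smooth_onB U f g : open U -> smooth_on U f -> smooth_on U g ->
  smooth_on U (fun v => f v - g v).
Proof.
move=> oU sf sg; have : smooth_on U (fun v => 1 * f v + (-1) * g v).
  by move=> n; apply: diff_on_lin.
by apply: eq_smooth_on => // x _; rewrite mul1r mulN1r.
Qed.

Lemma smooth_on_sum U (I : Type) (r : seq I) (F : I -> V -> R) : open U ->
  (forall k, smooth_on U (F k)) -> smooth_on U (fun v => \sum_(k <- r) F k v).
Proof.
move=> oU sF; elim: r => [|k r IH].
  by under eq_fun do rewrite big_nil; exact: smooth_on_cst.
have : smooth_on U (fun v => 1 * F k v + 1 * \sum_(k <- r) F k v).
  by move=> n; apply: diff_on_lin; [|exact: sF|exact: IH].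
by apply: eq_smooth_on => // x _; rewrite big_cons !mul1r.
Qed.

Lemma smooth_on_prod U (I : Type) (r : seq I) (F : I -> V -> R) : open U ->
  (forall k, smooth_on U (F k)) -> smooth_on U (fun v => \prod_(k <- r) F k v).
Proof.
move=> oU sF; elim: r => [|k r IH].
  by under eq_fun do rewrite big_nil; exact: smooth_on_cst.
have := smooth_onM oU (sF k) IH.
by apply: eq_smooth_on => // x _; rewrite big_cons.
Qed.

Lemma pder_sum U (I : Type) (r : seq I) (F : I -> V -> R) s x : open U ->
  (forall k, smooth_on U (F k)) -> U x ->
  pder s (fun v => \sum_(k <- r) F k v) x = \sum_(k <- r) pder s (F k) x.
Proof.
move=> oU sF Ux; elim: r => [|k r IH].
  rewrite big_nil; under eq_fun do rewrite big_nil; by rewrite pder0.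
rewrite big_cons -IH -[pder s (F k) x]mul1r -[X in _ = _ + X]mul1r.
rewrite -(pder_lin (n := size s) _ _ oU) //; last by apply: smooth_on_sum.
  by congr pder; apply/funext => v; rewrite big_cons !mul1r.
exact: sF.
Qed.

(** The form in which estimates on derivatives are carried around: it is stable under sums,
    products and changes of coordinates, and the seminorms of smooth functions are
    suprema of such bounds. *)
Definition pder_bound N g v B := forall s, (size s <= N)%N -> `|pder s g v| <= B.

Lemma pder_bound_ge0 N g v B : pder_bound N g v B -> 0 <= B.
Proof. by move=> /(_ [::] isT); exact: le_trans. Qed.

Lemma pder_boundW N N' g v B : (N' <= N)%N -> pder_bound N g v B ->
  pder_bound N' g v B.
Proof. by move=> NN gB s sN; apply: gB; exact: leq_trans NN. Qed.

Lemma pder_bound_le N g v B B' : B <= B' -> pder_bound N g v B ->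
  pder_bound N g v B'.
Proof. by move=> BB gB s sN; apply: le_trans BB; exact: gB. Qed.

Lemma pder_bound_pder N g v B i : pder_bound N.+1 g v B ->
  pder_bound N (pder [:: i] g) v B.
Proof. by move=> gB s sN; rewrite -pder_rcons; apply: gB; rewrite size_rcons. Qed.

Lemma eq_pder_bound N U f g v B : open U -> (forall x, U x -> f x = g x) -> U v ->
  pder_bound N f v B -> pder_bound N g v B.
Proof. by move=> oU fg Uv fB s sN; rewrite -(eq_pder oU fg _ Uv); exact: fB. Qed.

Lemma pder_bound_sum N U (I : eqType) (r : seq I) (F : I -> V -> R) (B : I -> R) v :
  open U -> (forall k, smooth_on U (F k)) -> U v ->
  (forall k, k \in r -> pder_bound N (F k) v (B k)) ->
  pder_bound N (fun w => \sum_(k <- r) F k w) v (\sum_(k <- r) B k).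
Proof.
move=> oU sF Uv FB s sN; rewrite (pder_sum _ _ oU) //.
apply: le_trans (ler_norm_sum _ _ _) _.
by rewrite big_seq [leRHS]big_seq; apply: ler_sum => k kr; exact: FB.
Qed.

(** Leibniz rule: each derivative at most doubles the number of terms. *)
Lemma pder_boundM N U f g v B C : open U -> smooth_on U f -> smooth_on U g -> U v ->
  pder_bound N f v B -> pder_bound N g v C ->
  pder_bound N (fun w => f w * g w) v (2 ^+ N * B * C).
Proof.
move=> oU sf sg Uv fB gC; elim: N f g sf sg fB gC => [|N IH] f g sf sg fB gC s sN.
  case: s sN => // _; rewrite /= normrM mul1r.
  by rewrite ler_pM //; [exact: (fB [::])|exact: (gC [::])].
case/lastP: s sN => [_|s i].
  rewrite /= normrM; apply: (@le_trans _ _ (B * C)).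
    by rewrite ler_pM //; [exact: (fB [::])|exact: (gC [::])].
  rewrite -mulrA ler_peMl ?exprn_ege1 ?ler1n //.
  by rewrite mulr_ge0 ?(pder_bound_ge0 fB) ?(pder_bound_ge0 gC).
rewrite size_rcons ltnS => sN; rewrite pder_rcons.
rewrite (eq_pder oU (pder1M i (sf 0) (sg 0))) //.
have sf' := smooth_on_pder i sf; have sg' := smooth_on_pder i sg.
have s1 := smooth_onM oU sf sg'; have s2 := smooth_onM oU sf' sg.
rewrite (pder_lin 1 1 oU (s1 (size s)) (s2 (size s)) (leqnn _) Uv).
rewrite !mul1r exprS -!mulrA mulr_natl mulr2n !mulrA.
apply: le_trans (ler_normD _ _) _; apply: lerD.
  exact: (IH _ _ sf sg' (pder_boundW (leqnSn N) fB) (pder_bound_pder i gC) s sN).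
exact: (IH _ _ sf' sg (pder_bound_pder i fB) (pder_boundW (leqnSn N) gC) s sN).
Qed.

(** The constant depends on the change of coordinates and on the compact set but not
    on [g], which is what transferring estimates between charts requires. *)
Lemma pder_bound_compact N U A g : compact A -> A `<=` U -> smooth_on U g ->
  exists B, forall v, A v -> pder_bound N g v B.
Proof.
move=> cA AU; elim: N g => [|N IH] g sg; have [M MA] := smooth_bounded [::] cA AU sg.
  by exists M => v Av [|//] _; exact: MA.
have /choice [B BA] : forall i, exists B, forall v, A v -> pder_bound N (pder [:: i] g) v B.
  by move=> i; apply: IH; exact: smooth_on_pder.
exists (`|M| + \sum_i `|B i|) => v Av s; case/lastP: s => [_|s i].
  apply: le_trans (MA v Av) _; apply: le_trans (ler_norm _) _.
  by rewrite lerDl sumr_ge0.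
rewrite size_rcons ltnS => sN; rewrite pder_rcons.
apply: le_trans (BA i v Av s sN) _; apply: le_trans (ler_norm _) _.
by apply: ler_wpDl => //; rewrite (bigD1 i) //= lerDl sumr_ge0.
Qed.

Section Composition.
Variables (U' U : set V) (Phi : V -> V).
Hypotheses (oU' : open U') (oU : open U) (UPhi : forall v, U' v -> U (Phi v)).
Hypothesis sPhi : forall i, smooth_on U' (fun v => Phi v 0 i).

Lemma pder1_comp g i v : smooth_on U g -> U' v ->
  derivable (fun w => g (Phi w)) v (delta i) /\
  pder [:: i] (fun w => g (Phi w)) v =
  \sum_l pder [:: i] (fun w => Phi w 0 l) v * pder [:: l] g (Phi v).
Proof.
move=> sg Uv; pose dP : V := \row_l pder [:: i] (fun w => Phi w 0 l) v.
have [||l|d E] := @is_derive_comp_row R m V Phi v (delta i) g dP.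
- near=> y => l; apply: (@smooth_derivable U g y [::]) => //.
  by near: y; apply: open_nbhs_nbhs; split=> //; exact: UPhi.
- by move=> l; apply: (@smooth_cont U g (Phi v) [:: l]) => //; exact: UPhi.
- rewrite mxE; apply: derivableP.
  exact: (@smooth_derivable U' (fun w => Phi w 0 l) v [::]).
split=> //; rewrite /= E; apply: eq_bigr => l _; by rewrite mxE.
Unshelve. all: by end_near. Qed.

Lemma diff_on_comp n g : smooth_on U g -> diff_on n U' (fun v => g (Phi v)).
Proof.
have c g' v : smooth_on U g' -> U' v -> {for v, continuous (fun w => g' (Phi w))}.
  move=> sg' Uv; apply: (@continuous_comp _ _ _ Phi g').
    apply: (cvg_coord (nbhs_filter v)) => i.
    exact: (@smooth_cont U' (fun v => Phi v 0 i) v [::] (sPhi i) Uv).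
  by apply: (@smooth_cont U g' (Phi v) [::]) => //; exact: UPhi.
elim: n g => [|n IH] g sg s.
  case: s => // _ v Uv; split=> [|i]; first exact: c.
  by have [] := pder1_comp i sg Uv.
case/lastP: s => [_ v Uv|s i].
  by split=> [|i]; [exact: c|have [] := pder1_comp i sg Uv].
rewrite size_rcons ltnS => sn; rewrite pder_rcons.
suff : diff_on n U' (pder [:: i] (fun v => g (Phi v))) by apply.
have E v : U' v -> \sum_l pder [:: i] (fun w => Phi w 0 l) v * pder [:: l] g (Phi v) =
    pder [:: i] (fun w => g (Phi w)) v.
  by move=> Uv; have [] := pder1_comp i sg Uv.
apply: (eq_diff_on oU' E).
elim: (index_enum _) => [|l r IHr].
  under eq_fun do rewrite big_nil; exact: smooth_on_cst.
under eq_fun do rewrite big_cons.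
have := diff_on_lin 1 1 oU' (diff_onM oU' (smooth_on_pder i (sPhi l) (n := n))
  (IH _ (smooth_on_pder l sg))) IHr.
by apply: eq_diff_on => // v Uv; rewrite !mul1r.
Qed.

Lemma smooth_on_comp g : smooth_on U g -> smooth_on U' (fun v => g (Phi v)).
Proof. by move=> sg n; exact: diff_on_comp. Qed.

Lemma pder_bound_comp N A : compact A -> A `<=` U' ->
  exists2 C, 0 <= C & forall g, smooth_on U g -> forall v B, A v ->
    pder_bound N g (Phi v) B -> pder_bound N (fun w => g (Phi w)) v (C * B).
Proof.
move=> cA AU; elim: N => [|N [C C0 IH]].
  by exists 1 => // g sg v B Av gB [|//] _; rewrite mul1r; exact: (gB [::]).
have /choice [D DA] : forall p : 'I_m * 'I_m, exists D, forall v, A v ->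
    pder_bound N (pder [:: p.1] (fun w => Phi w 0 p.2)) v D.
  move=> [i l]; apply: (pder_bound_compact N cA AU).
  exact: (smooth_on_pder i (sPhi l)).
pose M := \sum_p `|D p|.
have M0 : 0 <= M by rewrite sumr_ge0.
exists (1 + \sum_(l < m) 2 ^+ N * M * C).
  by rewrite addr_ge0 ?sumr_ge0 // => l _; rewrite !mulr_ge0.
move=> g sg v B Av gB; have B0 := pder_bound_ge0 gB.
have Uv : U' v by exact: AU.
move=> s; case/lastP: s => [_|s i].
  apply: le_trans (gB [::] isT) _; rewrite ler_peMl // lerDl sumr_ge0 // => l _.
  by rewrite !mulr_ge0.
rewrite size_rcons ltnS => sN; rewrite pder_rcons.
have E w : U' w -> pder [:: i] (fun w => g (Phi w)) w =
    \sum_l pder [:: i] (fun w => Phi w 0 l) w * pder [:: l] g (Phi w).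
  by move=> Uw; have [] := pder1_comp i sg Uw.
rewrite (eq_pder oU' E) //.
apply: (@le_trans _ _ (\sum_(l < m) 2 ^+ N * M * (C * B))); last first.
  rewrite mulrDl mul1r; apply: ler_wpDl => //.
  by rewrite mulr_suml; apply: ler_sum => l _; rewrite !mulrA.
have sc l : smooth_on U' (fun w => pder [:: l] g (Phi w)).
  by apply: smooth_on_comp; exact: smooth_on_pder.
have sF l : smooth_on U' (fun w => pder [:: i] (fun w => Phi w 0 l) w *
    pder [:: l] g (Phi w)).
  exact: (smooth_onM oU' (smooth_on_pder i (sPhi l)) (sc l)).
apply: (@pder_bound_sum N U' 'I_m (index_enum _) _
  (fun=> 2 ^+ N * M * (C * B)) v oU' sF Uv _ s sN) => l _.
apply: (pder_boundM oU' (smooth_on_pder i (sPhi l)) (sc l) Uv).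
  apply: pder_bound_le (DA (i, l) v Av); apply: le_trans (ler_norm _) _.
  by rewrite /M (bigD1 (i, l)) //= lerDl sumr_ge0.
exact: (IH _ (smooth_on_pder l sg) v B Av (pder_bound_pder l gB)).
Qed.

End Composition.

Definition cube (c : V) (r : R) : set V := [set w | forall i, `|w 0 i - c 0 i| <= r].

Lemma compact_cube c r : compact (cube c r).
Proof.
have -> : cube c r = [set w | forall i, `[c 0 i - r, c 0 i + r]%classic (w 0 i)].
  apply/seteqP; split=> w wr i; have := wr i.
    by rewrite ler_distl /= in_itv /=.
  by rewrite /= in_itv /= ler_distl.
apply: (@rV_compact _ _ (fun i => `[c 0 i - r, c 0 i + r]%classic)) => i.
exact: segment_compact.
Qed.

(** Taylor estimate at a flat point. Each application of [mean_value_box] costs one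
    derivative and gains a factor [m * e]; the derivatives of [g] are flat at [y] as
    well, so this can be repeated. *)
Lemma flat_taylor M U c r g y v e B : open U -> cube c r `<=` U -> smooth_on U g ->
  (forall w, cube c r w -> pder_bound M g w B) ->
  cube c r y -> cube c r v -> flat_at g y -> (forall i, `|v 0 i - y 0 i| <= e) ->
  `|g v| <= (m%:R * e) ^+ M * B.
Proof.
move=> oU cU; elim: M g v => [|M IH] g v sg gB cy cv fg vy.
  by rewrite mul1r; exact: (gB v cv [::]).
have cw w : in_box y (v - y) w -> cube c r w.
  move=> wb i; have [t /andP[t0 t1] E] := wb i.
  have := cy i; have := cv i; rewrite !ler_distl E !mxE.
  set a := v 0 i; set b := y 0 i => /andP[a1 a2] /andP[b1 b2].
  apply/andP; split; nra.
have [|xi xib E] := @mean_value_box R m g y (v - y).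
  move=> w wb i; apply: (@smooth_derivable U g w [::] i sg).
  by apply: cU; exact: cw.
have -> : g v = \sum_i (v - y) 0 i * 'D_(delta i) g (xi i).
  by have gy : g y = 0 := fg [::]; rewrite -E gy subr0 addrC subrK.
apply: le_trans (ler_norm_sum _ _ _) _.
apply: (@le_trans _ _ (\sum_(i < m) e * ((m%:R * e) ^+ M * B))); last first.
  by rewrite sumr_const card_ord -(mulr_natl (e * _)) exprS !mulrA.
apply: ler_sum => i _; rewrite normrM ler_pM //; first by rewrite !mxE.
have fg' : flat_at (pder [:: i] g) y by move=> s; rewrite -pder_rcons.
apply: (IH _ _ (smooth_on_pder i sg) _ cy (cw _ (xib i)) fg').
- by move=> w cw'; apply: pder_bound_pder; exact: gB.
- by move=> j; apply: le_trans (in_box_near j (xib i)) _; rewrite !mxE.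
Qed.

End SmoothCalculus.

(** * A smooth step function *)

Section SmoothStep.
Variable R : realType.
Implicit Types (p q : {poly R}) (f g : R -> R) (t u C : R).

Lemma horner_expR_bound q : exists C, forall u, 0 < u -> `|q.[u]| * expR (- u) <= C.
Proof.
exists (\sum_(i < size q) `|q`_i| * i`!%:R) => u u0.
have mono i : u ^+ i * expR (- u) <= i`!%:R.
  rewrite expRN ler_pdivrMr ?expR_gt0 //.
  case: i => [|n]; first by rewrite expr0 mul1r ltW // expR_gt1.
  rewrite -ler_pdivrMl ?ltr0n ?fact_gt0 // mulrC.
  by apply: le_trans (expR_ge1Dxn n (ltW u0)); rewrite lerDr.
rewrite horner_coef mulrC; apply: le_trans (_ : \sum_(i < size q) `|q`_i| * (u ^+ i * expR (- u)) <= _).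
  rewrite mulrC; under [X in _ <= X]eq_bigr do rewrite mulrA.
  rewrite -mulr_suml ler_wpM2r ?expR_ge0 //; apply: le_trans (ler_norm_sum _ _ _) _.
  by apply: ler_sum => i _; rewrite normrM (ger0_norm (exprn_ge0 _ (ltW u0))).
by apply: ler_sum => i _; rewrite ler_wpM2l.
Qed.

(** The polynomial factor makes the class closed under differentiation, see
    [is_derive_flat_exp]. *)
Definition flat_exp p t := if 0 < t then p.[t^-1] * expR (- t^-1) else 0.

(** The quadratic bound gives the derivative [0] at the origin. *)
Lemma flat_exp_sqr p : exists C, forall t, `|flat_exp p t| <= C * t ^+ 2.
Proof.
have [C CP] := horner_expR_bound (p * 'X ^+ 2).
have C0 : 0 <= C by apply: le_trans (CP 1 ltr01); rewrite mulr_ge0 ?expR_ge0.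
exists C => t; rewrite /flat_exp; case: ifPn => [t0|_]; last first.
  by rewrite normr0 mulr_ge0 ?sqr_ge0.
have u0 : 0 < t^-1 by rewrite invr_gt0.
rewrite normrM (ger0_norm (expR_ge0 _)).
have := CP _ u0; rewrite hornerM hornerXn normrM (ger0_norm (exprn_ge0 _ (ltW u0))).
rewrite mulrAC -ler_pdivlMr ?exprn_gt0 // exprVn invrK.
by [].
Qed.

Lemma is_derive_flat_exp p t :
  is_derive t 1 (flat_exp p) (flat_exp ('X ^+ 2 * (p - p^`())) t).
Proof.
have [t0|t0|<-] := ltgtP 0 t.
- have E : \forall s \near t, p.[s^-1] * expR (- s^-1) = flat_exp p s.
    near=> s; have s0 : 0 < s by near: s; exact: lt_nbhsr.
    by rewrite /flat_exp s0.
  apply: near_eq_is_derive E _.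
  have tn : t != 0 by rewrite gt_eqF.
  have dV : is_derive t 1 (fun s : R => s^-1) (- t^-2).
    have := @is_deriveV _ id t 1 1 tn _; rewrite /GRing.scale /= mulr1.
    by apply; exact: is_derive_id.
  have dp : is_derive t 1 (fun s : R => p.[s^-1]) (p^`().[t^-1] * (- t^-2)).
    by have := @is_derive1_comp _ (horner p) _ t _ _ (is_derive_poly p _) dV.
  have dN : is_derive t 1 (fun s : R => - s^-1) (t^-2).
    by rewrite -[t^-2]opprK; exact: is_deriveN.
  have de : is_derive t 1 (fun s : R => expR (- s^-1)) (expR (- t^-1) * t^-2).
    by have := @is_derive1_comp _ expR _ t _ _ (is_derive_expR _) dN.
  have := is_deriveM dp de; rewrite /GRing.scale /=; congr is_derive.
  rewrite /flat_exp t0 !hornerE /= exprVn; ring.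
- have E : \forall s \near t, (cst 0 : R -> R) s = flat_exp p s.
    near=> s; have s0 : s < 0 by near: s; exact: lt_nbhsl.
    by rewrite /flat_exp ltNge (ltW s0).
  apply: near_eq_is_derive E _.
  by rewrite /flat_exp ltNge (ltW t0) /=; exact: is_derive_cst.
- rewrite {2}/flat_exp ltxx.
  have [C CP] := flat_exp_sqr p.
  have C0 : 0 <= C by have := CP 1; rewrite expr1n mulr1; exact: le_trans.
  have cv : (fun h : R => h^-1 *: ((flat_exp p \o shift 0) (h *: 1) - flat_exp p 0))
      @ 0^' --> (0 : R).
    apply/cvgrPdist_lt => e e0; near=> h.
    have hn : h != 0 by near: h; exact: nbhs_dnbhs_neq.
    have hp : 0 < `|h| by rewrite normr_gt0.
    rewrite sub0r normrN /= [h%:A]mulr1 addr0 {2}/flat_exp ltxx subr0.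
    rewrite /GRing.scale /= normrM normfV mulrC ltr_pdivrMr //.
    apply: le_lt_trans (CP h) _; rewrite -real_normK ?num_real // expr2 mulrA.
    rewrite ltr_pM2r //; apply: le_lt_trans (_ : (C + 1) * `|h| < _).
      by rewrite ler_wpM2r // lerDl.
    rewrite mulrC -ltr_pdivlMr ?ltr_wpDl //.
    near: h; apply: (@dnbhs0_lt _ R); rewrite divr_gt0 // ltr_wpDl //.
  by split; [apply/cvg_ex; exists 0|exact: cvg_lim cv].
Unshelve. all: by end_near. Qed.

Let den t := flat_exp 1 t + flat_exp 1 (1 - t).

Lemma den_gt0 t : 0 < den t.
Proof.
have pos s : 0 < s -> 0 < flat_exp 1 s.
  by move=> s0; rewrite /flat_exp s0 hornerE mul1r expR_gt0.
have nn s : 0 <= flat_exp 1 s.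
  by rewrite /flat_exp; case: ifP => // _; rewrite hornerE mul1r expR_ge0.
rewrite /den; have [t0|t0] := ltP 0 t; first by rewrite ltr_pwDl ?pos.
by rewrite ltr_wpDl // pos // subr_gt0; exact: le_lt_trans t0 ltr01.
Qed.

(** The algebra generated by the functions needed to build a smooth step; that
    it is closed under differentiation gives smoothness at once. *)
Inductive step_class : (R -> R) -> Prop :=
| StepExp p : step_class (flat_exp p)
| StepRev p : step_class (fun t => flat_exp p (1 - t))
| StepInv : step_class (fun t => (den t)^-1)
| StepOpp f : step_class f -> step_class (fun t => - f t)
| StepAdd f g : step_class f -> step_class g -> step_class (fun t => f t + g t)
| StepMul f g : step_class f -> step_class g -> step_class (fun t => f t * g t).

Lemma step_class_deriv f : step_class f ->
  exists2 g, step_class g & forall t, is_derive t 1 f (g t).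
Proof.
have dR p t : is_derive t 1 (fun s => flat_exp p (1 - s))
    (- flat_exp ('X ^+ 2 * (p - p^`())) (1 - t)).
  have d1 : is_derive t 1 (fun s : R => 1 - s) (-1).
    rewrite -[X in is_derive _ _ _ X]add0r.
    exact: (is_deriveB (is_derive_cst (1 : R) t 1) (is_derive_id t 1)).
  have := @is_derive1_comp _ (flat_exp p) _ t _ _ (is_derive_flat_exp p (1 - t)) d1.
  by rewrite mulrN1.
elim=> [p|p||{}f _ [f' Ff' df]|{}f g _ [f' Ff' df] _ [g' Fg' dg]|
        {}f g Ff [f' Ff' df] Fg [g' Fg' dg]].
- exists (flat_exp ('X ^+ 2 * (p - p^`()))); first exact: StepExp.
  by move=> t; exact: is_derive_flat_exp.
- exists (fun t => - flat_exp ('X ^+ 2 * (p - p^`())) (1 - t)); last exact: dR.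
  by apply: StepOpp; exact: StepRev.
- pose q : {poly R} := 'X ^+ 2 * (1 - 1^`()).
  exists (fun t => - ((flat_exp q t + (- flat_exp q (1 - t))) * ((den t)^-1 * (den t)^-1))).
    apply: StepOpp; apply: StepMul; last by apply: StepMul; exact: StepInv.
    apply: StepAdd; first exact: StepExp.
    by apply: StepOpp; exact: StepRev.
  move=> t; have dn : den t != 0 by rewrite gt_eqF // den_gt0.
  have dd := is_deriveD (is_derive_flat_exp 1 t) (dR 1 t).
  have := @is_deriveV _ den t _ 1 dn dd; congr is_derive.
  by rewrite /GRing.scale /= mulNr mulrC -exprVn expr2.
- by exists (fun t => - f' t); [exact: StepOpp|move=> t; exact: is_deriveN].
- by exists (fun t => f' t + g' t); [exact: StepAdd|move=> t; exact: is_deriveD].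
- exists (fun t => f t * g' t + g t * f' t); last by move=> t; exact: is_deriveM.
  by apply: StepAdd; apply: StepMul.
Qed.

(** The step is [E t / (E t + E (1 - t))] with [E t = exp (- 1 / t)]. All its
    derivatives are provided at once as a sequence [S n], so that later
    constructions differentiate by raising an index. *)
Lemma smooth_step_exists : exists S : nat -> R -> R,
  [/\ forall n t, is_derive t 1 (S n) (S n.+1 t),
      forall t, t <= 0 -> S 0%N t = 0, forall t, 1 <= t -> S 0%N t = 1 &
      forall n, exists C, forall t, `|S n t| <= C].
Proof.
have /choice [D DP] : forall f : {f | step_class f}, exists g : {f | step_class f},
    forall t, is_derive t 1 (sval f) (sval g t).
  by move=> [f Ff]; have [g Fg dg] := step_class_deriv Ff; exists (exist _ g Fg).
pose S0 : {f | step_class f} := exist _ _ (StepMul (StepExp 1) StepInv).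
pose S n := sval (iter n D S0).
have S_le0 t : t <= 0 -> S 0%N t = 0.
  by move=> t0; rewrite /S /= /flat_exp ltNge t0 mul0r.
have S_ge1 t : 1 <= t -> S 0%N t = 1.
  move=> t1; have E : flat_exp 1 (1 - t) = 0.
    by rewrite /flat_exp subr_gt0 ltNge t1.
  have := den_gt0 t; rewrite /S /= /den E addr0 => d0.
  by rewrite divff // gt_eqF.
have dS n t : is_derive t 1 (S n) (S n.+1 t) by exact: DP.
exists S; split=> // n.
have lt0 k t : t < 0 -> S k t = 0.
  elim: k t => [|k IH] t t0; first exact: S_le0 (ltW t0).
  have [_ <-] := dS k t; rewrite -(derive_cst (0 : R) t 1).
  by apply: near_eq_derive; near=> s; apply: IH; near: s; exact: lt_nbhsl.
have gt1 k t : 1 < t -> S k t = (k == 0)%:R.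
  elim: k t => [|k IH] t t0; first exact: S_ge1 (ltW t0).
  have [_ <-] := dS k t; apply: etrans (derive_cst ((k == 0)%:R : R) t 1).
  by apply: near_eq_derive; near=> s; apply: IH; near: s; exact: lt_nbhsr.
have : compact (S n @` `[0, 1]).
  apply: continuous_compact; last exact: segment_compact.
  by apply: derivable_within_continuous => t _; have [] := dS n t.
move=> /compact_bounded [M [_ /(_ (M + 1))]]; rewrite ltrDl ltr01 => /(_ isT) MP.
exists (Num.max 1 (M + 1)) => t; rewrite le_max.
have [t0|t0] := ltP t 0; first by rewrite lt0 // normr0 ler01.
have [t1|t1] := ltP 1 t; first by rewrite gt1 // ger0_norm ?ler0n // lern1 leq_b1.
by rewrite (MP (S n t)) ?orbT //; exists t => //=; rewrite in_itv /= t0.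
Unshelve. all: by end_near. Qed.

End SmoothStep.

(** * Cut-off functions for a flat ideal in a cube *)

Lemma near_eq_pder (R : realType) (m : nat) (f g : 'rV[R]_m -> R) s (v : 'rV[R]_m) :
  (\forall w \near v, f w = g w) -> pder s f v = pder s g v.
Proof.
move=> fg; have : nbhs v [set w | f w = g w] by exact: fg.
by rewrite nbhsE => -[O [oO Ov] OE]; exact: (eq_pder oO OE).
Qed.

Lemma continuous_mulr (R : realType) (T : topologicalType) (f g : T -> R) x :
  {for x, continuous f} -> {for x, continuous g} ->
  {for x, continuous (fun y => f y * g y)}.
Proof. exact: cvgM. Qed.

Lemma continuous_affine (R : realType) (T : topologicalType) (f : T -> R) a b x :
  {for x, continuous f} -> {for x, continuous (fun y => a * f y + b)}.
Proof.
move=> cf; apply: cvgD; last exact: cvg_cst.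
by apply: cvgM => //; exact: cvg_cst.
Qed.

Section Bumps.
Variables (R : realType) (m : nat) (S : nat -> R -> R).
Hypothesis dS : forall n (t : R), is_derive t 1 (S n) (S n.+1 t).
Hypothesis S_le0 : forall t, t <= 0 -> S 0%N t = 0.
Hypothesis S_ge1 : forall t, 1 <= t -> S 0%N t = 1.
Hypothesis S_bounded : forall n, exists C, forall t, `|S n t| <= C.
Local Notation V := 'rV[R]_m.
Local Notation delta i := (delta_mx 0 i : V).
Implicit Types (d a t : R) (c : 'I_m -> R) (n : 'I_m -> nat) (v w : V).

(** For [n = 0] a bump supported in [ [-d, 1] ], and in general its [n]-th derivative.
    For [d = 1] its integer translates form a partition of unity, as a telescoping sum
    of steps; for [d = 3], suitably rescaled, it is a plateau. *)
Definition hat d (n : nat) t := S n (t + d) - S n t.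

Lemma is_derive_hat d (n : nat) t : is_derive t 1 (hat d n) (hat d n.+1 t).
Proof.
have ds : is_derive t 1 (fun s : R => s + d) 1.
  have := is_deriveD (is_derive_id t (1 : R)) (is_derive_cst d t 1).
  by rewrite addr0.
have := @is_derive1_comp _ (S n) _ t _ _ (dS n (t + d)) ds; rewrite mulr1 => d1.
exact: (is_deriveB d1 (dS n t)).
Qed.

Lemma hat_bounded N : exists2 C, 1 <= C &
  forall (n : nat) d t, (n <= N)%N -> `|hat d n t| <= C.
Proof.
elim: N => [|N [C C1 IH]].
  have [C CS] := S_bounded 0; exists (1 + `|C| *+ 2).
    by rewrite lerDl mulrn_wge0.
  move=> [|//] d t _; apply: ler_wpDl => //.
  apply: le_trans (ler_normB _ _) _; rewrite mulr2n.
  by apply: lerD; apply: le_trans (CS _) (ler_norm _).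
have [D DS] := S_bounded N.+1.
exists (C + `|D| *+ 2); first by apply: le_trans C1 _; rewrite lerDl mulrn_wge0.
move=> n d t; rewrite leq_eqVlt => /orP[/eqP ->|].
  apply: ler_wpDl; first exact: le_trans C1.
  apply: le_trans (ler_normB _ _) _; rewrite mulr2n.
  by apply: lerD; apply: le_trans (DS _) (ler_norm _).
rewrite ltnS => nN; apply: le_trans (IH n d t nN) _.
by rewrite lerDl mulrn_wge0.
Qed.

Lemma hat_eq0 d t : 0 <= d -> (t <= - d) || (1 <= t) -> hat d 0 t = 0.
Proof.
move=> d0 /orP[t0|t1]; rewrite /hat.
  by rewrite !S_le0 ?subrr //; lra.
by rewrite !S_ge1 ?subrr //; lra.
Qed.

Definition box_fun d a c n v := \prod_l hat d (n l) (a * v 0 l + c l).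

Let bumpn n (i : 'I_m) : 'I_m -> nat := fun l => (n l + (l == i))%N.

Lemma is_derive_box d a c n i v :
  is_derive v (delta i) (box_fun d a c n) (a * box_fun d a c (bumpn n i) v).
Proof.
pose phi t := hat d (n i) (a * t + c i).
pose rest := \prod_(l | l != i) hat d (n l) (a * v 0 l + c l).
have dphi : is_derive (v 0 i) 1 phi (a * hat d (n i).+1 (a * v 0 i + c i)).
  have da : is_derive (v 0 i) 1 (fun t : R => a * t + c i) a.
    have := is_deriveD (is_deriveZ a (is_derive_id (v 0 i) (1 : R)))
      (is_derive_cst (c i) (v 0 i) 1).
    by rewrite /GRing.scale /= mulr1 addr0.
  have := @is_derive1_comp _ (hat d (n i)) _ (v 0 i) _ _ (is_derive_hat d (n i) _) da.
  by rewrite mulrC.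
have E : (fun h : R => h^-1 *: ((box_fun d a c n \o shift v) (h *: delta i) - box_fun d a c n v))
    = (fun h => (h^-1 *: ((phi \o shift (v 0 i)) (h *: 1) - phi (v 0 i))) * rest).
  apply/funext => h; rewrite /= -scalerAl mulrBl; congr (_ *: (_ - _)).
    rewrite /box_fun (bigD1 i) //= !mxE !eqxx /= [h%:A]mulr1 mulr1; congr (_ * _).
    by apply: eq_bigr => l li; rewrite !mxE (negbTE li) andbF mulr0 add0r.
  by rewrite /box_fun (bigD1 i).
have q : (fun h : R => h^-1 *: ((phi \o shift (v 0 i)) (h *: 1) - phi (v 0 i))) @ 0^' -->
    a * hat d (n i).+1 (a * v 0 i + c i).
  by have [H <-] := dphi; exact: H.
have -> : a * box_fun d a c (bumpn n i) v = a * hat d (n i).+1 (a * v 0 i + c i) * rest.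
  rewrite /box_fun (bigD1 i) //= /bumpn eqxx addn1 mulrA; congr (_ * _).
  by apply: eq_bigr => l li; rewrite (negbTE li) addn0.
have L : (fun h : R => h^-1 *: ((phi \o shift (v 0 i)) (h *: 1) - phi (v 0 i)) * rest)
    @ 0^' --> a * hat d (n i).+1 (a * v 0 i + c i) * rest.
  by apply: cvgM; [exact: q|exact: cvg_cst].
split; rewrite ?/derivable ?/derive E; first by apply/cvg_ex; exists (a * hat d (n i).+1 (a * v 0 i + c i) * rest).
exact: cvg_lim L.
Qed.

Lemma continuous_box d a c n : continuous (box_fun d a c n).
Proof.
move=> v; change {for v, continuous (box_fun d a c n)}.
rewrite /box_fun; elim: (index_enum _) => [|l r IH].
  have -> : (fun w : V => \prod_(l <- [::]) hat d (n l) (a * w 0 l + c l)) = (fun=> 1).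
    by apply/funext => w; rewrite big_nil.
  exact: cst_continuous.
have -> : (fun w : V => \prod_(l <- l :: r) hat d (n l) (a * w 0 l + c l)) =
    (fun w => hat d (n l) (a * w 0 l + c l) * \prod_(l <- r) hat d (n l) (a * w 0 l + c l)).
  by apply/funext => w; rewrite big_cons.
apply: continuous_mulr; last exact: IH.
apply: (@continuous_comp _ _ _ (fun w : V => a * w 0 l + c l) (hat d (n l))).
  by apply: continuous_affine; exact: continuous_entry.
have [H _] := is_derive_hat d (n l) (a * v 0 l + c l).
exact/differentiable_continuous/derivable1_diffP.
Qed.

Lemma pder_box d a c n s : exists2 n', forall l, (n' l <= n l + size s)%N &
  pder s (box_fun d a c n) = (fun v => a ^+ size s * box_fun d a c n' v).
Proof.
elim: s => [|i s [n' n'E IH]].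
  by exists n => [l|]; [rewrite addn0|apply/funext => v; rewrite mul1r].
exists (bumpn n' i) => [l|].
  by rewrite /bumpn /= addnS -addn1 leq_add // leq_b1.
apply/funext => v /=; rewrite -/(pder s _) IH.
have [_ E] := is_deriveZ (a ^+ size s) (is_derive_box d a c n' i v).
by rewrite exprSr -mulrA; exact: E.
Qed.

Lemma smooth_box U d a c : smooth_on U (box_fun d a c (fun=> 0%N)).
Proof.
move=> N s _ v _; have [n' _ ->] := pder_box d a c (fun=> 0%N) s; split=> [|i].
  by apply: continuous_mulr; [exact: cst_continuous|exact: continuous_box].
by have [] := is_deriveZ (a ^+ size s) (is_derive_box d a c n' i v).
Qed.

Lemma box_bounded N : exists2 C, 0 <= C & forall d a c v, 1 <= a ->
  pder_bound N (box_fun d a c (fun=> 0%N)) v (a ^+ N * C).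
Proof.
have [C C1 CP] := hat_bounded N; have C0 : 0 <= C by exact: le_trans C1.
exists (C ^+ m); first exact: exprn_ge0.
move=> d a c v a1 s sN; have [n' n's ->] := pder_box d a c (fun=> 0%N) s.
have a0 : 0 <= a by exact: le_trans a1.
rewrite normrM ler_pM //; first by rewrite ger0_norm ?exprn_ge0 // ler_weXn2l.
rewrite /box_fun normr_prod -[in leRHS](card_ord m) -prodr_const.
apply: ler_prod => l _; rewrite normr_ge0 CP //=.
by apply: leq_trans sN; have := n's l; rewrite add0n.
Qed.

Lemma box_eq0 d a c v l : 0 <= d ->
  (a * v 0 l + c l <= - d) || (1 <= a * v 0 l + c l) ->
  box_fun d a c (fun=> 0%N) v = 0.
Proof. by move=> d0 H; rewrite /box_fun (bigD1 l) //= hat_eq0 // mul0r. Qed.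

(** The sum over the grid is the product of the sums over the coordinates, each of
    which telescopes. *)
Lemma box_partition N a v : (forall l, `|a * v 0 l| <= N%:R) ->
  \sum_(z : {ffun 'I_m -> 'I_(N.*2.+1)})
    box_fun 1 a (fun l => N%:R - (z l)%:R) (fun=> 0%N) v = 1.
Proof.
move=> vN; rewrite /box_fun -(bigA_distr_bigA (fun l (j : 'I_(N.*2.+1)) =>
  hat 1 0 (a * v 0 l + (N%:R - j%:R)))) big1 // => l _.
pose f (k : nat) := - S 0%N (a * v 0 l + N%:R + 1 - k%:R).
rewrite (eq_bigr (fun j : 'I_(N.*2.+1) => f j.+1 - f j)); last first.
  move=> j _; rewrite /f /hat opprK [RHS]addrC -natr1.
  by congr (S 0%N _ - S 0%N _); lra.
rewrite -(big_mkord xpredT (fun j => f j.+1 - f j)) telescope_sumr // /f.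
have := vN l; rewrite ler_norml => /andP[v1 v2].
rewrite S_le0 ?oppr0 ?add0r ?opprK ?subr0 ?S_ge1 //; first by lra.
rewrite -natr1 -addnn natrD; lra.
Qed.

Section Whitney.
Variables (U Z : set V) (c0 : V) (r : R).
Hypotheses (oU : open U) (r0 : 0 < r) (cU : cube c0 (r + r) `<=` U).

Lemma cube_natbound : exists2 N0, (0 < N0)%N &
  forall v, cube c0 (r + r) v -> forall l, `|v 0 l| <= N0%:R.
Proof.
pose x := r + r + \sum_l `|c0 0 l|.
have x0 : 0 <= x by rewrite addr_ge0 ?sumr_ge0 // addr_ge0 // ltW.
exists (Num.bound x).+1 => // v cv l.
have H : `|v 0 l| <= x.
  rewrite -(subrK (c0 0 l) (v 0 l)); apply: le_trans (ler_normD _ _) _.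
  by apply: lerD; [exact: cv|rewrite (bigD1 l) //= lerDl sumr_ge0].
apply: le_trans H _; apply: le_trans (ltW (archi_boundP x0)) _.
by rewrite ler_nat.
Qed.

Variable N0 : nat.
Hypotheses (N0_gt0 : (0 < N0)%N)
  (N0P : forall v, cube c0 (r + r) v -> forall l, `|v 0 l| <= N0%:R).

(* The grid of mesh [2 ^- k]; the indices range over [- N0 * 2 ^ k .. N0 * 2 ^ k],
   which covers the cube of radius [r + r]. *)
Let Nk k := (N0 * 2 ^ k)%N.
Local Notation grid k := {ffun 'I_m -> 'I_((Nk k).*2.+1)}.
Let center k (z : grid k) (l : 'I_m) : R := (Nk k)%:R - (z l)%:R.
Let bump k (z : grid k) : V -> R := box_fun 1 (2 ^+ k) (center z) (fun=> 0%N).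

Definition cell k (z : grid k) : set V :=
  [set v | forall l, `|2 ^+ k * v 0 l + center z l| <= 1].

Definition near_cell k : pred (grid k) := [pred z | `[< exists2 y, Z y & cell z y >]].

(** The sum of the bumps whose cell stays away from [Z]. It vanishes near [Z]
    and, on the cube of radius [r + r], equals [1] at distance more than [2 * 2 ^- k]
    from it. *)
Definition cutoff k v : R :=
  \sum_(z <- [seq z <- index_enum (grid k) | ~~ near_cell z]) bump z v.

Lemma bump_eq0 k (z : grid k) v : ~ cell z v -> \forall w \near v, bump z w = 0.
Proof.
move=> nc; have [l lP] : exists l, 1 < `|2 ^+ k * v 0 l + center z l|.
  apply: contrapT => H; apply: nc => l; rewrite leNgt; apply/negP => Hl.
  by apply: H; exists l.
have cl : {for v, continuous (fun w : V => `|2 ^+ k * w 0 l + center z l|)}.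
  apply: (@continuous_comp _ _ _ (fun w : V => 2 ^+ k * w 0 l + center z l) (fun x : R => `|x|)).
    by apply: continuous_affine; exact: continuous_entry.
  exact: norm_continuous.
have H : nbhs v (fun w : V => 1 < `|2 ^+ k * w 0 l + center z l|).
  exact: (cl _ (lt_nbhsr lP)).
apply: (@filterS _ _ (nbhs_filter v)) H => w wl.
apply: (@box_eq0 _ _ _ _ l); first exact: ler01.
by move: wl; rewrite lter_normr => /orP[]; lra.
Qed.

Lemma smooth_cutoff U' k : open U' -> smooth_on U' (cutoff k).
Proof. by move=> oU'; apply: smooth_on_sum => // z; exact: smooth_box. Qed.

Lemma cutoff_eq0 k y : Z y -> \forall v \near y, cutoff k v = 0.
Proof.
move=> Zy.
have H (z : grid k) : \forall v \near y, ~~ near_cell z -> bump z v = 0.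
  have [nz|nz] := boolP (near_cell z); first by near=> v.
  have : ~ cell z y by move=> cz; case/asboolP: nz; exists y.
  by move=> /bump_eq0; apply: (@filterS _ _ (nbhs_filter y)) => v.
have := near_forall (nbhs_filter y) H; apply: (@filterS _ _ (nbhs_filter y)) => v Hv.
by rewrite /cutoff big_filter big1 // => z; exact: Hv.
Unshelve. all: by end_near. Qed.

Lemma card_grid_le k : (#|{: grid k}|%:R : R) <= (3 * N0%:R * 2 ^+ k) ^+ m.
Proof.
rewrite card_ffun !card_ord natrX lerXn2r ?nnegrE ?ler0n //.
rewrite -mulrA -natrX -!natrM ler_nat -/(Nk k) -addnn.
have : (0 < Nk k)%N by rewrite muln_gt0 N0_gt0 expn_gt0.
lia.
Qed.

Lemma sum_grid_le k (p : pred (grid k)) (B : R) : 0 <= B ->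
  \sum_(z <- [seq z <- index_enum (grid k) | p z]) B <= (3 * N0%:R * 2 ^+ k) ^+ m * B.
Proof.
move=> B0; apply: (@le_trans _ _ (\sum_(z : grid k) B)).
  by rewrite big_filter [leRHS](bigID p) /= lerDl sumr_ge0.
by rewrite sumr_const -(mulr_natl B) ler_wpM2r // card_grid_le.
Qed.

Lemma cutoff_bounded N : exists2 C, 0 <= C & forall k v,
  pder_bound N (cutoff k) v (C * 2 ^+ ((m + N) * k)).
Proof.
have [C C0 CP] := box_bounded N.
exists ((3 * N0%:R) ^+ m * C) => [|k v]; first by rewrite mulr_ge0 ?exprn_ge0 ?mulr_ge0.
have B0 : 0 <= (2 ^+ k) ^+ N * C by rewrite mulr_ge0 ?exprn_ge0.
have := sum_grid_le (fun z : grid k => ~~ near_cell z) B0.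
have -> : (3 * N0%:R * 2 ^+ k) ^+ m * ((2 ^+ k) ^+ N * C) =
    (3 * N0%:R) ^+ m * C * 2 ^+ ((m + N) * k) :> R.
  by rewrite exprMn mulnDl exprD -!exprM [(k * m)%N]mulnC [(k * N)%N]mulnC; ring.
move/pder_bound_le; apply.
apply: (@pder_bound_sum _ _ _ setT _ _ _ (fun=> (2 ^+ k) ^+ N * C)) => //.
- exact: openT.
- by move=> z; exact: smooth_box.
- by move=> z _; apply: CP; rewrite exprn_ege1 ?ler1n.
Qed.

Lemma cutoff_complement k v : cube c0 (r + r) v ->
  1 - cutoff k v = \sum_(z <- [seq z <- index_enum (grid k) | near_cell z]) bump z v.
Proof.
move=> cv; have <- : \sum_z bump (k := k) z v = 1.
  apply: box_partition => l; rewrite normrM (ger0_norm (exprn_ge0 _ _)) // /Nk.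
  by rewrite natrM natrX mulrC ler_wpM2r ?exprn_ge0 // N0P.
by rewrite /cutoff !big_filter (bigID (@near_cell k)) /= addrK.
Qed.

(** Near [v] the function [1 - cutoff k] is the sum of the bumps whose cell meets [Z].
    There are at most [(3 * N0 * 2 ^ k) ^ m] of them, and their derivatives up to
    order [N] are of size [2 ^ (N * k)]. On such a cell [v] is within [2 * 2 ^- k] of a
    point where [f] is flat, so by [flat_taylor] the derivatives of [f] there are of
    size [2 ^- ((M + N + m) * k)], which pays for both factors. *)
Lemma cutoff_flat N M : exists2 C, 0 <= C & exists k0, forall k, (k0 <= k)%N ->
  forall f, smooth_on U f -> (forall y, Z y -> U y -> flat_at f y) ->
  forall B, (forall w, cube c0 (r + r) w -> pder_bound (N + (M + N + m)) f w B) ->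
  forall v, cube c0 r v ->
    pder_bound N (fun w => (1 - cutoff k w) * f w) v (C * 2 ^- (M * k) * B).
Proof.
have [C C0 CP] := box_bounded N.
pose D := (3 * N0%:R) ^+ m * 2 ^+ N * C * (m%:R * 2) ^+ (M + N + m) : R.
exists D; first by rewrite !mulr_ge0 ?exprn_ge0 ?mulr_ge0.
(* From [k0] on the cells meeting the cube of radius [r] lie in that of radius
   [r + r], where [f] is controlled. *)
have [k0 k0P] : exists k0, forall k, (k0 <= k)%N -> 2 / 2 ^+ k <= r.
  exists (Num.bound (2 / r)) => k kk.
  rewrite ler_pdivrMr ?exprn_gt0 // -ler_pdivrMl // mulrC.
  apply: le_trans (ltW (archi_boundP _)) _; first by rewrite divr_ge0 // ltW.
  rewrite -natrX ler_nat; apply: leq_trans (ltnW (ltn_expl k (ltnSn 1))).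
  exact: kk.
exists k0 => k /k0P kr f sf ff B fB v cv.
have rr : r <= r + r by rewrite lerDl ltW.
have cv2 : cube c0 (r + r) v by move=> l; apply: le_trans (cv l) rr.
have Uv : U v by exact: cU.
have B0 : 0 <= B by exact: pder_bound_ge0 (fB v cv2).
have q0 : 0 < (2 : R) ^+ k by rewrite exprn_gt0.
have q1 : 1 <= (2 : R) ^+ k by rewrite exprn_ege1 ?ler1n.
pose b := 2 ^+ N * ((2 ^+ k) ^+ N * C) * ((m%:R * (2 / 2 ^+ k)) ^+ (M + N + m) * B).
have b0 : 0 <= b.
  by rewrite !mulr_ge0 ?exprn_ge0 ?mulr_ge0 ?invr_ge0 ?exprn_ge0.
have -> : D * 2 ^- (M * k) * B = (3 * N0%:R * 2 ^+ k) ^+ m * b.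
  rewrite /D /b !exprMn mulnC exprM !exprVn !exprD.
  have qn (n : nat) : (2 ^+ k) ^+ n != 0 :> R by rewrite expf_neq0 // gt_eqF.
  set Q := 2 ^+ k in qn *; set X := (M + N + m)%N.
  field; rewrite !qn; done.
apply: pder_bound_le (sum_grid_le (@near_cell k) b0) _.
pose O := ball c0 (r + r) `&` U.
have oO : open O by apply: openI => //; exact: ball_open.
have Ov : O v.
  split=> //; split; first by rewrite addr_gt0.
  move=> i j; rewrite (ord1 i) -ball_normE /= distrC.
  by apply: le_lt_trans (cv j) _; rewrite ltrDl.
have EO w : O w -> \sum_(z <- [seq z <- index_enum (grid k) | near_cell z]) (bump z w * f w)
    = (1 - cutoff k w) * f w.
  move=> [[_ cw] Uw]; rewrite cutoff_complement ?mulr_suml // => l.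
  by have := cw 0 l; rewrite -ball_normE /= distrC => /ltW.
apply: (eq_pder_bound oO EO Ov).
have sb z : smooth_on U (bump (k := k) z) by exact: smooth_box.
have sbf z : smooth_on U (fun w => bump (k := k) z w * f w) by exact: smooth_onM.
apply: (pder_bound_sum oU sbf Uv) => z.
rewrite mem_filter => /andP[/asboolP [y Zy cy] _].
have [cz|ncz] := pselect (cell z v); last first.
  move=> s sN; rewrite (near_eq_pder (g := fun=> 0)) ?pder0 ?normr0 //.
  by have := bump_eq0 ncz; apply: (@filterS _ _ (nbhs_filter v)) => w ->; rewrite mul0r.
have vy l : `|v 0 l - y 0 l| <= 2 / 2 ^+ k.
  have := cz l; have := cy l; set x := center z l => h1 h2.
  rewrite ler_pdivlMr // -[X in _ * X](ger0_norm (ltW q0)) -normrM mulrBl.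
  have -> : v 0 l * 2 ^+ k - y 0 l * 2 ^+ k =
     (2 ^+ k * v 0 l + x) - (2 ^+ k * y 0 l + x) by ring.
  by apply: le_trans (ler_normB _ _) _; lra.
have cy2 : cube c0 (r + r) y.
  move=> l; rewrite -(subrK (v 0 l) (y 0 l)) -addrA.
  apply: le_trans (ler_normD _ _) _; apply: lerD; last exact: cv.
  by rewrite distrC; apply: le_trans (vy l) kr.
apply: (pder_boundM oU (sb z) sf Uv); first by apply: CP.
move=> s sN; apply: (flat_taylor oU cU _ _ cy2 cv2 _ vy) => [|w cw|t].
- by move=> n t _ x Ux; rewrite /pder -foldr_cat; exact: (sf _ _ (leqnn _) x Ux).
- move=> t tN; rewrite /pder -foldr_cat; apply: (fB w cw).
  by rewrite size_cat addnC leq_add.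
- by rewrite /pder -foldr_cat; apply: ff => //; exact: cU.
Qed.

End Whitney.

Lemma box_plateau (c0 : V) (r : R) : 0 < r -> exists p : V -> R,
  [/\ forall U, smooth_on U p, forall v, cube c0 (r / 2) v -> p v = 1 &
      forall v, ~ cube c0 r v -> p v = 0].
Proof.
move=> r0; have rn : r != 0 by rewrite gt_eqF.
pose c (l : 'I_m) := - (2 / r * c0 0 l) - 1.
have E (v : V) l : 2 / r * v 0 l + c l = 2 * ((v 0 l - c0 0 l) / r) - 1.
  by rewrite /c; field.
exists (box_fun 3 (2 / r) c (fun=> 0%N)); split=> [U|v cv|v ncv].
- exact: smooth_box.
- rewrite /box_fun big1 // => l _; rewrite /hat E.
  have : `|(v 0 l - c0 0 l) / r| <= 2^-1.
    by rewrite normrM normfV (ger0_norm (ltW r0)) ler_pdivrMr // mulrC; exact: cv.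
  rewrite ler_norml => /andP[h1 h2]; rewrite S_ge1 ?S_le0 ?subr0 //; lra.
- have [l lP] : exists l, r < `|v 0 l - c0 0 l|.
    apply: contrapT => H; apply: ncv => l; rewrite leNgt; apply/negP => Hl.
    by apply: H; exists l.
  apply: (@box_eq0 _ _ _ _ l); first by rewrite ler0n.
  have : 1 < `|(v 0 l - c0 0 l) / r|.
    by rewrite normrM normfV (ger0_norm (ltW r0)) ltr_pdivlMr // mul1r.
  rewrite E lter_normr => /orP[]; lra.
Qed.

End Bumps.

Lemma plateau_exists (R : realType) (m : nat) (c0 : 'rV[R]_m) (r : R) : 0 < r ->
  exists p : 'rV[R]_m -> R,
  [/\ forall U, smooth_on U p, forall v, cube c0 (r / 2) v -> p v = 1 &
      forall v, ~ cube c0 r v -> p v = 0].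
Proof. by have [S [? ? ? ?]] := smooth_step_exists R; exact: (@box_plateau R m S). Qed.

(** What the manifold needs to know about the grid construction. The decay at rate [M] is bought with [M + N + m] additional derivatives. *)
Record cutoff_family (R : realType) (m : nat) (U Z : set 'rV[R]_m) (c0 : 'rV[R]_m)
    (r : R) (E : nat -> 'rV[R]_m -> R) := CutoffFamily {
  cf_smooth : forall k U', open U' -> smooth_on U' (E k);
  cf_zero : forall k y, Z y -> \forall v \near y, E k v = 0;
  cf_growth : forall N, exists2 C, 0 <= C & forall k v,
    pder_bound N (E k) v (C * 2 ^+ ((m + N) * k));
  cf_decay : forall N M, exists2 C, 0 <= C & exists k0, forall k, (k0 <= k)%N ->
    forall f, smooth_on U f -> (forall y, Z y -> U y -> flat_at f y) ->
    forall B, (forall w, cube c0 (r + r) w -> pder_bound (N + (M + N + m)) f w B) ->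
    forall v, cube c0 r v ->
      pder_bound N (fun w => (1 - E k w) * f w) v (C * 2 ^- (M * k) * B)
}.

Lemma cutoff_family_exists (R : realType) (m : nat) (U Z : set 'rV[R]_m)
    (c0 : 'rV[R]_m) (r : R) :
  open U -> 0 < r -> cube c0 (r + r) `<=` U -> exists E, cutoff_family U Z c0 r E.
Proof.
move=> oU r0 cU; have [S [dS S0 S1 Sb]] := smooth_step_exists R.
have [N0 N0_gt0 N0P] := cube_natbound c0 r0.
exists (cutoff S Z N0); split.
- by move=> k U' oU'; exact: smooth_cutoff.
- by move=> k y Zy; exact: cutoff_eq0.
- by move=> N; exact: cutoff_bounded.
- by move=> N M; exact: (cutoff_flat dS S0 S1 Sb).
Qed.

(** * From approximate units to rapid splittings *)

Section ApproximateUnit.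
Variables (R : realType) (cplx : bool).
Local Notation K := (base_field R cplx).
Variables (E : lmodType K) (P : seminorm_family E).
Local Notation A := (seminormed P : tvsType K).
Implicit Types (s : seq (sn_index P)) (a x y : A) (B C : R).

Lemma seminorm_continuous (f : A -> A) :
  (forall b x y, f (b *: x + y) = b *: f x + f y) ->
  (forall j, exists2 C, 0 <= C & exists s, forall x B, 0 <= B ->
     (forall i, List.In i s -> P i x <= B) -> P j (f x) <= C * B) ->
  continuous f.
Proof.
move=> lf bf x V [s [e [e0 sV]]].
have [t [d [d0 td]]] : exists t d, 0 < d /\ forall y,
    (forall i, List.In i t -> P i y < d) -> forall j, List.In j s -> P j (f y) < e.
  elim: s {sV} => [|j s [t [d [d0 IH]]]]; first by exists [::], 1; split.
  have [C C0 [t' Ct]] := bf j.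
  have d'0 : 0 < e / (C + 1) by rewrite divr_gt0 // ltr_wpDl.
  exists (t' ++ t), (Num.min d (e / (C + 1))); split; first by rewrite lt_min d0.
  move=> y yt i [<-|si].
    apply: (@le_lt_trans _ _ (C * (e / (C + 1)))).
      apply: Ct (ltW d'0) _ => l lt; apply/ltW.
      have : P l y < Num.min d (e / (C + 1)) by apply: yt; apply/List.in_or_app; left.
      by rewrite lt_min => /andP[].
    rewrite mulrCA gtr_pMr // ltr_pdivrMr ?mul1r ?ltrDl // ltr_wpDl //.
  apply: IH si => l lt.
  have : P l y < Num.min d (e / (C + 1)) by apply: yt; apply/List.in_or_app; right.
  by rewrite lt_min => /andP[].
exists t, d; split=> // y yt; apply: sV => j js.
have Exy : f (y - x) = f y - f x :> A.
  by have := lf (-1) x y; rewrite !scaleN1r addrC [- f x + _]addrC.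
change (P j (f y - f x : A) < e); rewrite -Exy.
exact: td yt j js.
Qed.

Variables (mul : A -> A -> A) (e : nat -> A).
Let h k x := x - mul (e k) x.

Hypothesis mulDr : forall a b x y, mul a (b *: x + y) = b *: mul a x + mul a y.
Hypothesis mulDl : forall a b x y, mul (b *: x + y) a = b *: mul x a + mul y a.
Hypothesis mulA : forall x y z, mul x (mul y z) = mul (mul x y) z.
Hypothesis mul_bounded : forall a j, exists2 C, 0 <= C & exists s, forall x B,
  0 <= B -> (forall i, List.In i s -> P i x <= B) -> P j (mul a x) <= C * B.
Hypothesis telescope : forall k x,
  mul (e k.+1 - e k) (h k x + h k.+1 x) = h k (h k x) - h k.+1 (h k.+1 x).
Hypothesis e0 : e 0%N = 0.
Hypothesis growth : forall j, exists N k0, forall k, (k0 <= k)%N ->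
  P j (e k) <= 2 ^+ (N * k).
Hypothesis decay : forall j M, exists s k0, forall k, (k0 <= k)%N -> forall x B,
  0 <= B -> (forall i, List.In i s -> P i x <= B) -> 2 ^+ (M * k) * P j (h k x) <= B.

Let h_linear k b x y : h k (b *: x + y) = b *: h k x + h k y.
Proof. by rewrite /h mulDr scalerBr opprD addrACA. Qed.

Let h_continuous k : continuous (h k).
Proof.
apply: seminorm_continuous => [b x y|j]; first exact: h_linear.
have [C C0 [s Cs]] := mul_bounded (e k) j.
exists (1 + C); first by rewrite addr_ge0.
exists (j :: s) => x B B0 xB; apply: le_trans (snD _ _ _) _; rewrite snN mulrDl mul1r.
by apply: lerD; [apply: xB; left|apply: Cs => // i si; apply: xB; right].
Qed.

Lemma seminorm_seq_bound s x : exists2 B, 0 <= B & forall i, List.In i s -> P i x <= B.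
Proof.
elim: s => [|j s [B B0 IH]]; first by exists 0.
exists (B + P j x) => [|i [<-|si]]; first by rewrite addr_ge0 ?sn_ge0.
  by rewrite lerDr.
by apply: le_trans (IH i si) _; rewrite lerDl sn_ge0.
Qed.

(* [decay] with exponent [1] applies to the outer [h k], and with exponent [0] it
   bounds the inner one uniformly in [k]. *)
Let h_sqr_small j x (d : R) : 0 < d ->
  exists k0, forall k, (k0 <= k)%N -> P j (h k (h k x)) < d.
Proof.
move=> d0; have [s [k1 H1]] := decay j 1.
have [B B0 [k2 H2]] : exists2 B, 0 <= B & exists k2, forall k, (k2 <= k)%N ->
    forall i, List.In i s -> P i (h k x) <= B.
  elim: s {H1} => [|i s [B B0 [k2 IH]]]; first by exists 0 => //; exists 0%N.
  have [t [k3 H3]] := decay i 0; have [B' B'0 tB'] := seminorm_seq_bound t x.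
  exists (B + B'); first exact: addr_ge0.
  exists (maxn k2 k3) => k; rewrite geq_max => /andP[kk2 kk3] l [<-|sl].
    have := H3 k kk3 x B' B'0 tB'; rewrite mul1r => /le_trans; apply.
    by rewrite lerDr.
  by apply: le_trans (IH k kk2 l sl) _; rewrite lerDl.
have [k4 H4] := exp2_ge ((B + 1) / d).
exists (maxn k1 (maxn k2 k4)) => k; rewrite !geq_max => /and3P[kk1 kk2 kk4].
have := H1 k kk1 (h k x) B B0 (H2 k kk2); rewrite mul1n => H.
have q0 : 0 < (2 : R) ^+ k by rewrite exprn_gt0.
rewrite -(ltr_pM2l q0); apply: le_lt_trans H _.
apply: (@lt_le_trans _ _ (B + 1)); first by rewrite ltrDl.
rewrite -ler_pdivrMr //; apply: le_trans H4 _.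
by rewrite ler_weXn2l ?ler1n.
Qed.

(** With [h k = 1 - e k] the difference [e k.+1 - e k] is [h k - h k.+1], and its
    product with [h k + h k.+1] is [h k ^ 2 - h k.+1 ^ 2]. These products telescope,
    and the partial sums are [1 - h N ^ 2]. *)
Theorem approximate_unit_splitting :
  rapid_splitting mul (fun k => e k.+1 - e k) (fun k x => h k x + h k.+1 x).
Proof.
split.
- move=> k b x y; rewrite !h_linear.
  by rewrite addrACA -scalerDr.
- by move=> k x; apply: continuous_add; exact: h_continuous.
- have hM k x y : h k (mul x y) = mul (h k x) y.
    have := mulDl y (-1) (mul (e k) x) x; rewrite !scaleN1r => D.
    by rewrite /h [x - _]addrC D mulA addrC.
  move=> k x y; rewrite !hM.
  by have := mulDl y 1 (h k x) (h k.+1 x); rewrite !scale1r.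
- move=> x; have S N : \sum_(0 <= k < N) mul (e k.+1 - e k) (h k x + h k.+1 x) =
      x - h N (h N x).
    under eq_bigr do rewrite telescope -opprB.
    rewrite sumrN telescope_sumr // opprB.
    have h0 y : h 0%N y = y.
      have := mulDl y 1 0 0; rewrite /h e0 scaler0 addr0 scale1r => /eqP.
      by rewrite -subr_eq0 opprD addNKr oppr_eq0 => /eqP ->; rewrite subr0.
    by rewrite !h0.
  under eq_fun do rewrite S.
  move=> V [s [d [d0 sV]]].
  have [k0 k0P] : exists k0, forall k, (k0 <= k)%N -> forall j, List.In j s ->
      P j (h k (h k x)) < d.
    elim: s {sV} => [|j s [k0 IH]]; first by exists 0%N.
    have [k1 H1] := h_sqr_small j x d0.
    exists (maxn k0 k1) => k; rewrite geq_max => /andP[kk0 kk1] i [<-|si].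
      exact: H1.
    exact: IH.
  exists k0 => // k /= kk; apply: sV => j js.
  by rewrite [_ - _ - _]addrAC subrr add0r snN; exact: k0P.
- move=> j; have [N [k0 H]] := growth j.
  exists (N + N + 1)%N, (maxn k0 1) => k; rewrite geq_max => /andP[kk k1].
  apply: le_trans (snD _ _ _) _; rewrite snN.
  apply: (@le_trans _ _ (2 ^+ (N * k.+1) + 2 ^+ (N * k.+1))).
    apply: lerD; first by apply: H; exact: leq_trans (leqnSn k).
    apply: le_trans (H k kk) _; rewrite ler_weXn2l ?ler1n //.
    by rewrite leq_mul2l leqnSn orbT.
  rewrite -mulr2n -(mulr_natl (2 ^+ (N * k.+1))) -exprS ler_weXn2l ?ler1n //; nia.
- move=> j M; have [s [k0 H]] := decay j M.+1.
  exists s, (maxn k0 1) => k; rewrite geq_max => /andP[kk k1] x B B0 xB.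
  have half l : (k <= l)%N -> 2 * (2 ^+ (M * k) * P j (h l x)) <= B.
    move=> kl; apply: le_trans (H l (leq_trans kk kl) x B B0 xB).
    rewrite mulrA -exprS ler_wpM2r ?sn_ge0 // ler_weXn2l ?ler1n //; nia.
  have b1 := half k (leqnn k); have b2 := half k.+1 (leqnSn k).
  apply: (@le_trans _ _ (2 ^+ (M * k) * (P j (h k x) + P j (h k.+1 x)))).
    by rewrite ler_wpM2l ?exprn_ge0 //; exact: snD.
  rewrite mulrDr; lra.
Qed.

End ApproximateUnit.

(** * Charts, and transfer of estimates between them *)

Section ChartCalculus.
Variables (R : realType) (m : nat) (X : manifold R m).
Local Notation V := 'rV[R]_m.
Implicit Types (e : chart R m X) (f g : X -> R) (x : X) (A : set X).

(** Real functions on [X] are studied through their local expressions; the real and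
    imaginary parts of a function in the ideal are treated separately. *)
Definition in_chart e g : V -> R := fun v => g (chart_bwd e v).

Definition smooth_real g := forall e, atlas e -> smooth_on (chart_cod e) (in_chart e g).

Lemma chart_fwd_cvg e x (O : set V) : chart_dom e x ->
  nbhs (chart_fwd e x) O -> \forall y \near x, chart_dom e y /\ O (chart_fwd e y).
Proof.
move=> ex nO.
have := @chart_fwd_continuous _ _ _ e.
rewrite continuous_open_subspace; last exact: chart_dom_open.
move=> /(_ x); rewrite inE => /(_ ex) /(_ _ nO) H.
by near=> y; split; near: y; [apply: open_nbhs_nbhs; split=> //; exact: chart_dom_open|exact: H].
Unshelve. all: by end_near. Qed.

Lemma chart_bwd_cvg e v (O : set X) : chart_cod e v ->
  nbhs (chart_bwd e v) O -> \forall w \near v, chart_cod e w /\ O (chart_bwd e w).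
Proof.
move=> ev nO.
have := @chart_bwd_continuous _ _ _ e.
rewrite continuous_open_subspace; last exact: chart_cod_open.
move=> /(_ v); rewrite inE => /(_ ev) /(_ _ nO) H.
by near=> w; split; near: w; [apply: open_nbhs_nbhs; split=> //; exact: chart_cod_open|exact: H].
Unshelve. all: by end_near. Qed.

Lemma chart_fwd_cod e x : chart_dom e x -> chart_cod e (chart_fwd e x).
Proof. by exists x. Qed.

Lemma chart_bwdK e v : chart_cod e v ->
  chart_dom e (chart_bwd e v) /\ chart_fwd e (chart_bwd e v) = v.
Proof. by move=> [x ex <-]; rewrite chart_fwdK. Qed.

Lemma open_bwd_preimage e (O : set X) : open O ->
  open [set v | chart_cod e v /\ O (chart_bwd e v)].
Proof.
rewrite !openE => oO v [ev Ov]; have := chart_bwd_cvg ev (oO _ Ov).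
exact: filterS.
Qed.

Lemma compact_chart_image e A : compact A -> A `<=` chart_dom e ->
  compact (chart_fwd e @` A).
Proof.
move=> cA Ae; apply: continuous_compact => //.
by apply: continuous_subspaceW Ae _; exact: chart_fwd_continuous.
Qed.

Lemma smooth_on_local (U : set V) (g : V -> R) :
  (forall v, U v -> exists2 U', U' v & smooth_on U' g) -> smooth_on U g.
Proof. by move=> H n s sn v /H [U' U'v sg]; exact: (sg n s sn v U'v). Qed.

Lemma smooth_realM f g : smooth_real f -> smooth_real g ->
  smooth_real (fun x => f x * g x).
Proof. by move=> sf sg e Xe; apply: smooth_onM; [exact: chart_cod_open|exact: sf|exact: sg]. Qed.

Lemma smooth_realB f g : smooth_real f -> smooth_real g ->
  smooth_real (fun x => f x - g x).
Proof. by move=> sf sg e Xe; apply: smooth_onB; [exact: chart_cod_open|exact: sf|exact: sg]. Qed.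

Lemma smooth_real_cst (c : R) : smooth_real (fun=> c).
Proof. by move=> e _; exact: smooth_on_cst. Qed.

Lemma smooth_real_sum I (r : seq I) (F : I -> X -> R) :
  (forall i, smooth_real (F i)) -> smooth_real (fun x => \sum_(i <- r) F i x).
Proof.
move=> sF e Xe; apply: (@smooth_on_sum _ _ (chart_cod e) I r (fun i v => F i (chart_bwd e v))).
  exact: chart_cod_open.
by move=> i; exact: sF.
Qed.

Lemma smooth_real_prod I (r : seq I) (F : I -> X -> R) :
  (forall i, smooth_real (F i)) -> smooth_real (fun x => \prod_(i <- r) F i x).
Proof.
move=> sF e Xe; apply: (@smooth_on_prod _ _ (chart_cod e) I r (fun i v => F i (chart_bwd e v))).
  exact: chart_cod_open.
by move=> i; exact: sF.
Qed.

(** What a continuous seminorm on smooth functions depends on: a compact piece of a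
    chart and an order of differentiation. *)
Record region := Region {
  rg_chart : chart R m X;
  rg_set : set X;
  rg_order : nat;
  rg_atlas : atlas rg_chart;
  rg_compact : compact rg_set;
  rg_sub : rg_set `<=` chart_dom rg_chart
}.
Implicit Types (j : region) (B C : R).

Definition bounded_on j g B := forall x, rg_set j x ->
  pder_bound (rg_order j) (in_chart (rg_chart j) g) (chart_fwd (rg_chart j) x) B.

Lemma bounded_on_le j g B C : B <= C -> bounded_on j g B -> bounded_on j g C.
Proof. by move=> BC gB x jx; apply: pder_bound_le BC (gB x jx). Qed.

Lemma bounded_onM j f g B C : smooth_real f -> smooth_real g ->
  bounded_on j f B -> bounded_on j g C ->
  bounded_on j (fun x => f x * g x) (2 ^+ rg_order j * B * C).
Proof.
move=> sf sg fB gC x jx; have Xj := @rg_atlas j.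
apply: (pder_boundM (@chart_cod_open _ _ _ (rg_chart j)) (sf _ Xj) (sg _ Xj)).
- by apply: chart_fwd_cod; exact: rg_sub.
- exact: fB.
- exact: gC.
Qed.

Lemma bounded_on_sum j (I : eqType) (r : seq I) (F : I -> X -> R) (B : I -> R) :
  (forall i, smooth_real (F i)) -> (forall i, i \in r -> bounded_on j (F i) (B i)) ->
  bounded_on j (fun x => \sum_(i <- r) F i x) (\sum_(i <- r) B i).
Proof.
move=> sF FB x jx; have Xj := @rg_atlas j.
apply: (@pder_bound_sum _ _ _ _ I r (fun i v => F i (chart_bwd (rg_chart j) v)) _ _
  (@chart_cod_open _ _ _ (rg_chart j))).
- by move=> i; exact: sF.
- by apply: chart_fwd_cod; exact: rg_sub.
- by move=> i ir; exact: FB.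
Qed.

Lemma smooth_bounded_on j g : smooth_real g -> exists2 B, 0 <= B & bounded_on j g B.
Proof.
move=> sg; have cA := compact_chart_image (@rg_compact j) (@rg_sub j).
have AU : chart_fwd (rg_chart j) @` rg_set j `<=` chart_cod (rg_chart j).
  by move=> _ [x jx <-]; apply: chart_fwd_cod; exact: rg_sub.
have [B BP] := pder_bound_compact (rg_order j) cA AU (sg _ (@rg_atlas j)).
exists `|B| => // x jx; apply: pder_bound_le (ler_norm _) _.
by apply: BP; exists x.
Qed.

Lemma near_in_chart e x f g : chart_dom e x -> (\forall y \near x, f y = g y) ->
  \forall v \near chart_fwd e x, in_chart e f v = in_chart e g v.
Proof.
move=> ex fg; have ev := chart_fwd_cod ex.
have := @chart_bwd_cvg e _ [set y | f y = g y] ev; rewrite chart_fwdK //.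
by move=> /(_ fg); apply: filterS => w [].
Qed.

Lemma near_bounded_on j f g B :
  (forall x, rg_set j x -> \forall y \near x, f y = g y) ->
  bounded_on j f B -> bounded_on j g B.
Proof.
move=> fg fB x jx s sN.
rewrite -(near_eq_pder s (near_in_chart (rg_sub jx) (fg x jx))).
exact: fB.
Qed.

(** A function carried by a compact piece of one chart is controlled everywhere by
    its derivatives in that chart: off the piece it vanishes, and on the piece the
    other charts differ by smooth coordinate changes. *)
Section Transfer.
Variables (d : chart R m X) (c : V) (r : R).
Hypotheses (Xd : atlas d) (r_ge0 : 0 <= r) (cd : cube c r `<=` chart_cod d).

Definition carrier : set X := [set x | chart_dom d x /\ cube c r (chart_fwd d x)].

Lemma compact_carrier : compact carrier.
Proof.
have -> : carrier = chart_bwd d @` cube c r.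
  apply/seteqP; split=> [x [dx cx]|_ [v cv <-]].
    by exists (chart_fwd d x) => //; rewrite chart_fwdK.
  by have [h1 h2] := chart_bwdK (cd cv); split=> //; rewrite h2.
apply: continuous_compact; last exact: compact_cube.
by apply: continuous_subspaceW cd _; exact: chart_bwd_continuous.
Qed.

Lemma closed_carrier : closed carrier.
Proof. by apply: compact_closed compact_carrier; exact: mfd_hausdorff. Qed.

Variable e : chart R m X.
Hypothesis Xe : atlas e.
Let O : set V := [set v | chart_cod e v /\ chart_dom d (chart_bwd e v)].
Let Phi v := chart_fwd d (chart_bwd e v).

Let oO : open O.
Proof. by apply: open_bwd_preimage; exact: chart_dom_open. Qed.

Let sPhi i : smooth_on O (fun v => Phi v 0 i).
Proof.
have := atlas_smooth Xe Xd i; apply: sub_smooth_on => v [ev dv].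
have [e'v E] := chart_bwdK ev.
by exists (chart_bwd e v).
Qed.

Let OPhi v : O v -> chart_cod d (Phi v).
Proof. by move=> [_]; exact: chart_fwd_cod. Qed.

Let OE g v : O v -> in_chart d g (Phi v) = in_chart e g v.
Proof. by move=> [_ dv]; rewrite /in_chart /Phi chart_fwdK. Qed.

Let od : open (chart_cod d) := @chart_cod_open _ _ _ d.

Lemma smooth_transfer g : (forall x, ~ carrier x -> g x = 0) ->
  smooth_on (chart_cod d) (in_chart d g) -> smooth_on (chart_cod e) (in_chart e g).
Proof.
move=> g0 sg; apply: smooth_on_local => v ev.
have [Lx|nLx] := pselect (carrier (chart_bwd e v)).
  exists O; first by split=> //; case: Lx.
  exact: (eq_smooth_on oO (@OE g) (smooth_on_comp oO od OPhi sPhi sg)).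
exists [set v | chart_cod e v /\ (~` carrier) (chart_bwd e v)] => //.
have oL : open [set v | chart_cod e v /\ (~` carrier) (chart_bwd e v)].
  by apply: open_bwd_preimage; apply: closed_openC; exact: closed_carrier.
apply: (eq_smooth_on oL _ (@smooth_on_cst _ _ _ 0)) => w [_ nLw].
by rewrite /in_chart g0.
Qed.

Lemma bounded_transfer N (A : set X) : compact A -> A `<=` chart_dom e ->
  exists2 C, 0 <= C & forall g B, (forall x, ~ carrier x -> g x = 0) ->
    smooth_on (chart_cod d) (in_chart d g) ->
    (forall v, cube c r v -> pder_bound N (in_chart d g) v B) ->
    forall x, A x -> pder_bound N (in_chart e g) (chart_fwd e x) (C * B).
Proof.
move=> cA Ae.
have cK : compact (chart_fwd e @` (A `&` carrier)).
  apply: compact_chart_image; last by move=> x [/Ae].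
  by apply: compact_closedI => //; exact: closed_carrier.
have KO : chart_fwd e @` (A `&` carrier) `<=` O.
  move=> _ [x [Ax [dx _]] <-]; split; first by apply: chart_fwd_cod; exact: Ae.
  by rewrite chart_fwdK //; exact: Ae.
have [C C0 CP] := pder_bound_comp oO od OPhi sPhi N cK KO.
exists C => // g B g0 sg gB x Ax.
have B0 : 0 <= B.
  by apply: (@pder_bound_ge0 _ _ _ _ c); apply: gB => i; rewrite subrr normr0.
have [Lx|nLx] := pselect (carrier x).
  have Ox : O (chart_fwd e x) by apply: KO; exists x.
  apply: (eq_pder_bound oO (@OE g) Ox); apply: CP => //; first by exists x.
  by case: Lx => _ cx; apply: gB; rewrite /Phi chart_fwdK //; exact: Ae.
move=> s sN; rewrite (@near_eq_pder _ _ _ (fun=> 0)) ?pder0 ?normr0 ?mulr_ge0 //.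
apply: (near_in_chart (f := g) (g := fun=> 0) (Ae _ Ax)).
have nL : nbhs x (~` carrier).
  by apply: open_nbhs_nbhs; split=> //; apply: closed_openC; exact: closed_carrier.
by apply: filterS nL => y; exact: g0.
Qed.

End Transfer.

End ChartCalculus.

(** * Local approximate units on a manifold *)

Section LocalUnits.
Variables (R : realType) (m : nat) (X : manifold R m) (Y : set X).
Local Notation V := 'rV[R]_m.
Implicit Types (e : chart R m X) (f g : X -> R) (x : X) (j : region X) (B C : R).

Definition flat_real g := forall e, atlas e -> forall y, Y y -> chart_dom e y ->
  flat_at (in_chart e g) (chart_fwd e y).

(** The cut-offs of one chart, multiplied by a plateau function [a] of that chart and
    extended by zero. Everything that the chart was needed for is recorded here, so
    that the gluing below does not mention charts. *)
Record local_unit (W : set X) (a : X -> R) (b : nat -> X -> R) := LocalUnit {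
  lu_open : open W;
  lu_one : forall x, W x -> a x = 1;
  lu_smooth_plateau : smooth_real a;
  lu_smooth : forall k, smooth_real (b k);
  lu_zero : forall k y, Y y -> \forall x \near y, b k x = 0;
  lu_growth : forall j, exists2 C, 0 <= C & exists N, forall k,
    bounded_on j (b k) (C * 2 ^+ (N * k));
  lu_decay : forall j M, exists2 C, 0 <= C & exists j' k0, forall k, (k0 <= k)%N ->
    forall f, smooth_real f -> flat_real f -> forall B, bounded_on j' f B ->
    bounded_on j (fun x => (a x - b k x) * f x) (C * 2 ^- (M * k) * B)
}.

(** Fills the enumeration of a countable cover, which may have no other entries. *)
Lemma local_unit0 : local_unit set0 (fun=> 0) (fun _ _ => 0).
Proof.
have z j : bounded_on j (fun=> 0) 0.
  by move=> x jx s _; rewrite pder0 normr0.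
split=> //.
- exact: open0.
- exact: smooth_real_cst.
- by move=> k; exact: smooth_real_cst.
- by move=> k y _; near=> x.
- by move=> j; exists 0 => //; exists 0%N => k; rewrite mul0r.
- move=> j M; exists 0 => //; exists j, 0%N => k _ f sf ff B fB.
  rewrite !mul0r; under eq_fun do rewrite subr0 mul0r; exact: z.
Unshelve. all: by end_near. Qed.

(** In a chart at [x] take the cut-offs for the image of [Y] in a cube and a plateau
    supported in that cube; [bounded_transfer] carries their estimates to the other
    charts. *)
Lemma local_unit_exists x : exists W a b, local_unit W a b /\ W x.
Proof.
have [d Xd dx] := atlas_cover x.
have od : open (chart_cod d) by exact: chart_cod_open.
pose c := chart_fwd d x.
have [r r0 cU] : exists2 r : R, 0 < r & cube c (r + r) `<=` chart_cod d.
  have /nbhs_cube [r r0 rU] : nbhs c (chart_cod d).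
    by apply: open_nbhs_nbhs; split=> //; exact: chart_fwd_cod.
  exists (r / 4) => [|w cw]; first by rewrite divr_gt0.
  by apply: rU => i; apply: le_lt_trans (cw i) _; lra.
have cU1 : cube c r `<=` chart_cod d.
  by move=> w cw; apply: cU => i; apply: le_trans (cw i) _; rewrite lerDl ltW.
have [p [sp p1 p0]] := plateau_exists c r0.
have [E HE] := cutoff_family_exists (chart_fwd d @` (Y `&` chart_dom d)) od r0 cU.
pose a x : R := if pselect (chart_dom d x) then p (chart_fwd d x) else 0.
pose b k x : R := a x * E k (chart_fwd d x).
have a_d y : chart_dom d y -> a y = p (chart_fwd d y).
  by rewrite /a; case: pselect.
have a0 y : ~ carrier d c r y -> a y = 0.
  rewrite /a; case: pselect => // dy ny; apply: p0 => cy; exact: ny.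
have b0 k y : ~ carrier d c r y -> b k y = 0 by rewrite /b => /a0 ->; rewrite mul0r.
have in_a v : chart_cod d v -> p v = in_chart d a v.
  by move=> /chart_bwdK [h1 h2]; rewrite /in_chart a_d ?h2.
have in_b k v : chart_cod d v -> p v * E k v = in_chart d (b k) v.
  by move=> dv; rewrite /in_chart /b -/(in_chart d a v) -in_a //; case: (chart_bwdK dv) => _ ->.
have sE k : smooth_on (chart_cod d) (E k) by exact: cf_smooth HE k _ od.
have sa : smooth_on (chart_cod d) (in_chart d a) by exact: eq_smooth_on od in_a (sp _).
have sb k : smooth_on (chart_cod d) (in_chart d (b k)).
  exact: (eq_smooth_on od (in_b k) (smooth_onM od (sp _) (sE k))).
have pBP N : exists2 D, 0 <= D & forall v, cube c r v -> pder_bound N p v D.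
  have [D DP] := pder_bound_compact N (@compact_cube _ _ c r) cU1 (sp _).
  by exists `|D| => // v /DP; apply: pder_bound_le; exact: ler_norm.
exists (interior [set y | a y = 1]), a, b; split; last first.
  have : nbhs c (cube c (r / 2)).
    by apply/nbhs_cube; exists (r / 2) => [|w cw i]; [rewrite divr_gt0|exact: ltW].
  by move=> /(chart_fwd_cvg dx); apply: filterS => y [dy cy] /=; rewrite a_d // p1.
split.
- exact: open_interior.
- by move=> y /interior_subset.
- move=> e Xe; exact: (smooth_transfer Xd cU1 Xe a0 sa).
- move=> k e Xe; exact: (smooth_transfer Xd cU1 Xe (b0 k) (sb k)).
- move=> k y Yy; have [dy|ndy] := pselect (chart_dom d y).
    have Zy : (chart_fwd d @` (Y `&` chart_dom d)) (chart_fwd d y) by exists y.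
    have := chart_fwd_cvg dy (cf_zero HE k Zy); apply: filterS => z [_ /= Ez].
    by rewrite /b Ez mulr0.
  have nL : nbhs y (~` carrier d c r).
    apply: open_nbhs_nbhs; split; last by case.
    by apply: closed_openC; exact: closed_carrier.
  by apply: filterS nL => z; exact: b0.
- move=> j; have [C C0 T] := bounded_transfer Xd (ltW r0) cU1 (@rg_atlas _ _ _ j)
    (rg_order j) (@rg_compact _ _ _ j) (@rg_sub _ _ _ j).
  have [D D0 DP] := pBP (rg_order j); have [G G0 GP] := cf_growth HE (rg_order j).
  exists (C * (2 ^+ rg_order j * D * G)); first by rewrite !mulr_ge0.
  exists (m + rg_order j)%N => k y jy; rewrite -!mulrA.
  apply: (T _ _ (b0 k) (sb k) _ _ jy) => v cv.
  apply: (eq_pder_bound od (in_b k)); first exact: cU1.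
  rewrite !mulrA -(mulrA _ G).
  by apply: (pder_boundM od (sp _) (sE k) (cU1 _ cv)); [exact: DP|exact: GP].
- move=> j M; have [C C0 T] := bounded_transfer Xd (ltW r0) cU1 (@rg_atlas _ _ _ j)
    (rg_order j) (@rg_compact _ _ _ j) (@rg_sub _ _ _ j).
  set N := rg_order j in T *.
  have [D D0 DP] := pBP N; have [G G0 [k0 GP]] := cf_decay HE N M.
  exists (C * (2 ^+ N * D * G)); first by rewrite !mulr_ge0.
  have sL : carrier d c (r + r) `<=` chart_dom d by move=> y [].
  exists (Region (N + (M + N + m)) Xd (compact_carrier cU) sL), k0.
  move=> k kk f sf ff B fB y jy.
  have E0 z : ~ carrier d c r z -> (a z - b k z) * f z = 0.
    by move=> nz; rewrite a0 // b0 // subrr mul0r.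
  have EE v : chart_cod d v -> p v * ((1 - E k v) * in_chart d f v) =
      in_chart d (fun z => (a z - b k z) * f z) v.
    move=> dv; rewrite [RHS]/in_chart -/(in_chart d a v) -/(in_chart d (b k) v).
    by rewrite -in_a // -in_b // mulrA mulrBr mulr1.
  have sEf : smooth_on (chart_cod d) (fun v => (1 - E k v) * in_chart d f v).
    exact: (smooth_onM od (smooth_onB od (@smooth_on_cst _ _ _ 1) (sE k)) (sf d Xd)).
  have sEE : smooth_on (chart_cod d) (in_chart d (fun z => (a z - b k z) * f z)).
    exact: (eq_smooth_on od EE (smooth_onM od (sp _) sEf)).
  have -> : C * (2 ^+ N * D * G) * 2 ^- (M * k) * B =
      C * (2 ^+ N * D * (G * 2 ^- (M * k) * B)) by rewrite !mulrA.
  apply: (T _ _ E0 sEE _ _ jy) => v cv.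
  apply: (eq_pder_bound od EE); first exact: cU1.
  apply: (pder_boundM od (sp _) sEf (cU1 _ cv)); first exact: DP.
  apply: (GP k kk _ (sf d Xd)) => // [w [z [Yz dz] <-] _|w cw]; first exact: ff.
  have [h1 h2] := chart_bwdK (cU _ cw).
  by rewrite -h2; apply: fB; split; rewrite ?h2.
Qed.

End LocalUnits.

(** * Gluing the local approximate units *)

Lemma compact_increasing_cover (T : topologicalType) (A : set T) (W : nat -> set T) :
  compact A -> (forall i, open (W i)) -> (forall x, A x -> exists i, W i x) ->
  exists n, forall x, A x -> exists2 i, (i < n)%N & W i x.
Proof.
move=> cA oW AW; apply: contrapT => nA.
pose V n : set T := [set x | A x /\ forall i, (i < n)%N -> ~ W i x].
have V0 n : V n !=set0.
  apply: contrapT => Vn; apply: nA; exists n => x Ax; apply: contrapT => xW.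
  by apply: Vn; exists x; split=> // i ilt Wi; apply: xW; exists i.
have FV : ProperFilter (filter_from setT V).
  apply: filter_from_proper; last by move=> n _; exact: V0.
  apply: filter_from_filter; first by exists 0%N.
  move=> a b _ _; exists (maxn a b) => // x [Ax xn].
  by split; split=> // i ilt; apply: xn; rewrite leq_max ilt ?orbT.
have [|p [Ap clp]] := cA _ FV; first by exists 0%N => // x [].
have [i Wi] := AW p Ap.
have Vi : filter_from setT V (V i.+1) by exists i.+1.
have nWi : nbhs p (W i) by apply: open_nbhs_nbhs; split.
by have [y [[_ /(_ i (ltnSn i))]]] := clp _ _ Vi nWi.
Qed.

(** Lindeloef: choose one suitable index for each basic open set that fits into some
    member of the cover. *)
Lemma second_countable_family (T : topologicalType) (P : Type) (G : P -> Prop)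
    (W : P -> set T) (p0 : P) : @second_countable T -> G p0 ->
  (forall p, G p -> open (W p)) -> (forall x, exists2 p, G p & W p x) ->
  exists s : nat -> P, (forall n, G (s n)) /\ forall x, exists n, W (s n) x.
Proof.
move=> [B /countable_injP [c cinj] [Bo Bb]] Gp0 oW cW.
have /choice [s sP] : forall n, exists p, G p /\
    ((exists2 q, G q & exists U, [/\ B U, c U = n & U `<=` W q]) ->
     exists U, [/\ B U, c U = n & U `<=` W p]).
  move=> n; have [[q Gq HU]|nq] := pselect (exists2 q, G q &
    exists U, [/\ B U, c U = n & U `<=` W q]); first by exists q.
  by exists p0.
exists s; split=> [n|x]; first by have [] := sP n.
have [q Gq Wq] := cW x.
have [U [BU Ux] UW] : filter_from [set U | B U /\ U x] id (W q).
  by apply: Bb; apply: open_nbhs_nbhs; split=> //; exact: oW.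
exists (c U); have [_ [|U' [BU' cU' UW']]] := sP (c U).
  by exists q => //; exists U.
apply: UW'; suff -> : U' = U by [].
by apply: cinj; rewrite ?inE.
Qed.

(** Turns a sequence of plateau functions [a i] into a partition of unity: on a set
    where some [a i] equals [1] the right-hand side is [1]. *)
Lemma partition_telescope (S : comRingType) (a : nat -> S) n :
  \sum_(i < n) (\prod_(j < i) (1 - a j)) * a i = 1 - \prod_(j < n) (1 - a j).
Proof.
elim: n => [|n IH]; first by rewrite !big_ord0 subrr.
rewrite !big_ord_recr /= IH; set p := \prod_(j < n) _.
by rewrite mulrBr mulr1 opprB addrCA addrC addrA.
Qed.

Lemma In_map (I : eqType) T (F : I -> T) (s : seq I) i :
  i \in s -> List.In (F i) (map F s).
Proof.
elim: s => [//|i' s IH]; rewrite inE => /orP[/eqP ->|/IH H]; first by left.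
by right.
Qed.

Section GlobalUnit.
Variables (R : realType) (m : nat) (X : manifold R m) (Y : set X).
Implicit Types (f g : X -> R) (x : X) (j : region X) (B C : R).

(** The [k]-th function is [sum_(i < k) (prod_(l < i) (1 - a l)) * b i k], where
    [a i] and [b i k] are the local plateaus and cut-offs. The [i]-th weight vanishes on
    [W l] for all [l < i], so near a compact set covered by [W 0, ..., W n.-1] only the
    first [n] summands remain once [k >= n], and there the weighted sum of the [a i] is
    [1]. Thus [(1 - e k) * f] is a finite sum of weighted terms [(a i - b i k) * f], to
    which [lu_decay] applies. *)
Theorem approximate_unit_exists : exists e : nat -> X -> R,
  [/\ forall x, e 0%N x = 0,
      forall k, smooth_real (e k),
      forall k y, Y y -> \forall x \near y, e k x = 0,
      forall j, exists2 C, 0 <= C & exists N k0, forall k, (k0 <= k)%N ->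
        bounded_on j (e k) (C * 2 ^+ (N * k)) &
      forall j M, exists2 C, 0 <= C & exists (s : seq (region X)) k0,
        forall k, (k0 <= k)%N -> forall f, smooth_real f -> flat_real Y f ->
        forall B, (forall j', List.In j' s -> bounded_on j' f B) ->
        bounded_on j (fun x => (1 - e k x) * f x) (C * 2 ^- (M * k) * B)].
Proof.
pose unit_data := (set X * (X -> R) * (nat -> X -> R))%type.
pose G (p : unit_data) := local_unit Y p.1.1 p.1.2 p.2.
have [s [sG sW]] : exists s : nat -> unit_data,
    (forall n, G (s n)) /\ forall x, exists n, (s n).1.1 x.
  apply: (second_countable_family (G := G) (W := fun p => p.1.1)
    (p0 := (set0, fun=> 0, fun _ _ => 0)) (@mfd_second_countable _ _ X)).
  - exact: local_unit0.
  - by move=> p; exact: lu_open.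
  - move=> x; have [W [a [b [H Wx]]]] := local_unit_exists Y x.
    by exists (W, a, b).
pose W i := (s i).1.1; pose a i := (s i).1.2; pose b i := (s i).2.
have {sG} H i : local_unit Y (W i) (a i) (b i) by exact: sG.
(* [rest i] vanishes on every [W l] with [l < i]. *)
pose rest i x : R := \prod_(l < i) (1 - a l x).
have s_rest i : smooth_real (rest i).
  apply: (@smooth_real_prod _ _ X _ _ (fun (l : 'I_i) x => 1 - a l x)) => l.
  by apply: smooth_realB; [exact: smooth_real_cst|exact: lu_smooth_plateau (H l)].
have sb i k : smooth_real (b i k) by exact: lu_smooth (H i) k.
have sa i : smooth_real (a i) by exact: lu_smooth_plateau (H i).
have rest0 i n x : W i x -> (i < n)%N -> rest n x = 0.
  move=> Wi ilt; rewrite /rest (bigD1 (Ordinal ilt)) //=.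
  by rewrite (lu_one (H i) Wi) subrr mul0r.
pose e k x : R := \sum_(i < k) rest i x * b i k x.
have e_cut n k x : (exists2 i, (i < n)%N & W i x) -> (n <= k)%N ->
    e k x = \sum_(i < n) rest i x * b i k x.
  move=> [i ilt Wi] nk; rewrite /e (big_ord_widen k (fun i => rest i x * b i k x) nk).
  rewrite [RHS]big_mkcond; apply: eq_bigr => l _; case: ltnP => // nl.
  by rewrite (rest0 i) ?mul0r //; exact: leq_trans nl.
have one n x : (exists2 i, (i < n)%N & W i x) -> \sum_(i < n) rest i x * a i x = 1.
  move=> [i ilt Wi]; rewrite (partition_telescope (fun i => a i x)).
  by rewrite -/(rest n x) (rest0 i) ?subr0.
have near_cover n x : (exists2 i, (i < n)%N & W i x) ->
    \forall y \near x, exists2 i, (i < n)%N & W i y.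
  move=> [i ilt Wi]; have : nbhs x (W i).
    by apply: open_nbhs_nbhs; split=> //; exact: lu_open (H i).
  by apply: filterS => y Wy; exists i.
have cov j : exists n, forall x, rg_set j x -> exists2 i, (i < n)%N & W i x.
  apply: compact_increasing_cover; first exact: rg_compact.
    by move=> i; exact: lu_open (H i).
  by move=> x _; exact: sW.
exists e; split.
- by move=> x; rewrite /e big_ord0.
- move=> k; apply: (@smooth_real_sum _ _ X _ _ (fun (i : 'I_k) x => rest i x * b i k x)).
  by move=> i; exact: smooth_realM.
- move=> k y Yy; near=> x; rewrite /e big1 // => i _.
  suff -> : b i k x = 0 by rewrite mulr0.
  move: i; near: x; apply: (near_forall (nbhs_filter y)) => i.
  exact: lu_zero (H i) k y Yy.
- move=> j; have [n nP] := cov j.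
  have /choice [D DP] : forall i, exists D, 0 <= D /\ bounded_on j (rest i) D.
    by move=> i; have [D] := smooth_bounded_on j (s_rest i); exists D.
  have /choice [q qP] : forall i, exists q : R * nat, 0 <= q.1 /\
      forall k, bounded_on j (b i k) (q.1 * 2 ^+ (q.2 * k)).
    by move=> i; have [C C0 [N CN]] := lu_growth (H i) j; exists (C, N).
  pose c i := 2 ^+ rg_order j * D i * (q i).1.
  have c0 i : 0 <= c i by rewrite !mulr_ge0 ?(DP i).1 ?(qP i).1.
  exists (\sum_(i < n) c i); first by rewrite sumr_ge0.
  exists (\sum_(i < n) (q i).2)%N, n => k nk.
  apply: (near_bounded_on (f := fun x => \sum_(i < n) rest i x * b i k x)).
    move=> x /nP /near_cover; apply: filterS => y yn; exact/esym/e_cut.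
  apply: (@bounded_on_le _ _ _ _ _ (\sum_(i < n) c i * 2 ^+ ((q i).2 * k))).
    rewrite mulr_suml; apply: ler_sum => i _; rewrite ler_wpM2l // ler_weXn2l ?ler1n //.
    by rewrite leq_mul2r; apply/orP; right; rewrite (bigD1 i) //= leq_addr.
  apply: (@bounded_on_sum _ _ _ j _ _ (fun (i : 'I_n) x => rest i x * b i k x)).
    by move=> i; exact: smooth_realM.
  move=> i _; rewrite /c -mulrA; apply: bounded_onM => //; first exact: (DP i).2.
  exact: (qP i).2.
- move=> j M; have [n nP] := cov j.
  have /choice [D DP] : forall i, exists D, 0 <= D /\ bounded_on j (rest i) D.
    by move=> i; have [D] := smooth_bounded_on j (s_rest i); exists D.
  have /choice [q qP] : forall i, exists q : R * region X * nat, 0 <= q.1.1 /\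
      forall k, (q.2 <= k)%N -> forall f, smooth_real f -> flat_real Y f ->
      forall B, bounded_on q.1.2 f B ->
      bounded_on j (fun x => (a i x - b i k x) * f x) (q.1.1 * 2 ^- (M * k) * B).
    by move=> i; have [C C0 [j' [k0 P]]] := lu_decay (H i) j M; exists (C, j', k0).
  pose c i := 2 ^+ rg_order j * D i * (q i).1.1.
  exists (\sum_(i < n) c i).
    by rewrite sumr_ge0 // => i _; rewrite !mulr_ge0 ?(DP i).1 ?(qP i).1.
  exists [seq (q i).1.2 | i : 'I_n <- enum 'I_n], (maxn n (\sum_(i < n) (q i).2)).
  move=> k; rewrite geq_max => /andP[nk qk] f sf ff B fB.
  apply: (near_bounded_on
    (f := fun x => \sum_(i < n) rest i x * ((a i x - b i k x) * f x))).
    move=> x /nP /near_cover; apply: filterS => y yn.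
    rewrite (e_cut _ _ _ yn nk) -(one _ _ yn) -sumrB mulr_suml.
    by apply: eq_bigr => i _; rewrite -mulrBr mulrA.
  have -> : (\sum_(i < n) c i) * 2 ^- (M * k) * B =
      \sum_(i < n) 2 ^+ rg_order j * D i * ((q i).1.1 * 2 ^- (M * k) * B).
    by rewrite !mulr_suml; apply: eq_bigr => i _; rewrite /c !mulrA.
  have sab i : smooth_real (fun x => (a i x - b i k x) * f x).
    exact: (smooth_realM (smooth_realB (sa i) (sb i k)) sf).
  apply: (@bounded_on_sum _ _ _ j _ _
    (fun (i : 'I_n) x => rest i x * ((a i x - b i k x) * f x))).
    by move=> i; exact: (smooth_realM (s_rest i) (sab i)).
  move=> i _; apply: (bounded_onM (s_rest i) (sab i)); first exact: (DP i).2.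
  apply: (qP i).2 => //; last by apply: fB; apply: (In_map (fun i : 'I_n => (q i).1.2)); rewrite mem_enum.
  by apply: leq_trans qk; rewrite (bigD1 i) //= leq_addr.
Unshelve. all: by end_near. Qed.

End GlobalUnit.

(** * The flat ideal *)

Lemma seqs_le (T : finType) N : exists l : seq (seq T), forall t, (size t <= N)%N -> t \in l.
Proof.
elim: N => [|N [l IH]]; first by exists [:: [::]] => [[]].
exists ([::] :: [seq z :: t | z <- enum T, t <- l]) => [[//|z t] /= tN].
by rewrite inE /=; apply/allpairsP; exists (z, t); rewrite mem_enum IH.
Qed.

Section FlatIdeal.
Variables (R : realType) (cplx : bool) (m : nat) (X : manifold R m) (Y : set X).
Local Notation K := (base_field R cplx).
Local Notation F := (flat_fun cplx Y).
Implicit Types (g : X -> R) (f : F) (j : region X) (B C : R) (i : flat_index X).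

Definition re_part f : X -> R := fun x => Kre (f x).
Definition im_part f : X -> R := fun x => Kim (f x).

Lemma smooth_re f : smooth_real (re_part f).
Proof. by move=> e Xe; have [/(_ e Xe) []] := flat_funP f. Qed.

Lemma smooth_im f : smooth_real (im_part f).
Proof. by move=> e Xe; have [/(_ e Xe) []] := flat_funP f. Qed.

Lemma flat_re f : flat_real Y (re_part f).
Proof. by move=> e Xe y Yy ey; have [_ /(_ e Xe y Yy ey) []] := flat_funP f. Qed.

Lemma flat_im f : flat_real Y (im_part f).
Proof. by move=> e Xe y Yy ey; have [_ /(_ e Xe y Yy ey) []] := flat_funP f. Qed.

(** Vanishing near [Y] gives flatness on [Y] in every chart. *)
Lemma flat_of_real g : smooth_real g -> (forall y, Y y -> \forall x \near y, g x = 0) ->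
  exists f, forall x, f x = Kmk cplx (g x) 0.
Proof.
move=> sg g0; pose G : X -> K^o := fun x => Kmk cplx (g x) 0.
have reG e : re_in e G = in_chart e g.
  by apply/funext => v; rewrite /re_in /G; case: (cplx).
have imG e : im_in e G = fun=> 0.
  by apply/funext => v; rewrite /im_in /G; case: (cplx).
have GP : G \in flat_pred Y.
  apply/asboolP; split=> [e Xe|e Xe y Yy ey]; rewrite reG imG.
    by split; [exact: sg|exact: smooth_on_cst].
  split=> s; last by rewrite pder0.
  by rewrite (near_eq_pder s (near_in_chart (g := fun=> 0) ey (g0 y Yy))) /in_chart pder0.
by exists (FlatFun GP).
Qed.

Lemma Kre_le (a b : R) : `|a| <= Kabs (Kmk cplx a b).
Proof.
rewrite /Kabs; case: cplx => //=; rewrite -[`|a|]sqrtr_sqr ler_sqrt ?addr_ge0 ?sqr_ge0 //.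
by rewrite lerDl sqr_ge0.
Qed.

Lemma pder_im_le e s f v (a : R) :
  `|pder s (im_in e f) v| <= Kabs (Kmk cplx a (pder s (im_in e f) v)).
Proof.
case: (cplx) f => f.
  rewrite /Kabs /=; set b := pder _ _ _.
  by rewrite -[`|b|]sqrtr_sqr ler_sqrt ?addr_ge0 ?sqr_ge0 // lerDr sqr_ge0.
have -> : im_in e f = fun=> 0 by apply/funext.
by rewrite pder0 normr0 Kabs_ge0.
Qed.

Definition region_of i : region X :=
  Region (size (fi_der i)) (@fi_atlas _ _ _ i) (@fi_compact _ _ _ i) (@fi_sub _ _ _ i).

Lemma flat_sn_bounded i f B C :
  bounded_on (region_of i) (re_part f) B -> bounded_on (region_of i) (im_part f) C ->
  0 <= B + C -> flat_sn i f <= B + C.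
Proof.
move=> fB fC BC; apply: flat_sn_le => // x ix; apply: le_trans (Kabs_mk_le _ _ _) _.
by apply: lerD; [exact: fB|exact: fC].
Qed.

(** Conversely to [flat_sn_bounded], the bounds on a region follow from finitely many
    seminorms, one for each multi-index of admissible length. *)
Lemma bounded_flat_sn (s : seq (region X)) : exists s' : seq (flat_index X),
  forall f B, (forall i, List.In i s' -> flat_sn i f <= B) ->
  forall j, List.In j s -> bounded_on j (re_part f) B /\ bounded_on j (im_part f) B.
Proof.
elim: s => [|j s [s1 IH]]; first by exists [::].
have [l lP] := seqs_le 'I_m (rg_order j).
pose ix t := FlatIndex t (@rg_atlas _ _ _ j) (@rg_compact _ _ _ j) (@rg_sub _ _ _ j).
exists (map ix l ++ s1) => f B fB j' [<-|]; last first.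
  by apply: IH => i is1; apply: fB; apply/List.in_or_app; right.
have tB t : (size t <= rg_order j)%N -> flat_sn (ix t) f <= B.
  by move=> /lP tl; apply: fB; apply/List.in_or_app; left; exact: In_map.
split=> x jx t /tB; apply: le_trans; apply: le_trans (@flat_sn_ub _ _ _ _ _ (ix t) f x jx).
  exact: Kre_le.
exact: pder_im_le.
Qed.

Lemma bounded_on_lin j g h (a b B C : R) : smooth_real g -> smooth_real h ->
  bounded_on j g B -> bounded_on j h C ->
  bounded_on j (fun x => a * g x + b * h x) (`|a| * B + `|b| * C).
Proof.
move=> sg sh gB hC x jx s sN; have Xj := @rg_atlas _ _ _ j.
rewrite (pder_lin (n := size s) a b (@chart_cod_open _ _ _ (rg_chart j))
  (sg _ Xj (size s)) (sh _ Xj (size s)) (leqnn _)); last first.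
  by apply: chart_fwd_cod; exact: rg_sub.
apply: le_trans (ler_normD _ _) _; rewrite !normrM.
by apply: lerD; apply: ler_wpM2l => //; [exact: gB|exact: hC].
Qed.

Lemma flat_mul_bounded (a : F) i : exists2 C, 0 <= C & exists s, forall f B, 0 <= B ->
  (forall i', List.In i' s -> flat_sn i' f <= B) -> flat_sn i (flat_mul a f) <= C * B.
Proof.
pose j := region_of i; pose q : R := 2 ^+ rg_order j.
have [A1 A10 a1] := smooth_bounded_on j (smooth_re a).
have [A2 A20 a2] := smooth_bounded_on j (smooth_im a).
have [s sP] := bounded_flat_sn [:: j].
have q0 : 0 <= q by rewrite exprn_ge0.
have C0 : 0 <= q * A1 + q * A2 by rewrite addr_ge0 ?mulr_ge0.
exists ((q * A1 + q * A2) + (q * A1 + q * A2)); first by rewrite addr_ge0.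
exists s => f B B0 /sP /(_ j (or_introl erefl)) [f1 f2].
have re_re := bounded_onM (smooth_re a) (smooth_re f) a1 f1.
have re_im := bounded_onM (smooth_re a) (smooth_im f) a1 f2.
have im_re := bounded_onM (smooth_im a) (smooth_re f) a2 f1.
have im_im := bounded_onM (smooth_im a) (smooth_im f) a2 f2.
have srr := smooth_realM (smooth_re a) (smooth_re f).
have sri := smooth_realM (smooth_re a) (smooth_im f).
have sir := smooth_realM (smooth_im a) (smooth_re f).
have sii := smooth_realM (smooth_im a) (smooth_im f).
have Rb := bounded_on_lin 1 (-1) srr sii re_re im_im.
have Ib := bounded_on_lin 1 1 sri sir re_im im_re.
rewrite normrN1 normr1 !mul1r -mulrDl in Rb; rewrite normr1 !mul1r -mulrDl in Ib.
rewrite mulrDl; apply: flat_sn_bounded; last by rewrite addr_ge0 ?mulr_ge0.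
  rewrite (_ : re_part _ = fun x => 1 * (re_part a x * re_part f x) +
    -1 * (im_part a x * im_part f x)) //.
  by apply/funext => x; rewrite /re_part KreM mul1r mulN1r mulNr.
rewrite (_ : im_part _ = fun x => 1 * (re_part a x * im_part f x) +
  1 * (im_part a x * re_part f x)) //.
by apply/funext => x; rewrite /im_part KimM !mul1r.
Qed.

(** The functions of [approximate_unit_exists], read as elements of the ideal, satisfy
    the hypotheses of [approximate_unit_splitting]. Its constants are absorbed by
    requiring decay at rate [M.+1] instead of [M] and starting at a later index. *)
Theorem flat_ideal_splitting : exists u v, rapid_splitting (flat_ideal_mul cplx Y) u v.
Proof.
have [e [e0 se eY egrow edecay]] := approximate_unit_exists Y.
have /choice [E EP] k := flat_of_real (se k) (eY k).
have reE k : re_part (E k) = e k.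
  by apply/funext => x; rewrite /re_part EP; case: (cplx).
have imE k : im_part (E k) = fun=> 0.
  by apply/funext => x; rewrite /im_part EP; case: (cplx).
exists (fun k => (E k.+1 - E k : flat_ideal cplx Y)).
exists (fun k x => (x - flat_ideal_mul cplx Y (E k) x) +
                   (x - flat_ideal_mul cplx Y (E k.+1) x)).
apply: (approximate_unit_splitting (P := flat_family cplx Y) (e := E)).
- move=> a b x y; apply: val_inj; apply/funext => p.
  by change (a p * (b * x p + y p) = b * (a p * x p) + a p * y p :> K); ring.
- move=> a b x y; apply: val_inj; apply/funext => p.
  by change ((b * x p + y p) * a p = b * (x p * a p) + y p * a p :> K); ring.
- move=> x y z; apply: val_inj; apply/funext => p.
  by change (x p * (y p * z p) = x p * y p * z p :> K); ring.
- move=> a i; exact: flat_mul_bounded.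
- move=> k x; apply: val_inj; apply/funext => p.
  change ((E k.+1 p - E k p) * ((x p - E k p * x p) + (x p - E k.+1 p * x p)) =
   (x p - E k p * x p - E k p * (x p - E k p * x p)) -
   (x p - E k.+1 p * x p - E k.+1 p * (x p - E k.+1 p * x p)) :> K).
  by ring.
- apply: val_inj; apply/funext => p; rewrite /= EP e0.
  by change (Kmk cplx 0 0 = 0 :> K); case: (cplx).
- move=> i; have [C C0 [N [k0 H]]] := egrow (region_of i).
  have [q Cq] := exp2_ge C.
  exists (q + N)%N, (maxn k0 1) => k; rewrite geq_max => /andP[kk k1].
  apply: (@le_trans _ _ (C * 2 ^+ (N * k) + 0)).
    apply: flat_sn_bounded; last by rewrite addr0 mulr_ge0 ?exprn_ge0.
      by rewrite reE; exact: H.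
    by rewrite imE => x _ s _; rewrite /in_chart pder0 normr0.
  rewrite addr0 mulnDl exprD ler_wpM2r ?exprn_ge0 //; apply: le_trans Cq _.
  by rewrite ler_weXn2l ?ler1n // leq_pmulr.
- move=> i M; have [C C0 [s [k0 H]]] := edecay (region_of i) M.+1.
  have [s' s'P] := bounded_flat_sn s; have [k1 Ck1] := exp2_ge (C + C).
  exists s', (maxn k0 k1) => k; rewrite geq_max => /andP[kk0 kk1] x B B0 xB.
  have bRe := H k kk0 _ (smooth_re x) (@flat_re x) B
    (fun j js => (s'P x B xB j js).1).
  have bIm := H k kk0 _ (smooth_im x) (@flat_im x) B
    (fun j js => (s'P x B xB j js).2).
  set c := C * 2 ^- (M.+1 * k) * B in bRe bIm.
  have c0 : 0 <= c by rewrite !mulr_ge0 // invr_ge0 exprn_ge0.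
  apply: (@le_trans _ _ (2 ^+ (M * k) * (c + c))).
    rewrite ler_wpM2l ?exprn_ge0 //; apply: flat_sn_bounded; last by rewrite addr_ge0.
      rewrite (_ : re_part _ = fun p => (1 - e k p) * re_part x p) //.
      apply/funext => p; rewrite /re_part.
      change (Kre (x p - E k p * x p) = (1 - e k p) * Kre (x p)); rewrite EP.
      by case: (cplx) (x p) => [[z w]|z] /=; ring.
    rewrite (_ : im_part _ = fun p => (1 - e k p) * im_part x p) //.
    apply/funext => p; rewrite /im_part.
    change (Kim (x p - E k p * x p) = (1 - e k p) * Kim (x p)); rewrite EP.
    by case: (cplx) (x p) => [[z w]|z] /=; ring.
  have -> : 2 ^+ (M * k) * (c + c) = (C + C) / 2 ^+ k * B.
    rewrite /c mulSn exprD; field.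
    by rewrite !expf_neq0.
  rewrite ler_piMl // ler_pdivrMr ?exprn_gt0 // mul1r; apply: le_trans Ck1 _.
  by rewrite ler_weXn2l ?ler1n.
Qed.

End FlatIdeal.

Theorem corollary5p4 (R : realType) (cplx : bool) (m : nat)
    (X : manifold R m) (Y : set X) (hY : closed Y) :
  (forall C : bar_complex (flat_ideal_mul cplx Y),
     exists s : forall n, chom (bar_obj C n) (bar_obj C n.+1),
       contracting_homotopy (bar_d C) s) /\
  (forall S : exact_structure (base_field R cplx),
     homologically_unital S (flat_ideal_mul cplx Y)).
Proof.
have [u [v rs]] := flat_ideal_splitting cplx Y.
have H C := bar_contracting rs C.
split=> // S; apply: contracting_homologically_unital H => x y z.
apply: val_inj; apply/funext => p; exact: mulrA.
Qed.
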